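(* Let $d\in\mathbb N$, $\alpha\ge0$, and let $f$ be a probability density on $\mathbb R^d$ satisfying (C1). Let $\mathcal X_n$ consist of $n$ independent random vectors with density $f$. Then as $n\to\infty$, $$ n^{(\alpha-d)/d}\mathcal G^{d,\alpha}(\mathcal X_n)\xrightarrow{L^2}v_d^{-\alpha/d}\,2^{d+\alpha-1}\,\Gamma(1+\alpha/d)\int_{\mathrm{supp}(f)}f(\mathbf x)^{(d-\alpha)/d}d\mathbf x. $$
   Context: The Gabriel graph on a finite $\mathcal X\subset\mathbb R^d$ joins $\mathbf x,\mathbf y\in\mathcal X$ by an (undirected) edge iff the ball having the segment $\mathbf x\mathbf y$ as a diameter contains no other point of $\mathcal X$. $\mathcal G^{d,\alpha}(\mathcal X)$ is its total power-weighted edge length $\sum_{\text{edges }\{\mathbf u,\mathbf v\}}\|\mathbf u-\mathbf v\|^\alpha$ (Euclidean norm). $v_d=\pi^{d/2}/\Gamma(1+d/2)$ is the volume of the unit $d$-ball. Condition (C1): $f$ is supported by a convex polyhedron in $\mathbb R^d$ and is bounded away from $0$ and $\infty$ on its support; $\mathrm{supp}(f)$ is its support. *)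

(* Defs.v *)
From HB Require Import structures.
From mathcomp Require Import all_boot all_order all_algebra.
From mathcomp Require Import all_classical all_reals all_analysis.
Set Implicit Arguments. Unset Strict Implicit. Unset Printing Implicit Defensive.
Import Order.TTheory GRing.Theory Num.Theory.
Import numFieldNormedType.Exports.
Local Open Scope classical_set_scope.
Local Open Scope ring_scope.

Section Defs.
Variables (R : realType) (d : nat).

Definition pt := 'rV[R]_d.

Definition enorm (x : pt) : R := Num.sqrt (\sum_(i < d) (x ord0 i) ^+ 2).

Definition dotp (x y : pt) : R := \sum_(i < d) x ord0 i * y ord0 i.

Definition Rd := g_sigma_algebraType (@open pt).

Definition box (a b : pt) : set pt :=
  [set x | forall i : 'I_d, a ord0 i <= x ord0 i < b ord0 i].
Definition boxvol (a b : pt) : R := \prod_(i < d) Num.max 0 (b ord0 i - a ord0 i).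

(* d-dimensional Lebesgue (outer) measure: infimum of total volumes of
   countable covers by boxes. On Borel sets this is Lebesgue measure. *)
Definition lebesgue_d (A : set Rd) : \bar R :=
  ereal_inf [set s | exists a b : nat -> pt,
      (A `<=` \bigcup_k box (a k) (b k)) /\
      s = (\sum_(0 <= k <oo) (boxvol (a k) (b k))%:E)%E].

Definition supp (f : pt -> R) : set pt := closure [set x | f x != 0].

Definition convex_polyhedron (K : set pt) : Prop :=
  exists (m : nat) (a : 'I_m -> pt) (b : 'I_m -> R),
    K = [set x | forall j, dotp (a j) x <= b j].

Definition C1 (f : pt -> R) : Prop :=
  convex_polyhedron (supp f) /\
  exists c1 c2 : R, 0 < c1 /\ c1 <= c2 /\
    (forall x, supp f x -> c1 <= f x /\ f x <= c2).

Definition prob_density (f : pt -> R) : Prop :=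
  measurable_fun [set: Rd] (f : Rd -> R) /\ (forall x, 0 <= f x) /\
  (\int[lebesgue_d]_(x in [set: Rd]) (f x)%:E = 1)%E.

Definition gabriel_edge (s : seq pt) (x y : pt) : bool :=
  all (fun z => (z == x) || (z == y) ||
        (enorm (x - y) / 2 < enorm (z - 2^-1 *: (x + y)))) s.

Definition gabriel_weight (alpha : R) (s : seq pt) : R :=
  let u := undup s in
  \sum_(i < size u) \sum_(j < size u | (i < j)%N)
     (if gabriel_edge u (nth 0 u i) (nth 0 u j)
      then enorm (nth 0 u i - nth 0 u j) `^ alpha else 0).

End Defs.

Definition Gamma (R : realType) (s : R) : R :=
  fine (\int[@lebesgue_measure R]_(t in [set t : R | (0 < t)%R])
          ((powR t (s - 1) * expR (- t))%R)%:E)%E.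

Definition vol_ball (R : realType) (d : nat) : R :=
  pi `^ (d%:R / 2) / Gamma (1 + d%:R / 2).

Definition mutually_independent (R : realType) (d : nat)
  (dT : measure_display) (T : measurableType dT) (P : probability T R)
  (X : nat -> T -> Rd R d) : Prop :=
  forall (I : seq nat) (B : nat -> set (Rd R d)),
    uniq I -> (forall i, measurable (B i)) ->
    P (\bigcap_(i in [set i | i \in I]) (X i @^-1` B i)) =
    (\prod_(i <- I) P (X i @^-1` B i))%E.

(* Main.v *)
(* The weight is the sum, over pairs i < j, of |X_i - X_j|^alpha times the
   indicator that no third point lies in the ball with diameter X_i X_j, an
   event of conditional probability (1 - p(X_i, X_j))^(n-2), where p(x, y) is
   the integral of f over that ball.

   First moment: after the substitution y = x + n^(-1/d) z it tends to
   (1/2) int int f(x)^2 |z|^alpha exp (- f(x) v_d |z/2|^d) dx dz. For fixed z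
   the convergence in x holds in L^1, by L^1-continuity of translations, so no
   differentiation theorem is needed; domination in z comes from
   p(x, y) >= c |x - y|^d on the support, which is convex, and bounded because
   its volume is finite.

   Second moment: two edges with a common endpoint contribute O(1/n), and so do
   two edges with |x - z| <= 2 max(|x - y|, |z - t|). All other pairs of edges
   have disjoint balls, and (1 - p - p')^m <= (1 - p)^m (1 - p')^m bounds
   their contribution by the square of the first moment. Hence
   limsup E Y^2 <= L^2 and E (Y - L)^2 = E Y^2 - 2 L E Y + L^2 tends to 0.

   The measure given by box coverings is a measure on Borel sets by
   Caratheodory's criterion; the value of v_d comes from a Gaussian integral. *)
Require Import Defs.
From HB Require Import structures.
From mathcomp Require Import all_boot all_order all_algebra.
From mathcomp Require Import ring lra zify.
From mathcomp Require Import all_classical all_reals all_analysis.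
From mathcomp Require Import measurable_realfun.
Set Implicit Arguments. Unset Strict Implicit. Unset Printing Implicit Defensive.
Import Order.TTheory GRing.Theory Num.Theory.
Import numFieldNormedType.Exports.
Local Open Scope classical_set_scope.
Local Open Scope ring_scope.

(** * Lebesgue measure *)

(** The second moment is only bounded from above, so the dependence between edges is handled by
    inequalities. When two balls overlap, the probability that a point avoids both is no product. It
    is at most the geometric mean of the two separate exponential bounds, which decouples the edges
    at the price of half the decay rate. This loses a constant factor in the rate, so it serves only
    for configurations of lower order; the leading term keeps the exact probabilities, through
    disjointness of the balls. The first moment rests on a Poisson limit with an explicit error,
    [(1 - p)^(n - c)] against [exp (- a)] with [n p] close to [a]; the error is linear in
    [|n p - a|] and can therefore be integrated over [x].

    A comparison of integrals of nonnegative functions asks measurability of the larger function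
    only. This spares most measurability proofs for nested integrals, and also for the weight
    itself, which is replaced by a sum over index pairs off the null set where points coincide. *)

Section BorelRd.
Context {R : realType} {d : nat}.
Local Notation pt := (pt R d).
Local Notation Rd := (Rd R d).

Lemma open_Rd_measurable (A : set Rd) : @open pt A -> measurable A.
Proof. by move=> oA; apply: sub_sigma_algebra. Qed.

Lemma measurable_coord (i : 'I_d) :
  measurable_fun [set: Rd] (fun x : Rd => x ord0 i : R).
Proof.
apply: (measurability (@RGenOpens.G R)); first exact: RGenOpens.measurableE.
move=> _ [_ [p [q ->]] <-]; rewrite setTI; apply: open_Rd_measurable.
by apply: open_comp; [move=> x _; exact: coord_continuous|exact: interval_open].
Qed.

Lemma measurable_box (a b : pt) : measurable (box a b : set Rd).
Proof.
have -> : box a b = \bigcap_(i in [set: 'I_d])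
    ((fun x : Rd => x ord0 i : R) @^-1` `[a ord0 i, b ord0 i[%classic).
  by apply/seteqP; split=> x h i => [_|]; have := h i; rewrite /= in_itv//=; apply.
apply: fin_bigcap_measurable => // i _.
by rewrite -[X in measurable X]setTI; exact: measurable_coord.
Qed.

(** Rational boxes are countably many, and [D] selects the codes whose box lies inside [A]; only the
    coverage of each point of [A] is left to prove. *)
Lemma open_bigcup_box (A : set pt) : open A ->
  exists D : set nat, exists a b : nat -> pt,
    A = \bigcup_(k in D) box (a k) (b k).
Proof.
move=> oA.
pose I := ({ffun 'I_d -> rat} * {ffun 'I_d -> rat})%type.
pose lo (p : I) : pt := \row_i ratr (p.1 i).
pose hi (p : I) : pt := \row_i ratr (p.2 i).
(* Codes that decode to nothing get the box from 0 to 0; this is harmless, since [D] filters by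
   inclusion in [A]. *)
pose dec k : I := odflt ([ffun=> 0], [ffun=> 0]) (unpickle k).
exists [set k | box (lo (dec k)) (hi (dec k)) `<=` A],
  (lo \o dec), (hi \o dec).
apply/seteqP; split=> [x Ax|x [k /= kA]]; last exact: kA.
have /nbhs_ballP[e /= e0 xeA] : nbhs x A by exact: open_nbhs_nbhs.
have P1 i : exists q : rat, x ord0 i - e < ratr q < x ord0 i.
  by have [|q] := @rat_in_itvoo R (x ord0 i - e) (x ord0 i);
    [rewrite ltrBlDr ltrDl|rewrite in_itv => qi; exists q].
have P2 i : exists q : rat, x ord0 i < ratr q < x ord0 i + e.
  by have [|q] := @rat_in_itvoo R (x ord0 i) (x ord0 i + e);
    [rewrite ltrDl|rewrite in_itv => qi; exists q].
have [q1 q1P] := choice P1; have [q2 q2P] := choice P2.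
pose p : I := ([ffun i => q1 i], [ffun i => q2 i]).
have decp : dec (pickle p) = p by rewrite /dec pickleK.
exists (pickle p) => /=; rewrite decp.
  (* Balls of row vectors are balls of the sup norm, so membership is checked coordinate by
     coordinate. *)
  move=> y yp; apply: xeA; split => // i j; rewrite ord1.
  have /= := yp j; rewrite !mxE !ffunE => /andP[].
  have /andP[] := q1P j; have /andP[] := q2P j.
  rewrite -ball_normE/= => h1 h2 h3 h4 h5 h6; rewrite ltr_norml; apply/andP; split; lra.
move=> i; rewrite !mxE !ffunE; have /andP[_ /ltW->] := q1P i.
by have /andP[-> _] := q2P i.
Qed.

Lemma measurable_fun_Rd dT (T : measurableType dT) (f : T -> Rd) :
  (forall i, measurable_fun [set: T] (fun w => f w ord0 i : R)) ->
  measurable_fun [set: T] f.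
Proof.
move=> mf; apply: (@measurability _ _ T Rd _ f (@open pt)) => // _ [B oB <-].
have [D [a [b ->]]] := open_bigcup_box oB.
rewrite setTI preimage_bigcup; apply: bigcup_measurable => k _.
have -> : f @^-1` box (a k) (b k) = \bigcap_(i in [set: 'I_d])
    ((fun w => f w ord0 i : R) @^-1` `[a k ord0 i, b k ord0 i[%classic).
  by apply/seteqP; split=> x h i => [_|]; have := h i; rewrite /= in_itv//=; apply.
apply: fin_bigcap_measurable => // i _.
by rewrite -[X in measurable X]setTI; exact: mf.
Qed.

End BorelRd.

(** * The outer measure defined by box covers *)

Section OuterMeasure.
Context {R : realType} {d : nat}.
Local Notation pt := (pt R d).
Local Notation Rd := (Rd R d).
Local Notation lebd := (@lebesgue_d R d).
Local Open Scope ereal_scope.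

Lemma boxvol_ge0 (a b : pt) : (0 <= boxvol a b)%R.
Proof. by apply: prodr_ge0 => i _; rewrite le_max lexx. Qed.

Lemma lebesgue_d_ge0 A : 0 <= lebd A.
Proof.
apply/le_ereal_inf_tmp => _ [a [b [_ ->]]].
by apply: nneseries_ge0 => k _ _; rewrite lee_fin boxvol_ge0.
Qed.

Lemma le_lebesgue_d : {homo lebd : A B / A `<=` B >-> A <= B}.
Proof.
move=> A B AB; apply/le_ereal_inf_tmp => _ [a [b [Bab ->]]].
by apply: ereal_inf_lbound; exists a, b; split => //; exact: subset_trans Bab.
Qed.

(** A doubly indexed cover becomes a sequence through a bijection between [nat] and its square;
    nonnegativity permits the rearrangement of the sum. *)
Lemma lebesgue_d_le_esum (A : set pt) (a b : nat -> nat -> pt) :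
  A `<=` \bigcup_k \bigcup_l box (a k l) (b k l) ->
  lebd A <= \sum_(k <oo) \sum_(l <oo) (boxvol (a k l) (b k l))%:E.
Proof.
move=> Aab.
have vge0 (c e : pt) : 0 <= (boxvol c e)%:E by rewrite lee_fin boxvol_ge0.
rewrite nneseries_esumT; last by move=> k; apply: nneseries_ge0.
under eq_esum do rewrite nneseries_esumT//.
rewrite esum_esum//.
have /card_esym/ppcard_eqP[f] := card_nat2.
rewrite (_ : _ `*`` _ = [set: nat * nat]); last by apply/seteqP; split.
rewrite (reindex_esum [set: nat] _ f)// -nneseries_esumT//.
apply: ereal_inf_lbound.
exists (fun n => a (f n).1 (f n).2), (fun n => b (f n).1 (f n).2); split=> //.
apply: (subset_trans Aab) => x [k _ [l _ xkl]].
by exists (f^-1%FUN (k, l)) => //=; rewrite invK ?inE.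
Qed.

(** A cover is an infinite sequence, so the box is padded with boxes whose corners coincide. These
    have volume 0 only for [d > 0]: in dimension 0 the empty product gives each of them volume 1. *)
Lemma lebesgue_d_box_le (a b : pt) : (0 < d)%N ->
  lebd (box a b) <= (boxvol a b)%:E.
Proof.
move=> d0; apply: ereal_inf_lbound.
exists (fun k => if k is 0%N then a else 0%R), (fun k => if k is 0%N then b else 0%R).
split; first by move=> x abx; exists 0%N.
have boxvol0 : boxvol (0 : pt)%R 0%R = 0%R :> R.
  rewrite /boxvol; case: d d0 => // n _.
  by rewrite big_ord_recl !mxE subrr maxxx mul0r.
rewrite nneseries_recl//; last by move=> *; rewrite lee_fin boxvol_ge0.
rewrite eseries_cond/= eseries0 ?adde0// => -[|]//= k _ _.
by rewrite boxvol0.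
Qed.

Lemma lebesgue_d_sigma_subadditive : sigma_subadditive lebd.
Proof.
move=> A; have [[i ioo]|] := pselect (exists i, lebd (A i) = +oo).
  rewrite (eseries_pinfty _ _ ioo) ?leey// => n _.
  by rewrite -ltNye (lt_le_trans _ (lebesgue_d_ge0 _)).
rewrite -forallNE => Aoo.
apply/lee_addgt0Pr => e e0.
apply: le_trans (epsilon_trick _ (fun n => lebesgue_d_ge0 (A n)) (ltW e0)).
have covers n : exists ab : (nat -> pt) * (nat -> pt),
    A n `<=` \bigcup_k box (ab.1 k) (ab.2 k) /\
    \sum_(k <oo) (boxvol (ab.1 k) (ab.2 k))%:E <=
      lebd (A n) + (e / (2 ^ n.+1)%:R)%:E.
  have fA : lebd (A n) \is a fin_num.
    by rewrite ge0_fin_numE ?lebesgue_d_ge0// ltey; apply/eqP.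
  have en : (0 < e / (2 ^ n.+1)%:R)%R by rewrite divr_gt0// ltr0n expn_gt0.
  have [_ [a [b [Aab ->]]] /ltW abA] := lb_ereal_inf_adherent en fA.
  by exists (a, b).
have [ab abP] := choice covers.
apply: (@le_trans _ _
  (\sum_(n <oo) \sum_(k <oo) (boxvol ((ab n).1 k) ((ab n).2 k))%:E)).
  apply: (@lebesgue_d_le_esum _ (fun n => (ab n).1) (fun n => (ab n).2)).
  by move=> x [n _ /(abP n).1[k _ xk]]; exists n => //; exists k.
apply: lee_nneseries => n _; last exact: (abP n).2.
by move=> _; apply: nneseries_ge0 => k _ _; rewrite lee_fin boxvol_ge0.
Qed.

End OuterMeasure.

Section LebesgueMeasure.
Context {R : realType} {d' : nat}.
Local Notation d := d'.+1.
Local Notation pt := (pt R d).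
Local Notation Rd := (Rd R d).
Local Notation lebd := (@lebesgue_d R d).
Local Open Scope ereal_scope.

Lemma lebesgue_d0 : lebd set0 = 0.
Proof.
apply/eqP; rewrite eq_le lebesgue_d_ge0 andbT.
apply: (@le_trans _ _ (lebd (box (0 : pt)%R 0%R))).
  by apply: le_lebesgue_d => x.
apply: (le_trans (lebesgue_d_box_le _ _ _)) => //.
by rewrite /boxvol big_ord_recl !mxE subrr maxxx mul0r.
Qed.

End LebesgueMeasure.

HB.instance Definition _ (R : realType) (d : nat) :=
  isOuterMeasure.Build R (Rd R d.+1) (@lebesgue_d R d.+1)
    (@lebesgue_d0 R d) (@lebesgue_d_ge0 R d.+1) (@le_lebesgue_d R d.+1)
    (@lebesgue_d_sigma_subadditive R d.+1).

(** * Caratheodory's criterion and countable additivity on Borel sets *)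

Section LebesgueMeasure.
Context {R : realType} {d' : nat}.
Local Notation d := d'.+1.
Local Notation pt := (pt R d).
Local Notation Rd := (Rd R d).
Local Notation lebd := (@lebesgue_d R d).
Local Open Scope ereal_scope.

Let upd (x : pt) (i : 'I_d) (c : R) : pt :=
  \row_j (if j == i then c else x ord0 j).

(** The truncation at 0 in [boxvol] makes this valid wherever [c] lies: if the hyperplane misses the
    box, one piece has volume 0 and the other is the whole box. *)
Lemma boxvol_split (a b : pt) (i : 'I_d) (c : R) :
  (boxvol a b = boxvol a (upd b i (Num.min (b ord0 i) c)) +
                boxvol (upd a i (Num.max (a ord0 i) c)) b)%R.
Proof.
have E (s t : pt) : (boxvol s t = Num.max 0 (t ord0 i - s ord0 i) *
    \prod_(j | j != i) Num.max 0 (t ord0 j - s ord0 j))%R.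
  by rewrite /boxvol (bigD1 i).
rewrite !E !mxE !eqxx.
under [X in (_ = _ * X + _)%R]eq_bigr => j ji do rewrite !mxE (negbTE ji).
under [X in (_ = _ + _ * X)%R]eq_bigr => j ji do rewrite !mxE (negbTE ji).
rewrite -mulrDl; congr (_ * _)%R.
move: (a ord0 i) (b ord0 i) => s t.
rewrite /Num.max /Num.min /Order.max /Order.min.
by repeat case: ifPn; rewrite ?subr_gt0 ?subr_lt0 -?leNgt -?ltNge; lra.
Qed.

(** Cutting every box of a cover along the hyperplane splits its cost exactly. As boxes are closed
    below and open above, the pieces cover the parts [x_i < c] and [x_i >= c] with nothing left
    over. *)
Lemma caratheodory_halfspace (i : 'I_d) (c : R) :
  lebd.-caratheodory [set x : Rd | (x ord0 i < c)%R].
Proof.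
apply: le_caratheodory_measurable => X.
set H := [set x : Rd | (x ord0 i < c)%R].
apply/le_ereal_inf_tmp => _ [a [b [Xab ->]]].
pose b' k := upd (b k) i (Num.min (b k ord0 i) c).
pose a' k := upd (a k) i (Num.max (a k ord0 i) c).
have -> : \sum_(k <oo) (boxvol (a k) (b k))%:E =
    \sum_(k <oo) (boxvol (a k) (b' k))%:E + \sum_(k <oo) (boxvol (a' k) (b k))%:E.
  rewrite -nneseriesD; last 2 first.
  - by move=> k _; rewrite lee_fin boxvol_ge0.
  - by move=> k _; rewrite lee_fin boxvol_ge0.
  by apply: eq_eseriesr => k _; rewrite -EFinD -boxvol_split.
apply: leeD; apply: ereal_inf_lbound.
  exists a, b'; split=> // x [/Xab[k _ xk] Hx]; exists k => // j.
  rewrite mxE; case: eqP => [->|_]; last exact: xk.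
  have /andP[-> xb] := xk i; by rewrite lt_min xb.
exists a', b; split=> // x [/Xab[k _ xk] /negP]; rewrite -leNgt => Hx.
exists k => // j.
rewrite mxE; case: eqP => [->|_]; last exact: xk.
have /andP[xa ->] := xk i; by rewrite ge_max xa Hx.
Qed.

(** A box is a finite intersection of differences of half-spaces and an open set is a countable
    union of boxes; the Caratheodory sets form a sigma-algebra. *)
Lemma Rd_measurable_caratheodory (A : set Rd) :
  measurable A -> lebd.-caratheodory A.
Proof.
pose mu : {outer_measure set Rd -> \bar R} := lebd.
have cara_box (a b : pt) : (mu).-cara.-measurable (box a b).
  have -> : box a b = \bigcap_(i in [set: 'I_d])
      ([set x : Rd | (x ord0 i < b ord0 i)%R] `\` [set x : Rd | (x ord0 i < a ord0 i)%R]).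
    apply/seteqP; split=> x h i.
      by move=> _ /=; have /andP[ax ->] := h i; split => //; apply/negP; rewrite -leNgt.
    by have [] := h i I; rewrite /= => -> /negP; rewrite -leNgt => ->.
  apply: fin_bigcap_measurable => // i _; apply: measurableD;
    exact: caratheodory_halfspace.
move=> mA; suff : (mu).-cara.-measurable A by [].
move: A mA; apply: smallest_sub; first by split;
  [exact: measurable0|by move=> *; apply: measurableD|by move=> *; apply: bigcupT_measurable].
move=> A oA.
have [D [a [b ->]]] := open_bigcup_box oA.
by apply: bigcup_measurable => k _; exact: cara_box.
Qed.

Lemma lebesgue_d_sigma_additive : semi_sigma_additive (lebd : set Rd -> \bar R).
Proof.
move=> A mA tA mbigcupA.
apply: (@caratheodory_measure_sigma_additive R Rd lebd) => //.
  by move=> i; exact: Rd_measurable_caratheodory.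
exact: (@Rd_measurable_caratheodory).
Qed.

End LebesgueMeasure.

HB.instance Definition _ (R : realType) (d : nat) :=
  isMeasure.Build _ (Rd R d.+1) R (@lebesgue_d R d.+1)
    (@lebesgue_d0 R d) (@lebesgue_d_ge0 R d.+1)
    (@lebesgue_d_sigma_additive R d).

Section SigmaFinite.
Context {R : realType} {d' : nat}.
Local Notation d := d'.+1.
Local Notation pt := (pt R d).
Local Notation Rd := (Rd R d).
Local Notation lebd := (@lebesgue_d R d).

Definition cube (k : nat) : set Rd := box (const_mx (- k%:R) : pt) (const_mx k%:R).

Lemma measurable_cube k : measurable (cube k).
Proof. exact: measurable_box. Qed.

Lemma bigcup_cube : \bigcup_k cube k = [set: Rd].
Proof.
apply/seteqP; split=> // x _.
exists (\max_(i < d) (Num.truncn `|x ord0 i|).+1)%N => // i; rewrite !mxE.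
have xi : `|x ord0 i| < (\max_(i < d) (Num.truncn `|x ord0 i|).+1)%:R.
  apply: lt_le_trans (truncnS_gt _) _; rewrite ler_nat.
  exact: (leq_bigmax (F := fun i : 'I_d => (Num.truncn `|x ord0 i|).+1) i).
by move: xi; rewrite ltr_norml => /andP[/ltW -> ->].
Qed.

Lemma lebesgue_d_box_lty (a b : pt) : (lebd (box a b) < +oo)%E.
Proof. by apply: le_lt_trans (lebesgue_d_box_le _ _ _) _; rewrite ?ltry. Qed.

Lemma lebesgue_d_sigma_finite : sigma_finite [set: Rd] lebd.
Proof.
exists cube; first by rewrite bigcup_cube.
by move=> k; split; [exact: measurable_cube|exact: lebesgue_d_box_lty].
Qed.

End SigmaFinite.

HB.instance Definition _ (R : realType) (d : nat) :=
  Measure_isSigmaFinite.Build _ (Rd R d.+1) R (@lebesgue_d R d.+1)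
    (@lebesgue_d_sigma_finite R d).

(** * Uniqueness of the measure with given box volumes *)

Section LebesgueUnique.
Context {R : realType} {d' : nat}.
Local Notation d := d'.+1.
Local Notation pt := (pt R d).
Local Notation Rd := (Rd R d).
Local Notation lebd := (@lebesgue_d R d).
Local Open Scope ereal_scope.

Definition boxes : set (set Rd) := [set A | exists a b : pt, A = box a b].

Lemma boxes_measurableE : @measurable _ Rd = <<s boxes >>.
Proof.
apply/seteqP; split; last first.
  apply: smallest_sub; first exact: sigma_algebra_measurable.
  by move=> _ [a [b ->]]; exact: measurable_box.
apply: smallest_sub; first exact: smallest_sigma_algebra.
move=> A oA; have [D [a [b ->]]] := open_bigcup_box oA.
apply: (@bigcup_measurable _ (g_sigma_algebraType boxes)) => k _.
by apply: sub_sigma_algebra; exists (a k), (b k).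
Qed.

Lemma boxes_setI : setI_closed boxes.
Proof.
move=> _ _ [a [b ->]] [a' [b' ->]].
exists (\row_i Num.max (a ord0 i) (a' ord0 i))%R, (\row_i Num.min (b ord0 i) (b' ord0 i))%R.
apply/seteqP; split=> [x [h1 h2] i|x h].
  rewrite !mxE ge_max lt_min.
  by have /andP[-> ->] := h1 i; have /andP[-> ->] := h2 i.
by split=> i; have := h i; rewrite !mxE ge_max lt_min => /andP[/andP[? ?] /andP[? ?]]; apply/andP.
Qed.

Section Unique.
Variable m : {measure set Rd -> \bar R}.
Hypothesis mbox : forall a b : pt, m (box a b) = (boxvol a b)%:E.

Let mle A : measurable A -> m A <= lebd A.
Proof.
move=> mA; apply/le_ereal_inf_tmp => _ [a [b [Aab ->]]].
under eq_eseriesr do rewrite -mbox.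
by apply: measure_sigma_subadditive => // k; exact: measurable_box.
Qed.

(** That a box has no cover cheaper than its volume is usually a compactness argument. Here it
    follows from the existence of a single measure [m] with the right values: countable
    subadditivity over covers gives [m <= lebd]. *)
Lemma lebesgue_d_box_of_measure (a b : pt) : lebd (box a b) = (boxvol a b)%:E.
Proof.
apply/eqP; rewrite eq_le lebesgue_d_box_le//= -mbox; apply: mle.
exact: measurable_box.
Qed.

Lemma lebesgue_d_unique A : measurable A -> m A = lebd A.
Proof.
apply: (measure_unique boxes cube).
- exact: boxes_measurableE.
- exact: boxes_setI.
- by move=> k; exists (const_mx (- k%:R)%R), (const_mx k%:R)%R.
- exact: bigcup_cube.
- by move=> _ [a [b ->]]; rewrite mbox; exact/esym/lebesgue_d_box_of_measure.
- by move=> k; rewrite mbox ltry.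
Qed.

End Unique.

End LebesgueUnique.

(** * Volumes of boxes and integration one coordinate at a time *)

Section BoxVolume.
Context {R : realType}.
Local Notation mu := (@lebesgue_measure R).
Local Open Scope ereal_scope.

Lemma lebesgue_measure_co (a b : R) :
  mu `[a, b[%classic = (Num.max 0 (b - a))%:E.
Proof.
rewrite lebesgue_measure_itv/= lte_fin /Num.max /Order.max -subr_gt0.
by case: ifP.
Qed.

Definition row1 (t : R) : Rd R 1 := (const_mx t)%R.

Lemma measurable_row1 : measurable_fun [set: R] row1.
Proof.
apply: measurable_fun_Rd => i.
by apply: (eq_measurable_fun id) => // t _; rewrite mxE.
Qed.

(** The scalar goes to coordinate 0, so that [big_ord_recl] splits it off in sums and products. *)
Definition rcons_row (d : nat) (p : R * Rd R d) : Rd R d.+1 :=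
  (\row_i oapp (p.2 ord0) p.1 (unlift ord0 i))%R.

Lemma measurable_rcons_row d : measurable_fun [set: R * Rd R d] (@rcons_row d).
Proof.
apply: measurable_fun_Rd => i.
under eq_fun do rewrite mxE.
case: (unlift ord0 i) => [j|] /=; last exact: measurable_fst.
by apply: (measurableT_comp (measurable_coord j)); exact: measurable_snd.
Qed.

Lemma row1_box (a b : pt R 1) :
  pushforward mu row1 (box a b) = (boxvol a b)%:E.
Proof.
rewrite /pushforward.
have -> : row1 @^-1` box a b = `[a ord0 ord0, b ord0 ord0[%classic.
  apply/seteqP; split=> t /=; rewrite in_itv/=; first by move/(_ ord0); rewrite mxE.
  by move=> h; rewrite /box/= => i; rewrite mxE (ord1 i); exact: h.
by rewrite lebesgue_measure_co /boxvol big_ord_recl big_ord0 mulr1.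
Qed.

Lemma rcons_row_box (d : nat) (a b : pt R d.+2) :
  (forall a b : pt R d.+1, lebesgue_d (box a b) = (boxvol a b)%:E) ->
  pushforward (mu \x @lebesgue_d R d.+1) (@rcons_row d.+1) (box a b) =
  (boxvol a b)%:E.
Proof.
move=> IH; rewrite /pushforward.
pose tl (x : pt R d.+2) : pt R d.+1 := (\row_j x ord0 (lift ord0 j))%R.
have -> : @rcons_row d.+1 @^-1` box a b =
    `[a ord0 ord0, b ord0 ord0[%classic `*` box (tl a) (tl b).
  apply/seteqP; split=> -[t x] /=.
    move=> h; split; first by have := h ord0; rewrite mxE unlift_none/= in_itv.
    by move=> i; have := h (lift ord0 i); rewrite !mxE liftK.
  move=> [h1 h2] i; rewrite mxE; case: unliftP => [j ->|->] /=.
    by have := h2 j; rewrite !mxE.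
  by move: h1; rewrite in_itv.
rewrite product_measure1E//; last exact: measurable_box.
rewrite [X in _ * X](_ : _ = (boxvol (tl a) (tl b))%:E); last exact: IH.
rewrite [X in X * _](_ : _ = (Num.max 0 (b ord0 ord0 - a ord0 ord0))%:E);
  last exact: lebesgue_measure_co.
rewrite -EFinM /boxvol [in RHS]big_ord_recl.
by congr (_ * _)%:E; apply: eq_bigr => j _; rewrite !mxE.
Qed.

(** Induction on the dimension supplies the measure that [lebesgue_d_box_of_measure] asks for: an
    image of the Lebesgue measure of the line, then of its product with the measure one dimension
    lower. *)
Lemma lebesgue_d_box (d : nat) (a b : pt R d.+1) :
  lebesgue_d (box a b) = (boxvol a b)%:E.
Proof.
elim: d a b => [|d IH] a b.
  pose m : {measure set (Rd R 1) -> \bar R} := pushforward mu row1.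
  exact: (@lebesgue_d_box_of_measure _ _ (m measurable_row1) row1_box).
pose m : {measure set (Rd R d.+2) -> \bar R} :=
  pushforward (mu \x @lebesgue_d R d.+1) (@rcons_row d.+1).
apply: (@lebesgue_d_box_of_measure _ _ (m (@measurable_rcons_row d.+1))).
by move=> a' b'; exact: rcons_row_box.
Qed.

Lemma ge0_integral_lebesgue_d1 (g : Rd R 1 -> \bar R) :
  measurable_fun setT g -> (forall x, 0 <= g x) ->
  \int[@lebesgue_d R 1]_x g x = \int[mu]_t g (row1 t).
Proof.
move=> mg g0.
pose m : {measure set (Rd R 1) -> \bar R} := pushforward mu row1.
rewrite -(@eq_measure_integral _ _ _ _ _ (m measurable_row1)); last first.
  by move=> A mA _; apply: lebesgue_d_unique => //; exact: row1_box.
by rewrite ge0_integral_pushforward//; exact: measurable_row1.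
Qed.

Lemma ge0_integral_lebesgue_dS (d : nat) (g : Rd R d.+2 -> \bar R) :
  measurable_fun setT g -> (forall x, 0 <= g x) ->
  \int[@lebesgue_d R d.+2]_x g x =
  \int[mu]_t \int[@lebesgue_d R d.+1]_x g (rcons_row (t, x)).
Proof.
move=> mg g0.
pose m : {measure set (Rd R d.+2) -> \bar R} :=
  pushforward (mu \x @lebesgue_d R d.+1) (@rcons_row d.+1).
rewrite -(@eq_measure_integral _ _ _ _ _ (m (@measurable_rcons_row d.+1))); last first.
  move=> A mA _; apply: lebesgue_d_unique => // a b; apply: rcons_row_box.
  exact: lebesgue_d_box.
rewrite ge0_integral_pushforward//; last exact: measurable_rcons_row.
rewrite preimage_setT fubini_tonelli1//; last by move=> x; exact: g0.
by apply: measurableT_comp => //; exact: measurable_rcons_row.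
Qed.

(** The Gaussian factorizes over the coordinates. The volume of the unit ball is found by computing
    this integral a second time, by layers. *)
Lemma integral_lebesgue_d_gauss (d : nat) :
  \int[@lebesgue_d R d.+1]_x (expR (- \sum_i x ord0 i ^+ 2))%:E =
  (Num.sqrt pi ^+ d.+1)%:E.
Proof.
have mg n : measurable_fun [set: Rd R n.+1]
    (fun x : Rd R n.+1 => (expR (- \sum_i x ord0 i ^+ 2))%:E).
  apply/measurable_EFinP; apply: measurableT_comp => //.
  apply: (measurableT_comp (@oppr_measurable R setT)).
  by apply: measurable_sum => i; apply: measurable_funX; exact: measurable_coord.
have g0 n (x : Rd R n.+1) : 0 <= (expR (- \sum_i x ord0 i ^+ 2))%:E.
  by rewrite lee_fin expR_ge0.
elim: d => [|d IH].
  rewrite ge0_integral_lebesgue_d1// expr1 -integralT_gauss.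
  by apply: eq_integral => t _; rewrite big_ord_recl big_ord0 addr0 mxE.
rewrite ge0_integral_lebesgue_dS//.
have inner t : \int[@lebesgue_d R d.+1]_x
    (expR (- \sum_i (rcons_row (t, x)) ord0 i ^+ 2))%:E =
    (gauss_fun t)%:E * (Num.sqrt pi ^+ d.+1)%:E.
  rewrite -IH -ge0_integralZl_EFin//; last exact: expR_ge0.
  apply: eq_integral => x _; rewrite big_ord_recl mxE unlift_none/= opprD expRD EFinM.
  by under eq_bigr do rewrite mxE liftK/=.
under eq_integral do rewrite inner.
have mgauss : measurable_fun [set: R] (fun t : R => (gauss_fun t)%:E).
  by apply/measurable_EFinP; exact: measurable_gauss_fun.
rewrite ge0_integralZr//; last by move=> t _; rewrite lee_fin gauss_fun_ge0.
  by rewrite integralT_gauss -EFinM -exprS.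
Qed.

End BoxVolume.

(** * Balls and radial integrals *)

Section Affine.
Context {R : realType} {d' : nat}.
Local Notation d := d'.+1.
Local Notation pt := (pt R d).
Local Notation Rd := (Rd R d).
Local Notation lebd := (@lebesgue_d R d).
Local Open Scope ereal_scope.

Definition affine (c : R) (v : pt) (x : Rd) : Rd := (c *: x + v)%R.

Lemma measurable_affine c v : measurable_fun [set: Rd] (affine c v).
Proof.
apply: measurable_fun_Rd => i.
under eq_fun do rewrite !mxE.
apply: measurable_funD => //; apply: measurable_funM => //.
exact: measurable_coord.
Qed.

(** Boxes pull back to boxes with volume divided by [c ^ d], so a cover of [A] yields a cover of its
    preimage. *)
Let affine_le (c : R) (v : pt) (A : set pt) : (0 < c)%R ->
  (c ^+ d)%:E * lebd (affine c v @^-1` A) <= lebd A.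
Proof.
move=> c0; apply/le_ereal_inf_tmp => _ [a [b [Aab ->]]].
have cd0 : (0 < c ^+ d)%R by rewrite exprn_gt0.
rewrite -(invrK (c ^+ d)%R) lee_pdivrMl ?invr_gt0//.
pose g (x : pt) : pt := (c^-1 *: (x - v))%R.
rewrite -nneseriesZl; last by move=> k _; rewrite lee_fin boxvol_ge0.
apply: ereal_inf_lbound; exists (g \o a), (g \o b); split.
  move=> x /Aab[k _ xk]; exists k => // i.
  by have := xk i; rewrite !mxE ler_pdivrMl// ltr_pdivlMl// lerBlDr ltrBrDr.
apply: eq_eseriesr => k _; rewrite -EFinM; congr (_%:E).
rewrite /boxvol -[X in (c ^+ X)^-1%R]card_ord -prodr_const -prodfV -big_split/=.
apply: eq_bigr => i _; rewrite !mxE -mulrBr maxr_pMr ?invr_ge0 ?(ltW c0)// mulr0.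
by congr (Num.max _ (_ * _))%R; ring.
Qed.

Lemma lebesgue_d_affine (c : R) (v : pt) (A : set pt) : (0 < c)%R ->
  lebd (affine c v @^-1` A) = (c ^- d)%:E * lebd A.
Proof.
move=> c0; have cd0 : (0 < c ^+ d)%R by rewrite exprn_gt0.
apply/eqP; rewrite eq_le; apply/andP; split.
  by rewrite -lee_pdivrMl ?invr_gt0// invrK affine_le.
(* The reverse inequality is the same bound for the inverse map, again affine with positive
   ratio. *)
have := @affine_le c^-1 (- (c^-1 *: v))%R (affine c v @^-1` A).
rewrite invr_gt0 exprVn => /(_ c0); rewrite (_ : _ @^-1` _ = A)//.
rewrite -comp_preimage (_ : _ \o _ = id) ?preimage_id//.
apply/funext => x /=; rewrite /affine scalerDr scalerN !scalerA divff ?gt_eqF//.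
by rewrite !scale1r subrK.
Qed.

Lemma ge0_integral_affine (c : R) (v : pt) (g : Rd -> \bar R) : (0 < c)%R ->
  measurable_fun setT g -> (forall x, 0 <= g x) ->
  \int[lebd]_x g (affine c v x) = (c ^- d)%:E * \int[lebd]_x g x.
Proof.
move=> c0 mg g0.
have k0 : (0 <= c ^- d)%R by rewrite invr_ge0 exprn_ge0// ltW.
have <- : \int[mscale (NngNum k0) lebd]_x g x = (c ^- d)%:E * \int[lebd]_x g x.
  by rewrite ge0_integral_mscale.
pose m : {measure set Rd -> \bar R} := pushforward lebd (affine c v).
transitivity (\int[m (@measurable_affine c v)]_x g x).
  by rewrite ge0_integral_pushforward//; exact: measurable_affine.
apply: eq_measure_integral => A mA _.
by rewrite /m/= /pushforward/= lebesgue_d_affine.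
Qed.

End Affine.

(** * The Euclidean norm *)

Section Norm.
Context {R : realType} {d : nat}.
Local Notation pt := (pt R d).
Local Notation Rd := (Rd R d).
Implicit Types x y : pt.

Lemma sum_sqr_ge0 x : 0 <= \sum_(i < d) x ord0 i ^+ 2.
Proof. by apply: sumr_ge0 => i _; exact: sqr_ge0. Qed.

Lemma enorm_ge0 x : 0 <= enorm x. Proof. exact: sqrtr_ge0. Qed.

Lemma enorm_sqr x : enorm x ^+ 2 = \sum_(i < d) x ord0 i ^+ 2.
Proof. by rewrite sqr_sqrtr// sum_sqr_ge0. Qed.

Lemma enormZ (c : R) x : enorm (c *: x) = `|c| * enorm x.
Proof.
rewrite /enorm -sqrtr_sqr -sqrtrM ?sqr_ge0// mulr_sumr.
by congr Num.sqrt; apply: eq_bigr => i _; rewrite mxE exprMn.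
Qed.

Lemma enormN x : enorm (- x) = enorm x.
Proof. by rewrite -scaleN1r enormZ normrN1 mul1r. Qed.

Lemma enorm_distC x y : enorm (x - y) = enorm (y - x).
Proof. by rewrite -enormN opprB. Qed.

Lemma enorm_eq0 x : (enorm x == 0) = (x == 0).
Proof.
apply/idP/idP => [|/eqP ->]; last first.
  by rewrite -sqrf_eq0 enorm_sqr big1// => i _; rewrite mxE expr0n.
rewrite -sqrf_eq0 enorm_sqr psumr_eq0 => [/allP h|i _]; last exact: sqr_ge0.
apply/eqP/rowP => i; rewrite mxE; have := h i; rewrite mem_index_enum sqrf_eq0.
by move=> /(_ isT)/eqP.
Qed.

Lemma coord_le_enorm x i : `|x ord0 i| <= enorm x.
Proof.
rewrite -sqrtr_sqr ler_sqrt ?sqr_ge0 ?sum_sqr_ge0//.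
by rewrite (bigD1 i)//= lerDl sumr_ge0// => j _; exact: sqr_ge0.
Qed.

Lemma enorm_triangle x y : enorm (x + y) <= enorm x + enorm y.
Proof.
rewrite -ler_sqr ?nnegrE ?addr_ge0 ?enorm_ge0// sqrrD !enorm_sqr.
have cauchy : \sum_i x ord0 i * y ord0 i <= enorm x * enorm y.
  have [y0|y0] := eqVneq (enorm y) 0.
    rewrite y0 mulr0; move/eqP: y0; rewrite enorm_eq0 => /eqP ->.
    by rewrite big1// => i _; rewrite mxE mulr0.
  have [x0|x0] := eqVneq (enorm x) 0.
    rewrite x0 mul0r; move/eqP: x0; rewrite enorm_eq0 => /eqP ->.
    by rewrite big1// => i _; rewrite mxE mul0r.
  have xp : 0 < enorm x by rewrite lt_def x0 enorm_ge0.
  have yp : 0 < enorm y by rewrite lt_def y0 enorm_ge0.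
  (* For nonzero vectors Cauchy-Schwarz is the expansion of this sum of squares, divided by
     [2 |x| |y|]. *)
  have : 0 <= \sum_i (enorm y * x ord0 i - enorm x * y ord0 i) ^+ 2.
    by apply: sumr_ge0 => i _; exact: sqr_ge0.
  have -> : \sum_i (enorm y * x ord0 i - enorm x * y ord0 i) ^+ 2 =
     2 * (enorm x * enorm y) * (enorm x * enorm y - \sum_i x ord0 i * y ord0 i).
    transitivity (enorm y ^+ 2 * \sum_i x ord0 i ^+ 2 +
      enorm x ^+ 2 * \sum_i y ord0 i ^+ 2 -
      2 * (enorm x * enorm y) * \sum_i x ord0 i * y ord0 i).
      rewrite !mulr_sumr -big_split -sumrB/=; apply: eq_bigr => i _; ring.
    by rewrite -!enorm_sqr; ring.
  by rewrite pmulr_rge0 ?subr_ge0// !mulr_gt0.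
have -> : \sum_i (x + y) ord0 i ^+ 2 =
  \sum_i x ord0 i ^+ 2 + \sum_i y ord0 i ^+ 2 + 2 * \sum_i x ord0 i * y ord0 i.
  by rewrite mulr_sumr -!big_split/=; apply: eq_bigr => i _; rewrite mxE; ring.
lra.
Qed.

Lemma measurable_enorm : measurable_fun [set: Rd] (@enorm R d : Rd -> R).
Proof.
have msqrt : measurable_fun [set: R] (Num.sqrt : R -> R).
  by apply: continuous_measurable_fun; exact: sqrt_continuous.
apply: (measurableT_comp msqrt).
by apply: measurable_sum => i; apply: measurable_funX; exact: measurable_coord.
Qed.

Section Composite.
Context dT (T : measurableType dT) (f g : T -> Rd).
Hypotheses (mf : measurable_fun [set: T] f) (mg : measurable_fun [set: T] g).

Lemma measurable_RdD : measurable_fun [set: T] (fun w => (f w + g w)%R : Rd).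
Proof.
apply: measurable_fun_Rd => i; under eq_fun do rewrite mxE.
by apply: measurable_funD; exact: (measurableT_comp (measurable_coord i)).
Qed.

Lemma measurable_RdZ (c : T -> R) : measurable_fun [set: T] c ->
  measurable_fun [set: T] (fun w => (c w *: f w)%R : Rd).
Proof.
move=> mc; apply: measurable_fun_Rd => i; under eq_fun do rewrite mxE.
by apply: measurable_funM => //; exact: (measurableT_comp (measurable_coord i)).
Qed.

Lemma measurable_RdB : measurable_fun [set: T] (fun w => (f w - g w)%R : Rd).
Proof.
apply: measurable_fun_Rd => i; under eq_fun do rewrite !mxE.
by apply: measurable_funB; exact: (measurableT_comp (measurable_coord i)).
Qed.

End Composite.

End Norm.

Lemma ge0_integral_mrestr dT (T : measurableType dT) (R : realType)
    (mu : {measure set T -> \bar R}) (D : set T) (mD : measurable D)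
    (g : T -> \bar R) :
  measurable_fun setT g -> (forall x, 0 <= g x)%E ->
  (\int[mrestr mu mD]_x g x = \int[mu]_(x in D) g x)%E.
Proof.
move=> mg g0; rewrite -(setUv D) ge0_integral_setU//=; last 3 first.
- exact: measurableC.
- by rewrite setUv.
- exact/disj_setPCl.
rewrite (@eq_measure_integral _ _ _ D mu); last first.
  by move=> A mA AD; rewrite /= /mrestr setIidl.
rewrite (@eq_measure_integral _ _ _ (~` D) mzero); last first.
  move=> A mA AD; rewrite /= /mrestr /mzero (_ : A `&` D = set0) ?measure0//.
  exact/disjoints_subset.
by rewrite integral_measure_zero adde0.
Qed.

(** * Integrals of radial functions *)

Section Radial.
Context {R : realType} {d' : nat}.
Local Notation d := d'.+1.
Local Notation pt := (pt R d).
Local Notation Rd := (Rd R d).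
Local Notation lebd := (@lebesgue_d R d).
Local Notation mu := (@lebesgue_measure R).
Implicit Types (c : pt) (r : R).

Definition oball c r : set Rd := [set x | enorm (x - c) < r].
Definition cball c r : set Rd := [set x | enorm (x - c) <= r].
Definition unit_vol : R := fine (lebd (oball 0 1)).

Lemma measurable_enorm_sub c : measurable_fun [set: Rd] (fun x : Rd => enorm (x - c) : R).
Proof.
apply: (measurableT_comp measurable_enorm).
by apply: measurable_RdB => //; exact: measurable_cst.
Qed.

Lemma measurable_oball c r : measurable (oball c r).
Proof.
have -> : oball c r = (fun x : Rd => enorm (x - c) : R) @^-1` `]-oo, r[%classic.
  by apply/seteqP; split=> x; rewrite /oball/= in_itv.
by rewrite -[X in measurable X]setTI; exact: measurable_enorm_sub.
Qed.

Lemma measurable_cball c r : measurable (cball c r).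
Proof.
have -> : cball c r = (fun x : Rd => enorm (x - c) : R) @^-1` `]-oo, r]%classic.
  by apply/seteqP; split=> x; rewrite /cball/= in_itv.
by rewrite -[X in measurable X]setTI; exact: measurable_enorm_sub.
Qed.

Lemma unit_volE : lebd (oball 0 1) = unit_vol%:E.
Proof.
rewrite fineK// ge0_fin_numE ?measure_ge0//.
apply: le_lt_trans (lebesgue_d_box_lty (const_mx (-1)) (const_mx 1)).
apply: le_outer_measure => x; rewrite /oball/= subr0 => x1 i; rewrite !mxE.
have := le_lt_trans (coord_le_enorm x i) x1.
by rewrite ltr_norml => /andP[/ltW -> ->].
Qed.

Lemma unit_vol_ge0 : 0 <= unit_vol.
Proof. by rewrite fine_ge0. Qed.

Lemma lebesgue_d_oball c r : 0 < r -> lebd (oball c r) = (r ^+ d * unit_vol)%:E.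
Proof.
move=> r0; rewrite EFinM -unit_volE.
have r1 : 0 < r^-1 by rewrite invr_gt0.
have := @lebesgue_d_affine R d' r^-1 (- (r^-1 *: c)) (oball 0 1) r1.
rewrite exprVn invrK => <-; congr (lebd _).
apply/seteqP; split=> x; rewrite /oball/= /affine subr0 -scalerBr enormZ
  gtr0_norm// ltr_pdivrMl// mulr1//.
Qed.

(** The power [d] makes this linear in [a]: the image of Lebesgue measure under [|x|^d] is
    [unit_vol] times Lebesgue measure on the half-line. *)
Lemma radial_lt (a : R) : lebd [set x : Rd | enorm x ^+ d < a] =
  (unit_vol%:E * mu (`]-oo, a[ `&` `[0%R, +oo[))%E.
Proof.
have [a0|a0] := leP a 0.
  rewrite (_ : [set _ | _] = set0); last first.
    apply/seteqP; split=> // x /= xa.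
    by have := lt_le_trans xa a0; rewrite ltNge exprn_ge0// enorm_ge0.
  rewrite (_ : _ `&` _ = set0) ?measure0 ?mule0//.
  apply/seteqP; split=> // x [] /=; rewrite !in_itv/= => xa; rewrite andbT => x0.
  by have := lt_le_trans (le_lt_trans x0 xa) a0; rewrite ltxx.
rewrite (_ : _ `&` _ = `[0%R, a[%classic); last first.
  apply/seteqP; split=> x; rewrite /= !in_itv/= andbT; first by move=> [-> ->].
  by move=> /andP[-> ->].
rewrite lebesgue_measure_co subr0 (max_idPr (ltW a0)) -EFinM mulrC.
pose b := a `^ (d%:R^-1).
have b0 : 0 < b by exact: powR_gt0.
have bd : b ^+ d = a.
  by rewrite -powR_mulrn ?(ltW b0)// -powRrM mulVf ?pnatr_eq0// powRr1// ltW.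
rewrite -bd -(lebesgue_d_oball 0)//; congr (lebd _).
by apply/seteqP; split=> x; rewrite /oball/= subr0 ltr_pXn2r// ?nnegrE ?enorm_ge0// ltW.
Qed.

(** This takes the place of polar coordinates. The two measures on the line agree on the half-lines
    []-oo, a[], a generating family closed under intersection, hence everywhere. *)
Lemma ge0_integral_radial (g : R -> \bar R) :
  measurable_fun setT g -> (forall s, 0 <= g s)%E ->
  (\int[lebd]_x g (enorm x ^+ d)%R = unit_vol%:E * \int[mu]_(s in `[0%R, +oo[) g s)%E.
Proof.
move=> mg g0.
have mD : measurable (`[0, +oo[%classic : set R) by [].
have mn : measurable_fun [set: Rd] (fun x : Rd => enorm x ^+ d : R).
  by apply: measurable_funX; exact: measurable_enorm.
pose m1 : {measure set (measurableTypeR R) -> \bar R} :=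
  pushforward lebd (fun x : Rd => enorm x ^+ d : measurableTypeR R).
pose m2 : {measure set (measurableTypeR R) -> \bar R} := mscale (NngNum unit_vol_ge0) (mrestr mu mD).
have <- : (\int[m2]_s g s = unit_vol%:E * \int[mu]_(s in `[0%R, +oo[) g s)%E.
  by rewrite ge0_integral_mscale// ge0_integral_mrestr.
transitivity (\int[m1 mn]_s g s)%E; first by rewrite ge0_integral_pushforward.
apply: (@eq_measure_integral _ _ _ _ m2 (m1 mn)) => A mA _.
apply: (@measure_unique _ R (measurableTypeR R) (@RGenInftyO.G R)
  (fun k => `]-oo, k%:R[%classic) _ _ _ _ (m1 mn) m2) => //.
- exact: RGenInftyO.measurableE.
- move=> _ _ [x ->] [y ->]; exists (Num.min x y).
  by apply/seteqP; split=> z /=; rewrite !in_itv/= lt_min; [move=> [-> ->]|move=> /andP[]].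
- by move=> k; exists k%:R.
- apply/seteqP; split=> // x _; exists (Num.truncn `|x|).+1 => //=.
  by rewrite in_itv/= (le_lt_trans (ler_norm x))// truncnS_gt.
- move=> _ [a ->]; rewrite /m1/= /pushforward /mscale/= /mrestr -radial_lt.
  by congr (lebd _); apply/seteqP; split=> x; rewrite /= in_itv.
- move=> k; rewrite /m1/= /pushforward.
  rewrite [X in lebd X](_ : _ = [set x : Rd | enorm x ^+ d < k%:R]); last first.
    by apply/seteqP; split=> x; rewrite /= in_itv.
  rewrite radial_lt lte_mul_pinfty// ?lee_fin ?unit_vol_ge0//.
  rewrite (_ : _ `&` _ = `[0%R, k%:R[%classic); last first.
    apply/seteqP; split=> x; rewrite /= !in_itv/= andbT; first by move=> [-> ->].
    by move=> /andP[-> ->].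
  by rewrite lebesgue_measure_co ltry.
Qed.

End Radial.

(** * The Gamma integral *)

Section GammaFacts.
Context {R : realType}.
Local Notation mu := (@lebesgue_measure R).
Implicit Types p q t : R.

Lemma measurable_powR_expR p : measurable_fun [set: R] (fun t : R => (t `^ p * expR (- t))%:E).
Proof.
apply/measurable_EFinP; apply: measurable_funM; first exact: measurable_powR.
by apply: measurableT_comp => //; exact: oppr_measurable.
Qed.

(** For [t > 1] a single Taylor term of [exp (t / 2)], of an order above [p], is enough; for
    [t <= 1] the power is at most 1. *)
Lemma powR_le_expR p : 0 <= p -> exists2 C : R, 0 <= C &
  forall t, 0 <= t -> t `^ p <= C * expR (t / 2).
Proof.
move=> p0; pose n := (Num.truncn p).+1.
exists (1 + 2 ^+ n * n`!%:R); first by rewrite addr_ge0// mulr_ge0// exprn_ge0.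
move=> t t0; have e1 : 1 <= expR (t / 2) by rewrite -expR0 ler_expR divr_ge0.
have tn : t ^+ n <= 2 ^+ n * n`!%:R * expR (t / 2).
  have t20 : 0 <= t / 2 by rewrite divr_ge0.
  have := @expR_ge1Dxn R (t / 2) (Num.truncn p) t20.
  rewrite -/n => h.
  have : (t / 2) ^+ n / n`!%:R <= expR (t / 2) by apply: le_trans h; rewrite lerDr.
  rewrite ler_pdivrMr ?ltr0n ?fact_gt0// expr_div_n ler_pdivrMr ?exprn_gt0//.
  by move/le_trans; apply; rewrite mulrC mulrA mulrAC mulrC mulrA mulrC mulrA.
rewrite mulrDl mul1r.
have [t1|t1] := leP t 1.
  apply: (@le_trans _ _ 1); last by rewrite (le_trans e1)// lerDl !mulr_ge0// ?expR_ge0// exprn_ge0.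
  have [->|tp] := eqVneq t 0; first by rewrite /powR eqxx lern1 leq_b1.
  by rewrite -(powRr0 t) ger_powR// lt_def tp t0.
apply: (@le_trans _ _ (t ^+ n)); last by rewrite (le_trans tn)// lerDr expR_ge0.
by rewrite -powR_mulrn// ler_powR ?(ltW t1)// ltW// truncnS_gt.
Qed.

(** The tail is 1 minus the distribution function of the exponential law of rate 1. *)
Lemma integral_expRN_tail q : 0 <= q ->
  (\int[mu]_(u in `]q, +oo[) (expR (- u))%:E = (expR (- q))%:E)%E.
Proof.
have mE D : measurable_fun D (fun u : R => (expR (- u))%:E).
  apply/measurable_EFinP; apply: measurable_funTS.
  by apply: measurableT_comp => //; exact: oppr_measurable.
have pdf1 u : 0 <= u -> exponential_pdf 1 u = expR (- u).
  by move=> u0; rewrite exponential_pdfE// mul1r mulN1r.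
have tot : (\int[mu]_(u in `[0%R, +oo[) (expR (- u))%:E = 1)%E.
  rewrite -(@integral_exponential_pdf R 1)// [RHS](_ : _ =
    \int[mu]_(u in `[0%R, +oo[) (exponential_pdf 1 u)%:E)%E; last first.
    rewrite [RHS]integral_mkcond; apply: eq_integral => u _.
    rewrite patchE; case: ifPn => // /negP; rewrite inE/= in_itv/= andbT => /negP.
    by rewrite -ltNge => u0; rewrite lt0_exponential_pdf.
  by apply: eq_integral => u; rewrite inE/= in_itv/= andbT => u0; rewrite pdf1.
move=> q0; have [->|qn] := eqVneq q 0.
  by rewrite integral_itv_obnd_cbnd// tot oppr0 expR0.
have {}q0 : 0 < q by rewrite lt_def qn q0.
have : (\int[mu]_(u in `[0%R, +oo[) (expR (- u))%:E =
   \int[mu]_(u in `[0%R, q]) (expR (- u))%:E +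
   \int[mu]_(u in `]q, +oo[) (expR (- u))%:E)%E.
  rewrite -ge0_integral_setU//; last 2 first.
  - exact: mE.
  - apply/disj_set2P/seteqP; split=> // u [] /=; rewrite !in_itv/= andbT.
    by move=> /andP[_ uq] /(le_lt_trans uq); rewrite ltxx.
  by congr integral; rewrite -itv_bndbnd_setU// ?bnd_simp// ltW.
rewrite tot [X in (_ = X + _)%E](_ : _ = (1 - (expR (- q))%:E)%E); last first.
  have := @exponential_prob_itv0c R 1 q q0; rewrite mulN1r => <-.
  apply: eq_integral => u; rewrite inE/= in_itv/= => /andP[u0 _].
  by rewrite pdf1.
set I := (X in (_ + X)%E) => h.
have Ifin : I \is a fin_num.
  rewrite ge0_fin_numE; last by apply: integral_ge0 => u _; rewrite lee_fin expR_ge0.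
  rewrite ltey; apply/eqP => Ioo; move: h; rewrite Ioo -EFinB addey//.
move: h; rewrite -(fineK Ifin) -EFinB -EFinD => -[] h.
by rewrite -[LHS](fineK Ifin); congr (_%:E); rewrite -/I; lra.
Qed.

(** [Gamma] is defined by [fine], so finiteness comes first: the integrand is at most [2 C] times
    the exponential density of rate 1/2. *)
Lemma GammaE p : 0 <= p ->
  (\int[mu]_(t in `[0%R, +oo[) (t `^ p * expR (- t))%:E = (Gamma (1 + p))%:E)%E.
Proof.
move=> p0; rewrite -integral_itv_obnd_cbnd; last first.
  by apply: measurable_funTS; exact: measurable_powR_expR.
rewrite /Gamma (_ : 1 + p - 1 = p); last by ring.
rewrite (_ : [set t : R | 0 < t] = `]0, +oo[%classic); last first.
  by apply/seteqP; split=> t /=; rewrite in_itv/= andbT.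
rewrite fineK// ge0_fin_numE; last first.
  by apply: integral_ge0 => t _; rewrite lee_fin mulr_ge0 ?powR_ge0 ?expR_ge0.
have [C C0 CP] := powR_le_expR p0.
apply: (@le_lt_trans _ _ (\int[mu]_t ((2 * C)%:E * (exponential_pdf (2^-1) t)%:E))%E).
  rewrite integral_mkcond; apply: ge0_le_integral => //.
  - by move=> t _; rewrite erestrict_ge0// => u _; rewrite lee_fin mulr_ge0 ?powR_ge0 ?expR_ge0.
  - apply/(measurable_restrictT _ _).1 => //.
    by apply: measurable_funTS; exact: measurable_powR_expR.
  - apply/measurable_EFinP; apply: measurable_funM => //.
    exact: measurable_exponential_pdf.
  - move=> t _; rewrite patchE; case: ifPn => [|_].
      rewrite inE/= in_itv/= andbT => t0.
      rewrite exponential_pdfE ?(ltW t0)// -EFinM lee_fin.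
      rewrite (_ : 2 * C * _ = C * expR (- 2^-1 * t)); last by field.
      apply: (@le_trans _ _ (C * expR (t / 2) * expR (- t))).
        by rewrite ler_wpM2r ?expR_ge0// CP// ltW.
      by rewrite -mulrA -expRD ler_wpM2l// ler_expR; lra.
    by rewrite -EFinM lee_fin !mulr_ge0// exponential_pdf_ge0// invr_ge0.
rewrite ge0_integralZl//; last 3 first.
- by apply/measurable_EFinP; exact: measurable_exponential_pdf.
- by move=> t _; rewrite lee_fin exponential_pdf_ge0// invr_ge0.
- by rewrite lee_fin mulr_ge0.
by rewrite integral_exponential_pdf ?invr_gt0// mule1 ltry.
Qed.

End GammaFacts.

(** * The volume of the unit ball and radial moments *)

Section BallVolume.
Context {R : realType} {d' : nat}.
Local Notation d := d'.+1.
Local Notation pt := (pt R d).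
Local Notation Rd := (Rd R d).
Local Notation lebd := (@lebesgue_d R d).
Local Notation mu := (@lebesgue_measure R).
Local Notation v := (@unit_vol R d').

Lemma mem_oball (c x : pt) (r : R) : (x \in oball c r) = (enorm (x - c) < r).
Proof. by apply/idP/idP => [/set_mem//|h]; exact/mem_set. Qed.

Lemma mem_cball (c x : pt) (r : R) : (x \in cball c r) = (enorm (x - c) <= r).
Proof. by apply/idP/idP => [/set_mem//|h]; exact/mem_set. Qed.

Let layer (p : Rd * measurableTypeR R) : \bar R :=
  (if enorm p.1 ^+ 2 < p.2 then expR (- p.2) else 0)%:E.

Let measurable_layer : measurable_fun setT layer.
Proof.
apply/measurable_EFinP; apply: measurable_fun_ifT => //.
- apply: measurable_fun_ltr; last exact: measurable_snd.
  apply: measurable_funX.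
  by apply: (measurableT_comp measurable_enorm); exact: measurable_fst.
- apply: measurableT_comp => //.
  by apply: (measurableT_comp (@oppr_measurable R setT)); exact: measurable_snd.
Qed.

(** The kernel [layer] is integrated in both orders. Over [u] first it gives [exp (- |x|^2)] and the
    Gaussian integral; over [x] first it gives [exp (- u)] times the volume [v u^(d/2)] of the ball
    of radius [sqrt u], hence a Gamma integral. *)
Lemma unit_vol_Gamma : v * Gamma (1 + d%:R / 2) = Num.sqrt pi ^+ d.
Proof.
apply: EFin_inj; rewrite -integral_lebesgue_d_gauss.
have l0 p : (0 <= layer p)%E by rewrite lee_fin /layer; case: ifP.
transitivity (\int[lebd]_x \int[mu]_u layer (x, u))%E; last first.
  apply: eq_integral => x _; rewrite -enorm_sqr -integral_expRN_tail ?exprn_ge0 ?enorm_ge0//.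
  rewrite [RHS]integral_mkcond; apply: eq_integral => u _.
  by rewrite patchE mem_setE in_itv/= andbT /layer/=; case: ifP.
rewrite fubini_tonelli//.
transitivity (v%:E * \int[mu]_(u in `[0%R, +oo[) (u `^ (d%:R / 2) * expR (- u))%:E)%E.
  by rewrite GammaE ?divr_ge0// EFinM.
rewrite -ge0_integralZl//; last 3 first.
- by apply: measurable_funTS; exact: measurable_powR_expR.
- by move=> u _; rewrite lee_fin mulr_ge0 ?powR_ge0 ?expR_ge0.
- by rewrite lee_fin unit_vol_ge0.
rewrite integral_mkcond; apply: eq_integral => u _.
rewrite patchE mem_setE in_itv/= andbT.
transitivity (\int[lebd]_x ((expR (- u))%:E * (\1_(oball (0 : pt) (Num.sqrt u)) x)%:E))%E; last first.
  apply: eq_integral => x _; rewrite indicE mem_oball subr0 /layer/= -EFinM; congr (_%:E).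
  have [u0|u0] := ltP u 0.
    have -> : (enorm x ^+ 2 < u) = false.
      by apply/negbTE; rewrite -leNgt (le_trans (ltW u0))// exprn_ge0// enorm_ge0.
    by rewrite ltr0_sqrtr// [enorm x < 0]ltNge enorm_ge0 mulr0.
  have -> : (enorm x ^+ 2 < u) = (enorm x < Num.sqrt u).
    by rewrite -[X in _ < X](sqr_sqrtr u0) ltr_pXn2r// nnegrE ?enorm_ge0 ?sqrtr_ge0.
  by case: ifP; rewrite ?mulr1 ?mulr0.
rewrite ge0_integralZl//; last first.
  by apply/measurable_EFinP; apply: measurable_indic; exact: measurable_oball.
rewrite integral_indic ?setIT//; last exact: measurable_oball.
have [u0|u0] := ltP u 0.
  rewrite ltr0_sqrtr// (_ : oball _ _ = set0) ?measure0 ?mule0//.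
  by apply/seteqP; split=> // x; rewrite /oball/= ltNge enorm_ge0.
have [->|un] := eqVneq u 0.
  rewrite sqrtr0 powR0 ?mul0r ?mule0 ?divr_eq0 ?pnatr_eq0// (_ : oball _ _ = set0).
    by rewrite measure0 mule0.
  by apply/seteqP; split=> // x; rewrite /oball/= ltNge enorm_ge0.
rewrite /= lebesgue_d_oball ?sqrtr_gt0 ?lt_def ?un// -EFinM; congr (_%:E).
rewrite [d%:R / 2]mulrC powRrM powR12_sqrt// powR_mulrn ?sqrtr_ge0//; ring.
Qed.

Lemma unit_vol_gt0 : 0 < v.
Proof.
rewrite lt_def unit_vol_ge0 andbT; apply/eqP => v0.
have := unit_vol_Gamma; rewrite v0 mul0r => /esym/eqP.
by rewrite gt_eqF// exprn_gt0// sqrtr_gt0 pi_gt0.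
Qed.

Lemma vol_ballE : vol_ball R d = v.
Proof.
have G0 : Gamma (1 + d%:R / 2) != 0 :> R.
  apply/eqP => G0; have := unit_vol_Gamma; rewrite G0 mulr0 => /esym/eqP.
  by rewrite gt_eqF// exprn_gt0// sqrtr_gt0 pi_gt0.
apply: (mulIf G0); rewrite unit_vol_Gamma /vol_ball divfK//.
by rewrite [d%:R / 2]mulrC powRrM powR12_sqrt ?pi_ge0// powR_mulrn ?sqrtr_ge0.
Qed.

(** By the radial formula spheres carry no mass. The case [r = 0] is included and later makes
    coincidences of points null events. *)
Lemma lebesgue_d_cball (c : pt) (r : R) : 0 <= r ->
  lebd (cball c r) = (r ^+ d * v)%:E.
Proof.
move=> r0.
have -> : cball c r = affine 1 (- c) @^-1` cball 0 r.
  by apply/seteqP; split=> x; rewrite /cball /affine/= scale1r subr0.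
rewrite lebesgue_d_affine// expr1n invr1 mul1e.
rewrite -[cball 0 r]setIT -integral_indic//; last exact: measurable_cball.
pose g (s : R) : \bar R := (\1_(`]-oo, r ^+ d]%classic) s)%:E.
transitivity (\int[lebd]_x g (enorm x ^+ d)%R)%E.
  apply: eq_integral => x _; rewrite /g !indicE; congr ((_ _)%:R%:E).
  apply/idP/idP => /set_mem h; apply/mem_set; move: h; rewrite /cball/= in_itv/= subr0.
    by move=> h; rewrite ler_pXn2r// nnegrE enorm_ge0.
  by rewrite ler_pXn2r// nnegrE enorm_ge0.
rewrite ge0_integral_radial; last 2 first.
- by apply/measurable_EFinP; exact: measurable_indic.
- by move=> s; rewrite lee_fin.
rewrite integral_indic// mulrC EFinM; congr (_ * _)%E.
rewrite (_ : _ `&` _ = `[0, r ^+ d]%classic).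
  rewrite /= lebesgue_measure_itv/= lte_fin sube0 lt_def exprn_ge0// andbT.
  by case: eqP => [->|].
by apply/seteqP; split=> s; rewrite /= !in_itv/= ?andbT; [move=> [-> ->]|move=> /andP[-> ->]].
Qed.

Variable a : R.
Hypothesis a0 : 0 <= a.

Lemma measurable_enorm_powR_expR (t : R) :
  measurable_fun [set: Rd] (fun x : Rd => (enorm x `^ a * expR (- (t * enorm x ^+ d)))%:E).
Proof.
apply/measurable_EFinP; apply: measurable_funM.
  by apply: (measurableT_comp (measurable_powR a)); exact: measurable_enorm.
apply: measurableT_comp => //; apply: (measurableT_comp (@oppr_measurable R setT)).
apply: measurable_funM => //; apply: measurable_funX; exact: measurable_enorm.
Qed.

Lemma integral_radial_moment1 :
  (\int[lebd]_x (enorm x `^ a * expR (- enorm x ^+ d))%:E =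
   (v * Gamma (1 + a / d%:R))%:E)%E.
Proof.
have ad0 : 0 <= a / d%:R by rewrite divr_ge0.
rewrite EFinM -GammaE// -ge0_integral_radial; last 2 first.
- exact: measurable_powR_expR.
- by move=> s; rewrite lee_fin mulr_ge0 ?powR_ge0 ?expR_ge0.
apply: eq_integral => x _; congr (_ * _)%:E.
rewrite -powR_mulrn ?enorm_ge0// -powRrM mulrCA divff ?pnatr_eq0// mulr1//.
Qed.

(** Dilation by [t^(1/d)] reduces the rate to 1: the Jacobian contributes [t^(-1)] and the power of
    the norm [t^(-a/d)]. *)
Lemma integral_radial_moment (t : R) : 0 < t ->
  (\int[lebd]_x (enorm x `^ a * expR (- (t * enorm x ^+ d)))%:E =
   (v * Gamma (1 + a / d%:R) * t `^ (- (1 + a / d%:R)))%:E)%E.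
Proof.
move=> t0; pose c := t `^ (d%:R^-1).
have c0 : 0 < c by exact: powR_gt0.
have cd : c ^+ d = t.
  by rewrite -powR_mulrn ?(ltW c0)// -powRrM mulVf ?pnatr_eq0// powRr1// ltW.
have ca : c `^ a = t `^ (a / d%:R) by rewrite -powRrM mulrC.
pose g (x : Rd) : \bar R := (enorm x `^ a * expR (- enorm x ^+ d))%:E.
have mg : measurable_fun setT g.
  rewrite /g; under eq_fun do rewrite -[enorm _ ^+ d]mul1r.
  exact: measurable_enorm_powR_expR.
have g0 x : (0 <= g x)%E by rewrite lee_fin mulr_ge0 ?powR_ge0 ?expR_ge0.
have := ge0_integral_affine 0 c0 mg g0.
rewrite integral_radial_moment1 cd -EFinM => h.
have cap : 0 < c `^ a by exact: powR_gt0.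
transitivity (\int[lebd]_x ((c `^ a)^-1%:E * g (affine c 0%R x)))%E.
  apply: eq_integral => x _; rewrite /g -EFinM; congr (_%:E).
  rewrite /affine addr0 enormZ gtr0_norm// exprMn cd powRM ?enorm_ge0 ?(ltW c0)//.
  by field; rewrite gt_eqF.
rewrite ge0_integralZl//; last 2 first.
- exact: (measurableT_comp mg (measurable_affine c 0)).
- by rewrite lee_fin invr_ge0 ltW.
rewrite h -EFinM ca; congr (_%:E).
rewrite powRN powRD ?powRr1 ?(ltW t0)//; last by rewrite (gt_eqF t0) implybT.
rewrite invfM; ring.
Qed.

Lemma Gamma_ge0 (s : R) : 0 <= Gamma s.
Proof.
rewrite fine_ge0//; apply: integral_ge0 => t _.
by rewrite lee_fin mulr_ge0 ?powR_ge0 ?expR_ge0.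
Qed.

End BallVolume.

(** * Independence and iterated integrals *)

Section Independence.
Context {R : realType} {dE : measure_display} {E : measurableType dE}.
Context {dT : measure_display} {T : measurableType dT}.
Variables (P : probability T R) (F : probability E R) (X : nat -> T -> E).
Hypothesis mX : forall i, measurable_fun [set: T] (X i).
Hypothesis lawX : forall i B, measurable B -> P (X i @^-1` B) = F B.

Definition cyl (I : seq nat) (B : nat -> set E) : set T :=
  \bigcap_(i in [set i | i \in I]) (X i @^-1` B i).

Hypothesis indepX : forall (I : seq nat) (B : nat -> set E),
  uniq I -> (forall i, measurable (B i)) ->
  P (cyl I B) = (\prod_(i <- I) P (X i @^-1` B i))%E.

Lemma measurable_cyl I B : (forall i, measurable (B i)) -> measurable (cyl I B).
Proof.
move=> mB; apply: fin_bigcap_measurable => [|i _]; first exact: finite_seq.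
by rewrite -[X in measurable X]setTI; exact: mX.
Qed.

(* [W] plays the role of the tuple of the [X i] with [i] in [s]; peeling off one
   index at a time avoids measures on spaces of tuples. *)
Definition indep_from dT2 (T2 : measurableType dT2) (s : seq nat) (W : T -> T2) :=
  forall (I : seq nat) (B : nat -> set E) (C : set T2),
    uniq I -> (forall i, measurable (B i)) -> (forall i, i \in I -> i \notin s) ->
    measurable C -> P (cyl I B `&` W @^-1` C) = (P (cyl I B) * P (W @^-1` C))%E.

Section Step.
Context dT2 (T2 : measurableType dT2) (s : seq nat) (W : T -> T2) (a : nat).
Hypotheses (mW : measurable_fun [set: T] W) (iW : indep_from s W) (a_s : a \notin s).

Let Wm : {RV P >-> T2} := mfun_Sub (mem_set mW).

Let XW (w : T) : E * T2 := (X a w, W w).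

Let mXW : measurable_fun [set: T] XW.
Proof. exact: measurable_fun_pair. Qed.

(** For fixed [I] and [B] both sides are finite measures in [C], so rectangles suffice. On a
    rectangle the event that [X a] lies in [A1] is absorbed into the cylinder, and [indep_from]
    applies to the longer index list [a :: I]. *)
Lemma indep_from_pair_prod (I : seq nat) (B : nat -> set E) (C : set (E * T2)) :
  uniq I -> (forall i, measurable (B i)) -> (forall i, i \in I -> i \notin a :: s) ->
  measurable C ->
  P (cyl I B `&` XW @^-1` C) = (P (cyl I B) * (F \x distribution P Wm)%E C)%E.
Proof.
move=> uI mB Is mC.
have mc := measurable_cyl I mB.
pose m1' : {measure set T -> \bar R} := mrestr P mc.
pose m1 : {measure set (E * T2) -> \bar R} := pushforward m1' XW.
have p0 : 0 <= fine (P (cyl I B)) by rewrite fine_ge0.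
pose m2 : {measure set (E * T2) -> \bar R} := mscale (NngNum p0) (F \x distribution P Wm)%E.
have pE : (fine (P (cyl I B)))%:E = P (cyl I B) by rewrite fineK// fin_num_measure.
rewrite setIC -[LHS]/(m1 mXW C) -[RHS](_ : m2 C = _); last first.
  by rewrite /m2/= /mscale/= pE.
pose G := [set A1 `*` A2 | A1 in @measurable _ E & A2 in @measurable _ T2].
apply: (measure_unique G (fun=> setT)) => //.
- exact: measurable_prod_measurableType.
- move=> _ _ [A1 mA1 [A2 mA2 <-]] [B1 mB1 [B2 mB2 <-]].
  exists (A1 `&` B1); first exact: measurableI.
  by exists (A2 `&` B2); [exact: measurableI|rewrite setXI].
- by move=> _; exists setT => //; exists setT => //; rewrite setXTT.
- by apply/seteqP; split => // x _; exists 0%N.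
- move=> _ [A1 mA1 [A2 mA2 <-]].
  rewrite /m2/= /mscale/= pE product_measure1E//= /distribution/=.
  rewrite /m1/= /pushforward /m1'/= /mrestr.
  have aI : a \notin I by apply/negP => /Is; rewrite mem_head.
  pose B' i := if i == a then A1 else B i.
  have mB' i : measurable (B' i) by rewrite /B'; case: ifP.
  have cylE : cyl (a :: I) B' = cyl I B `&` X a @^-1` A1.
    apply/seteqP; split=> w /=.
      move=> h; split.
        move=> i /= iI; have := h i; rewrite /= inE iI orbT /B' => /(_ isT).
        by case: eqP iI => // -> aI'; rewrite aI' in aI.
      by have := h a; rewrite /= mem_head /B' eqxx => /(_ isT).
    move=> [h1 h2] i /=; rewrite inE /B'; case: eqP => [->//|_] /= iI; exact: h1.
  have -> : XW @^-1` (A1 `*` A2) `&` cyl I B = cyl (a :: I) B' `&` W @^-1` A2.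
    by rewrite cylE; apply/seteqP; split=> w; rewrite /XW/=; tauto.
  rewrite iW//=; last 2 first.
  - by rewrite /= aI.
  - by move=> i; rewrite inE => /predU1P[->//|/Is]; rewrite inE negb_or => /andP[].
  rewrite muleA; congr (_ * _)%E.
  rewrite !indepX//=; last by rewrite /= aI.
  rewrite big_cons {1}/B' eqxx lawX// muleC; congr (_ * _)%E.
  by apply: eq_big_seq => i iI; rewrite /B'; case: eqP iI => // -> aI'; rewrite aI' in aI.
- move=> _; rewrite /m1/= /pushforward /m1'/= /mrestr.
  rewrite preimage_setT setTI (le_lt_trans (probability_le1 _ _))// ltry//.
Qed.

Lemma indep_pair_law (C : set (E * T2)) : measurable C ->
  P (XW @^-1` C) = (F \x distribution P Wm)%E C.
Proof.
move=> mC; have := @indep_from_pair_prod [::] (fun=> setT) C isT.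
have -> : cyl [::] (fun=> setT) = setT by apply/seteqP; split.
by rewrite setTI probability_setT mul1e; apply.
Qed.

Lemma indep_from_pair : indep_from (a :: s) XW.
Proof.
move=> I B C uI mB Is mC; rewrite indep_from_pair_prod// indep_pair_law//.
Qed.

(** Fubini for independent variables: [X a] is integrated out under its law, while [W] stays random
    under [P], ready for the next index. *)
Lemma integral_peel (H : E * T2 -> \bar R) :
  measurable_fun setT H -> (forall p, 0 <= H p)%E ->
  (\int[P]_w H (X a w, W w) = \int[F]_x \int[P]_w H (x, W w))%E.
Proof.
move=> mH H0.
transitivity (\int[(F \x distribution P Wm)%E]_p H p)%E.
  pose m : {measure set (E * T2) -> \bar R} := pushforward P XW.
  rewrite -(@eq_measure_integral _ _ _ _ _ (m mXW)); last first.
    by move=> A mA _; exact: indep_pair_law.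
  by rewrite ge0_integral_pushforward.
rewrite fubini_tonelli1//; apply: eq_integral => x _.
rewrite /fubini_F ge0_integral_distribution//.
exact: (measurableT_comp mH (pair1_measurable x)).
Qed.

End Step.

Definition others (s : seq nat) (w : T) : (size s).-tuple E :=
  map_tuple (X ^~ w) (in_tuple s).

Lemma measurable_others s : measurable_fun [set: T] (others s).
Proof.
apply/measurable_fun_tnthP => i.
rewrite [X in measurable_fun _ X](_ : _ = X (tnth (in_tuple s) i))//.
by apply/funext => w; rewrite /others /= tnth_map.
Qed.

Lemma indep_from_others s : uniq s -> indep_from s (others s).
Proof.
elim: s => [_|a s IH /= /andP[a_s us]] I B C uI mB Is mC.
  have o0 w : others [::] w = [tuple] by exact: tuple0.
  have [C0|C0] := pselect (C [tuple]).
    rewrite (_ : others _ @^-1` C = setT) ?setIT ?probability_setT ?mule1//.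
    by apply/seteqP; split=> // w _; rewrite /= o0.
  rewrite (_ : others _ @^-1` C = set0) ?setI0 ?measure0 ?mule0//.
  by apply/seteqP; split=> // w; rewrite /= o0.
pose c (p : E * (size s).-tuple E) : (size s).+1.-tuple E := [tuple of p.1 :: p.2].
have mc : measurable_fun setT c.
  by apply: measurable_cons; [exact: measurable_fst|exact: measurable_snd].
have oE : others (a :: s) = c \o (fun w => (X a w, others s w)).
  by apply/funext => w; apply: val_inj.
rewrite oE comp_preimage.
have := indep_from_pair (@measurable_others s) (IH us) a_s; apply => //.
by rewrite -[X in measurable X]setTI; exact: mc.
Qed.

Lemma prob_all s (B : set E) : uniq s -> measurable B ->
  P [set w | forall i, i \in s -> B (X i w)] = ((fine (F B)) ^+ size s)%:E.
Proof.
move=> us mB; rewrite (_ : [set _ | _] = cyl s (fun=> B)); last first.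
  by apply/seteqP; split.
rewrite indepX//.
under eq_bigr do rewrite lawX//.
rewrite -[F B]fineK ?fin_num_measure//.
elim: s {us} => [|a s IH]; first by rewrite big_nil expr0.
by rewrite big_cons IH/= exprS EFinM.
Qed.

End Independence.

(** * Integration against a density *)

Section Density.
Import HBNNSimple.

Lemma ge0_integral_density dT (T : measurableType dT) (R : realType)
    (mu nu : {measure set T -> \bar R}) (f : T -> R) (g : T -> \bar R) :
  measurable_fun setT f -> (forall x, 0 <= f x) ->
  (forall A, measurable A -> nu A = \int[mu]_(x in A) (f x)%:E)%E ->
  measurable_fun setT g -> (forall x, 0 <= g x)%E ->
  (\int[nu]_x g x = \int[mu]_x (g x * (f x)%:E))%E.
Proof.
move=> mf f0 nuE mg g0.
have mfE : measurable_fun setT (fun x => (f x)%:E) by exact/measurable_EFinP.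
pose h n : {nnsfun T >-> R} := nnsfun_approx measurableT mg n.
have hE (n : nat) : (\int[nu]_x (h n x)%:E = \int[mu]_x ((h n x)%:E * (f x)%:E))%E.
  transitivity (\int[nu]_x (\sum_(r \in range (h n)) (r * \1_(h n @^-1` [set r]) x)%:E))%E.
    by apply: eq_integral => x _; rewrite fsumEFin// -fimfunE.
  transitivity (\int[mu]_x (\sum_(r \in range (h n))
      ((r * \1_(h n @^-1` [set r]) x)%:E * (f x)%:E)))%E; last first.
    apply: eq_integral => x _; rewrite -ge0_mule_fsuml.
      by rewrite fsumEFin// -(fimfunE _ x).
    by move=> r; rewrite EFinM nnfun_muleindic_ge0.
  rewrite ge0_integral_fsum//; last 2 first.
  - move=> r; apply/measurable_EFinP; apply: measurable_funM => //.
  - by move=> r x _; rewrite EFinM nnfun_muleindic_ge0.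
  rewrite ge0_integral_fsum//; last 2 first.
  - move=> r; apply: emeasurable_funM => //.
    by apply/measurable_EFinP; exact: measurable_funM.
  - by move=> r x _; apply: mule_ge0; rewrite ?EFinM ?nnfun_muleindic_ge0 ?lee_fin.
  apply: eq_fsbigr => r _.
  have [r0|r0] := ltP r 0.
    have e0 : h n @^-1` [set r] = set0 by apply: preimage_nnfun0.
    rewrite e0; rewrite !integral0_eq// => x _; by rewrite indic0 mulr0 ?mul0e.
  have mr : measurable (h n @^-1` [set r]) by [].
  transitivity (r%:E * nu (h n @^-1` [set r]))%E.
    under eq_integral do rewrite EFinM.
    by rewrite integralZl_indic_nnsfun// integral_indic// setIT.
  rewrite nuE// integral_mkcond -ge0_integralZl//; last 2 first.
  - exact/(measurable_restrictT _ _).1/measurable_funTS.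
  - by move=> x _; rewrite erestrict_ge0// => y _; rewrite lee_fin.
  apply: eq_integral => x _; rewrite patchE indicE EFinM -muleA; congr (_ * _)%E.
  by case: ifP; rewrite ?mul1e ?mul0e.
transitivity (limn (fun n => \int[nu]_x (h n x)%:E))%E.
  rewrite -monotone_convergence//; last 3 first.
  - by move=> n; exact/measurable_EFinP.
  - by move=> n x _; rewrite lee_fin.
  - move=> x _ a b ab; rewrite lee_fin; exact/lefP/nd_nnsfun_approx.
  apply: eq_integral => x _; apply/esym/cvg_lim => //; exact: cvg_nnsfun_approx.
under eq_fun do rewrite hE.
rewrite -monotone_convergence//; last 3 first.
- by move=> n; apply: emeasurable_funM => //; exact/measurable_EFinP.
- by move=> n x _; rewrite mule_ge0 ?lee_fin.
- move=> x _ a b ab; rewrite lee_wpmul2r ?lee_fin//; exact/lefP/nd_nnsfun_approx.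
apply: eq_integral => x _; apply/cvg_lim => //.
by apply: cvgeMr => //; exact: cvg_nnsfun_approx.
Qed.

End Density.

Ltac mproj := first [exact: measurable_fst | exact: measurable_snd
  | apply: (measurableT_comp measurable_fst); mproj
  | apply: (measurableT_comp measurable_snd); mproj].
Ltac mpairs := first [mproj | apply: measurable_fun_pair; mpairs].

(** * Expectations over two, three or four points and the remaining ones *)

Section Expect.
Context {R : realType} {dE : measure_display} {E : measurableType dE}.
Context {dT : measure_display} {T : measurableType dT}.
Variables (P : probability T R) (F : probability E R) (X : nat -> T -> E).
Hypothesis mX : forall i, measurable_fun [set: T] (X i).
Hypothesis lawX : forall i B, measurable B -> P (X i @^-1` B) = F B.
Hypothesis indepX : forall (I : seq nat) (B : nat -> set E),
  uniq I -> (forall i, measurable (B i)) ->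
  P (cyl X I B) = (\prod_(i <- I) P (X i @^-1` B i))%E.

Section OneParam.
Context dU (U : measurableType dU) (cl : U -> E -> bool) (Phi : U -> R).
Hypothesis mcl : measurable_fun setT (fun p : U * E => cl p.1 p.2).
Hypothesis mPhi : measurable_fun setT Phi.
Hypothesis Phi0 : forall u, 0 <= Phi u.

(* [cl u z]: a point at [z] does not destroy the edges drawn on the points [u]. *)
Definition clear_prob (u : U) : R := fine (F [set z | cl u z]).

Lemma measurable_clear u : measurable [set z | cl u z].
Proof.
have -> : [set z | cl u z] = (fun z => cl u z) @^-1` [set true] by [].
rewrite -[X in measurable X]setTI.
exact: (measurableT_comp mcl (pair1_measurable u)).
Qed.

(** The indicator of a conjunction is the product of the indicators, and finite products preserve
    measurability. *)
Lemma measurable_all_clear n :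
  measurable_fun setT (fun p : U * n.-tuple E => (all (cl p.1) p.2)%:R : R).
Proof.
have -> : (fun p : U * n.-tuple E => (all (cl p.1) p.2)%:R : R) =
    (fun p => \prod_(i < n) (cl p.1 (tnth p.2 i))%:R).
  apply/funext => -[u t] /=.
  have [/all_tnthP h|/all_tnthP h] := boolP (all (cl u) t).
    by rewrite big1// => i _; rewrite h.
  have [i /negbTE hi] : exists i, ~~ cl u (tnth t i).
    by apply/not_existsP => h'; apply: h => i; apply: contrapT => /negP; exact: h'.
  by rewrite (bigD1 i)//= hi mul0r.
apply: measurable_prod => i _.
have mb : measurable_fun setT (fun b : bool => b%:R : R) by [].
have mp : measurable_fun setT (fun p : U * n.-tuple E => (p.1, tnth p.2 i)).
  apply: measurable_fun_pair; first exact: measurable_fst.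
  by apply: (measurableT_comp (measurable_tnth i)); exact: measurable_snd.
have mcp := measurableT_comp mcl mp.
exact: (measurableT_comp mb mcp).
Qed.

Lemma integral_others (s : seq nat) (u : U) : uniq s ->
  (\int[P]_w (Phi u * (all (cl u) (others X s w))%:R)%:E =
   (Phi u * clear_prob u ^+ size s)%:E)%E.
Proof.
move=> us; have mc := measurable_clear u.
have mA : measurable [set w | forall i, i \in s -> cl u (X i w)].
  rewrite (_ : [set _ | _] = cyl X s (fun=> [set z | cl u z])); last first.
    by apply/seteqP; split.
  exact: measurable_cyl.
transitivity (\int[P]_w ((Phi u)%:E *
    (\1_([set w | forall i, i \in s -> cl u (X i w)]) w)%:E))%E.
  apply: eq_integral => w _; rewrite -EFinM indicE; congr (_ * (nat_of_bool _)%:R)%:E.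
  apply/idP/idP.
    move=> /allP h; apply/mem_set => i si; apply: h.
    by rewrite /others/=; exact: map_f.
  by move=> /set_mem/= h; apply/allP => _ /mapP[i si ->]; exact: h.
rewrite ge0_integralZl//; last 2 first.
- by apply/measurable_EFinP; exact: measurable_indic.
- by rewrite lee_fin.
rewrite integral_indic// setIT EFinM; congr (_ * _)%E.
exact: (prob_all lawX indepX).
Qed.

End OneParam.

Section TwoPoints.
Variables (cl : E * E -> E -> bool) (Phi : E * E -> R).
Hypothesis mcl : measurable_fun setT (fun p : (E * E) * E => cl p.1 p.2).
Hypothesis mPhi : measurable_fun setT Phi.
Hypothesis Phi0 : forall u, 0 <= Phi u.

(** Peel off the two points, then evaluate the rest with these frozen: the points of [s] avoid
    independently, each with probability [clear_prob]. The versions with three and four points only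
    peel more often. *)
Lemma expect2 i j s : uniq (i :: j :: s) ->
  (\int[P]_w (Phi (X i w, X j w) * (all (cl (X i w, X j w)) (others X s w))%:R)%:E =
   \int[F]_x \int[F]_y (Phi (x, y) * clear_prob cl (x, y) ^+ size s)%:E)%E.
Proof.
move=> /=; rewrite inE negb_or => /andP[/andP[ij i_s] /andP[j_s us]].
pose H (p : (E * E) * (size s).-tuple E) : \bar R :=
  (Phi p.1 * (all (cl p.1) p.2)%:R)%:E.
have mH : measurable_fun setT H.
  apply/measurable_EFinP; apply: measurable_funM.
    by apply: (measurableT_comp mPhi); exact: measurable_fst.
  exact: measurable_all_clear.
have H0 p : (0 <= H p)%E by rewrite lee_fin mulr_ge0.
have io := indep_from_others mX lawX indepX us.
have mo := measurable_others mX (s := s).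
have mjo : measurable_fun setT (fun w => (X j w, others X s w)).
  exact: measurable_fun_pair.
have ijo := indep_from_pair mX lawX indepX mo io j_s.
have i_js : i \notin j :: s by rewrite inE negb_or ij.
pose H1 (p : E * (E * (size s).-tuple E)) := H ((p.1, p.2.1), p.2.2).
have mH1 : measurable_fun setT H1.
  apply: (measurableT_comp mH); apply: measurable_fun_pair.
    apply: measurable_fun_pair; first exact: measurable_fst.
    by apply: (measurableT_comp measurable_fst); exact: measurable_snd.
  by apply: (measurableT_comp measurable_snd); exact: measurable_snd.
have := integral_peel mX lawX indepX mjo ijo i_js mH1 (fun p => H0 _).
move=> ->; apply: eq_integral => x _.
have mH2 : measurable_fun setT (fun q => H1 (x, q)).
  exact: (measurableT_comp mH1 (pair1_measurable x)).
have := integral_peel mX lawX indepX mo io j_s mH2 (fun p => H0 _).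
move=> ->; apply: eq_integral => y _.
rewrite -integral_others//.
Qed.

End TwoPoints.

Section ThreePoints.
Variables (cl : E * (E * E) -> E -> bool) (Phi : E * (E * E) -> R).
Hypothesis mcl : measurable_fun setT (fun p : (E * (E * E)) * E => cl p.1 p.2).
Hypothesis mPhi : measurable_fun setT Phi.
Hypothesis Phi0 : forall u, 0 <= Phi u.

Lemma expect3 i j k s : uniq [:: i, j, k & s] ->
  (\int[P]_w (Phi (X i w, (X j w, X k w)) *
      (all (cl (X i w, (X j w, X k w))) (others X s w))%:R)%:E =
   \int[F]_x \int[F]_y \int[F]_z
      (Phi (x, (y, z)) * clear_prob cl (x, (y, z)) ^+ size s)%:E)%E.
Proof.
rewrite 3!cons_uniq => /andP[i_jks /andP[j_ks /andP[k_s us]]].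
pose H (p : (E * (E * E)) * (size s).-tuple E) : \bar R :=
  (Phi p.1 * (all (cl p.1) p.2)%:R)%:E.
have mH : measurable_fun setT H.
  apply/measurable_EFinP; apply: measurable_funM.
    by apply: (measurableT_comp mPhi); exact: measurable_fst.
  exact: measurable_all_clear.
have H0 p : (0 <= H p)%E by rewrite lee_fin mulr_ge0.
have io := indep_from_others mX lawX indepX us.
have mo := measurable_others mX (s := s).
have mko : measurable_fun setT (fun w => (X k w, others X s w)).
  exact: measurable_fun_pair.
have iko := indep_from_pair mX lawX indepX mo io k_s.
have mjko : measurable_fun setT (fun w => (X j w, (X k w, others X s w))).
  exact: measurable_fun_pair.
have ijko := indep_from_pair mX lawX indepX mko iko j_ks.
pose H1 (p : E * (E * (E * (size s).-tuple E))) :=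
  H ((p.1, (p.2.1, p.2.2.1)), p.2.2.2).
have mH1 : measurable_fun setT H1 by apply: (measurableT_comp mH); mpairs.
have := integral_peel mX lawX indepX mjko ijko i_jks mH1 (fun p => H0 _).
move=> ->; apply: eq_integral => x _.
have mH2 := measurableT_comp mH1 (pair1_measurable x).
have := integral_peel mX lawX indepX mko iko j_ks mH2 (fun p => H0 _).
move=> ->; apply: eq_integral => y _.
have mH3 := measurableT_comp mH2 (pair1_measurable y).
have := integral_peel mX lawX indepX mo io k_s mH3 (fun p => H0 _).
by move=> ->; apply: eq_integral => z _; rewrite -integral_others.
Qed.

End ThreePoints.

Section FourPoints.
Variables (cl : E * (E * (E * E)) -> E -> bool) (Phi : E * (E * (E * E)) -> R).
Hypothesis mcl : measurable_fun setT (fun p : (E * (E * (E * E))) * E => cl p.1 p.2).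
Hypothesis mPhi : measurable_fun setT Phi.
Hypothesis Phi0 : forall u, 0 <= Phi u.

Lemma expect4 i j k l s : uniq [:: i, j, k, l & s] ->
  (\int[P]_w (Phi (X i w, (X j w, (X k w, X l w))) *
      (all (cl (X i w, (X j w, (X k w, X l w)))) (others X s w))%:R)%:E =
   \int[F]_x \int[F]_y \int[F]_z \int[F]_t
      (Phi (x, (y, (z, t))) * clear_prob cl (x, (y, (z, t))) ^+ size s)%:E)%E.
Proof.
rewrite 4!cons_uniq => /andP[i_jkls /andP[j_kls /andP[k_ls /andP[l_s us]]]].
pose H (p : (E * (E * (E * E))) * (size s).-tuple E) : \bar R :=
  (Phi p.1 * (all (cl p.1) p.2)%:R)%:E.
have mH : measurable_fun setT H.
  apply/measurable_EFinP; apply: measurable_funM.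
    by apply: (measurableT_comp mPhi); exact: measurable_fst.
  exact: measurable_all_clear.
have H0 p : (0 <= H p)%E by rewrite lee_fin mulr_ge0.
have io := indep_from_others mX lawX indepX us.
have mo := measurable_others mX (s := s).
have mlo : measurable_fun setT (fun w => (X l w, others X s w)).
  exact: measurable_fun_pair.
have ilo := indep_from_pair mX lawX indepX mo io l_s.
have mklo : measurable_fun setT (fun w => (X k w, (X l w, others X s w))).
  exact: measurable_fun_pair.
have iklo := indep_from_pair mX lawX indepX mlo ilo k_ls.
have mjklo : measurable_fun setT (fun w => (X j w, (X k w, (X l w, others X s w)))).
  exact: measurable_fun_pair.
have ijklo := indep_from_pair mX lawX indepX mklo iklo j_kls.
pose H1 (p : E * (E * (E * (E * (size s).-tuple E)))) :=
  H ((p.1, (p.2.1, (p.2.2.1, p.2.2.2.1))), p.2.2.2.2).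
have mH1 : measurable_fun setT H1 by apply: (measurableT_comp mH); mpairs.
have := integral_peel mX lawX indepX mjklo ijklo i_jkls mH1 (fun p => H0 _).
move=> ->; apply: eq_integral => x _.
have mH2 := measurableT_comp mH1 (pair1_measurable x).
have := integral_peel mX lawX indepX mklo iklo j_kls mH2 (fun p => H0 _).
move=> ->; apply: eq_integral => y _.
have mH3 := measurableT_comp mH2 (pair1_measurable y).
have := integral_peel mX lawX indepX mlo ilo k_ls mH3 (fun p => H0 _).
move=> ->; apply: eq_integral => z _.
have mH4 := measurableT_comp mH3 (pair1_measurable z).
have := integral_peel mX lawX indepX mo io l_s mH4 (fun p => H0 _).
by move=> ->; apply: eq_integral => t _; rewrite -integral_others.
Qed.

End FourPoints.

End Expect.

(** * Geometry of the support *)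

Section Geometry.
Context {R : realType} {d' : nat}.
Local Notation d := d'.+1.
Local Notation pt := (pt R d).
Local Notation Rd := (Rd R d).
Local Notation lebd := (@lebesgue_d R d).

(** The interface between the hypotheses of the theorem and the analysis; [C1_admissible] provides
    it with the support as [K]. *)
Record admissible (K : set Rd) (f : Rd -> R) (c1 c2 : R) : Prop := Admissible {
  adm_mK : measurable K ;
  adm_convex : forall (x y : pt) (t : R), K x -> K y -> 0 <= t <= 1 ->
    K (t *: x + (1 - t) *: y) ;
  adm_mf : measurable_fun [set: Rd] f ;
  adm_c1 : 0 < c1 ;
  adm_in : forall x, K x -> c1 <= f x <= c2 ;
  adm_out : forall x, ~ K x -> f x = 0 ;
  adm_int : (\int[lebd]_x (f x)%:E = 1)%E }.

Variables (K : set Rd) (f : Rd -> R) (c1 c2 : R).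
Hypothesis adm : admissible K f c1 c2.
Let mK := adm_mK adm.
Let mf := adm_mf adm.

Lemma adm_ge0 x : 0 <= f x.
Proof.
have [Kx|Kx] := pselect (K x); last by rewrite (adm_out adm).
by have /andP[h _] := adm_in adm Kx; apply: le_trans h; exact/ltW/(adm_c1 adm).
Qed.

Lemma adm_exK : exists x, K x.
Proof.
apply: contrapT => /forallNP nK; have := adm_int adm.
rewrite integral0_eq; last by move=> x _; rewrite (adm_out adm).
by move=> /eqP; rewrite eq_sym onee_eq0.
Qed.

Lemma adm_c2_gt0 : 0 < c2.
Proof.
have [x Kx] := adm_exK; have /andP[h1 h2] := adm_in adm Kx.
exact: lt_le_trans (adm_c1 adm) (le_trans h1 h2).
Qed.

Lemma adm_le x : f x <= c2.
Proof.
have [Kx|Kx] := pselect (K x); first by have /andP[] := adm_in adm Kx.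
by rewrite (adm_out adm)// ltW// adm_c2_gt0.
Qed.

Let mfE : measurable_fun [set: Rd] (fun x => (f x)%:E).
Proof. exact/measurable_EFinP. Qed.

Lemma adm_le_integral (A : set Rd) : measurable A ->
  (c1%:E * lebd (A `&` K) <= \int[lebd]_(x in A) (f x)%:E)%E.
Proof.
move=> mA; have mAK : measurable (A `&` K) by exact: measurableI.
apply: (@le_trans _ _ (\int[lebd]_(x in A `&` K) (f x)%:E)%E); last first.
  apply: ge0_subset_integral => //; first exact: measurable_funTS.
  by move=> x _; rewrite lee_fin adm_ge0.
rewrite -integral_cst//; apply: ge0_le_integral => //.
- by move=> x _; rewrite lee_fin ltW// (adm_c1 adm).
- exact: measurable_funTS.
- by move=> x [_ Kx]; rewrite lee_fin; have /andP[] := adm_in adm Kx.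
Qed.

(** Total mass 1 and a density of at least [c1] on [K] leave room for a volume of at most
    [1 / c1]. *)
Lemma adm_K_lty : (lebd K < +oo)%E.
Proof.
have := adm_le_integral measurableT.
rewrite setTI (adm_int adm) => h; rewrite ltey; apply/eqP => Koo.
by move: h; rewrite Koo gt0_muley ?lte_fin ?(adm_c1 adm)// leNgt ltry.
Qed.

Lemma adm_K_gt0 : (0 < lebd K)%E.
Proof.
rewrite lt_def measure_ge0 andbT; apply/eqP => K0.
have := adm_int adm.
have -> : (\int[lebd]_x (f x)%:E = \int[lebd]_(x in K) (f x)%:E)%E.
  rewrite [RHS]integral_mkcond; apply: eq_integral => x _; rewrite patchE.
  by case: ifPn => // /negP h; rewrite (adm_out adm)// => Kx; apply: h; exact/mem_set.
have : (\int[lebd]_(x in K) (f x)%:E <= c2%:E * lebd K)%E.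
  rewrite -integral_cst//; apply: ge0_le_integral => //.
  - by move=> x _; rewrite lee_fin adm_ge0.
  - exact: measurable_funTS.
  - by move=> x _; rewrite lee_fin adm_le.
by rewrite K0 mule0 => /[swap] ->; rewrite lee_fin ler10.
Qed.

Definition volK : R := fine (lebd K).

Lemma volKE : lebd K = volK%:E.
Proof. by rewrite fineK// ge0_fin_numE ?measure_ge0// adm_K_lty. Qed.

Lemma volK_gt0 : 0 < volK.
Proof. by rewrite -lte_fin -volKE adm_K_gt0. Qed.

(** Countably many cubes cover the space, so they cannot all meet [K] in null sets. *)
Lemma adm_bounded_chunk : exists k, (0 < lebd (K `&` cube k))%E.
Proof.
apply: contrapT => /forallNP h.
have h0 k : lebd (K `&` cube k) = 0%E.
  by apply/eqP; rewrite eq_le measure_ge0 andbT leNgt; apply/negP; exact: h.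
have := adm_K_gt0; rewrite ltNge => /negP; apply.
have mKk k : measurable (K `&` cube k) by apply: measurableI => //; exact: measurable_cube.
apply: le_trans (measure_sigma_subadditive lebd mKk mK _) _.
  by rewrite -setI_bigcupr bigcup_cube setIT.
by rewrite eseries0// => i _ _; exact: h0.
Qed.

Lemma enorm_cube k (x : pt) : cube k x -> enorm x <= d%:R * k%:R.
Proof.
move=> xk; have xi i : `|x ord0 i| <= k%:R.
  by have := xk i; rewrite !mxE ler_norml => /andP[-> /ltW ->].
rewrite -(@ler_pXn2r _ 2)// ?nnegrE ?enorm_ge0 ?mulr_ge0// enorm_sqr.
apply: (@le_trans _ _ (\sum_(i < d) k%:R ^+ 2)).
  apply: ler_sum => i _; rewrite -(real_normK (num_real (x ord0 i))).
  by rewrite ler_pXn2r ?nnegrE.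
rewrite sumr_const card_ord exprMn -[_ ^+ 2 *+ d]mulr_natl ler_wpM2r ?exprn_ge0//.
by rewrite -natrX ler_nat -mulnn leq_pmulr.
Qed.

(* If K were unbounded it would contain infinitely many disjoint sets
   (x_n + K0)/2 of the same positive volume, where K0 is a bounded chunk. *)
Lemma adm_bounded : exists M : R, forall x, K x -> enorm x <= M.
Proof.
apply: contrapT => /forallNP unb.
have [k k0] := adm_bounded_chunk.
pose M0 : R := d%:R * k%:R.
have far (M : R) : exists x : pt, K x /\ M < enorm x.
  have /existsNP[x /not_implyP[Kx /negP]] := unb M.
  by rewrite -ltNge => xM; exists x.
have [g gP] := choice far.
(* Each point exceeds the previous one in norm by more than [2 * M0], twice the bound on the norms
   in the chunk. *)
pose x n := iter n (fun y => g (enorm y + 2 * M0)) (g 0).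
have Kx n : K (x n) by case: n => [|n]; exact: (gP _).1.
have xS n : enorm (x n) + 2 * M0 < enorm (x n.+1) by exact: (gP _).2.
have M0_ge0 : 0 <= M0 by rewrite mulr_ge0.
have xlt m n : (m < n)%N -> enorm (x m) + 2 * M0 < enorm (x n).
  elim: n => // n IH; rewrite ltnS leq_eqVlt => /predU1P[->//|/IH h].
  by have := xS n; lra.
pose K0 := K `&` cube k.
have mK0 : measurable K0 by apply: measurableI => //; exact: measurable_cube.
pose A n : set Rd := affine 2 (- x n) @^-1` K0.
have mA n : measurable (A n).
  by rewrite -[X in measurable X]setTI; exact: measurable_affine.
have vA n : lebd (A n) = ((2 ^- d)%:E * lebd K0)%E by exact: lebesgue_d_affine.
have AK n : A n `<=` K.
  move=> y [Ky _]; have := adm_convex adm (t := 2^-1) Ky (Kx n).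
  have -> : 2^-1 *: affine 2 (- x n) y + (1 - 2^-1) *: x n = y.
    by apply/rowP => i; rewrite /affine !mxE; lra.
  by apply; lra.
(* A common point [y] would give two points [2 y - x m] and [2 y - x n] of norm at most [M0] whose
   difference [x n - x m] is longer than [2 * M0]. *)
have dA m n : (m < n)%N -> A m `&` A n = set0.
  move=> mn; apply/seteqP; split=> // y [[_ ym] [_ yn]].
  have := enorm_cube ym; have := enorm_cube yn; rewrite /affine => h1 h2.
  have := xlt m n mn.
  have := enorm_triangle (x m) (x n - x m).
  have := enorm_triangle (2 *: y - x m) (- (2 *: y - x n)); rewrite enormN.
  rewrite (_ : 2 *: y - x m - _ = x n - x m); last by apply/rowP => i; rewrite !mxE; ring.
  rewrite (_ : x m + (x n - x m) = x n); last by rewrite addrC subrK.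
  rewrite -/M0 in h1 h2; lra.
have tA : trivIset setT A.
  apply/trivIsetP => m n _ _; case: (ltngtP m n) => [mn|nm|->] //; first by rewrite dA.
    by rewrite setIC dA.
have : (lebd (\bigcup_n A n) <= lebd K)%E.
  by apply: le_outer_measure => y [n _]; exact: AK.
rewrite measure_bigcup//= leNgt => /negP; apply.
under eq_eseriesr do rewrite vA.
apply: lt_le_trans adm_K_lty _; rewrite leye_eq.
have c0 : (0 < (2 ^- d)%:E * lebd K0)%E.
  by rewrite mule_gt0// lte_fin invr_gt0 exprn_gt0.
have [e e0 ec] : exists2 e : R, 0 < e & (e%:E <= (2 ^- d)%:E * lebd K0)%E.
  have K0fin : lebd K0 \is a fin_num.
    rewrite ge0_fin_numE ?measure_ge0//.
    by apply: le_lt_trans adm_K_lty; apply: le_outer_measure => y [].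
  exists (2 ^- d * fine (lebd K0)); last by rewrite EFinM fineK.
  by rewrite -lte_fin EFinM fineK.
apply/eqP/eq_infty => r.
pose N := (Num.truncn (`|r| / e)).+1.
apply: (@le_trans _ _ (\sum_(0 <= i < N | i \in [set: nat]) e%:E)%E).
  rewrite sumEFin lee_fin (eq_bigl xpredT); last by move=> i; rewrite in_setT.
  rewrite sumr_const_nat subn0 -mulr_natr mulrC -ler_pdivrMr//.
  rewrite (le_trans _ (ltW (truncnS_gt _)))//.
  by rewrite ler_pM2r ?invr_gt0// ler_norm.
apply: (@le_trans _ _ (\sum_(0 <= i < N | i \in [set: nat]) ((2 ^- d)%:E * lebd K0))%E).
  exact: lee_sum.
by apply: nneseries_lim_ge => i _ _; exact: ltW.
Qed.

Lemma adm_diam : exists2 D : R, 0 < D & forall x y, K x -> K y -> enorm (x - y) <= D.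
Proof.
have [M KM] := adm_bounded.
have M0 : 0 <= M by have [x Kx] := adm_exK; exact: le_trans (enorm_ge0 x) (KM _ Kx).
exists (2 * M + 1); first lra.
move=> x y Kx Ky; have := enorm_triangle x (- y); rewrite enormN.
have := KM _ Kx; have := KM _ Ky; lra.
Qed.

(** The homothety with centre [m] and ratio [rho / D] maps [K] into [K] by convexity, and into the
    ball because [D] bounds the diameter. *)
Lemma adm_cone (D : R) (m : pt) (rho : R) : 0 < D ->
  (forall x y, K x -> K y -> enorm (x - y) <= D) -> K m -> 0 < rho -> rho <= D ->
  (((rho / D) ^+ d * volK)%:E <= lebd (cball m rho `&` K))%E.
Proof.
move=> D0 KD Km r0 rD; pose c := D / rho; have c0 : 0 < c by rewrite divr_gt0.
have <- : lebd (affine c (m - c *: m) @^-1` K) = ((rho / D) ^+ d * volK)%:E.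
  by rewrite lebesgue_d_affine// volKE -EFinM -[rho / D]invf_div exprVn.
apply: le_outer_measure => y /=; rewrite /affine.
set z := c *: y + _ => Kz.
have yz : y - m = c^-1 *: (z - m).
  by apply/rowP => i; rewrite !mxE; field; rewrite gt_eqF.
split.
  rewrite /cball/= yz enormZ gtr0_norm ?invr_gt0// mulrC ler_pdivrMr//.
  by rewrite /c mulrC divfK ?gt_eqF// KD.
have -> : y = c^-1 *: z + (1 - c^-1) *: m.
  by apply/rowP => i; rewrite !mxE; field; rewrite gt_eqF.
apply: (adm_convex adm) => //; rewrite invr_ge0 (ltW c0)/= invf_le1// /c.
by rewrite ler_pdivlMr// mul1r.
Qed.

Definition mid (x y : pt) : pt := 2^-1 *: (x + y).

Definition gball (x y : pt) : set Rd := cball (mid x y) (enorm (x - y) / 2).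

(** The midpoint lies in [K], and [adm_cone] applies there with radius [|x - y| / 2]; hence the
    constant [c1 vol(K) / (2 D)^d]. Pairs near the boundary get the same bound as interior ones,
    which controls long edges uniformly. *)
Lemma adm_ball_bound : exists2 c0 : R, 0 < c0 & forall x y, K x -> K y ->
  ((c0 * enorm (x - y)%R ^+ d)%:E <= \int[lebd]_(z in gball x y) (f z)%:E)%E.
Proof.
have [D D0 KD] := adm_diam.
exists (c1 * volK / (2 * D) ^+ d).
  by rewrite divr_gt0 ?mulr_gt0 ?(adm_c1 adm) ?volK_gt0 ?exprn_gt0 ?mulr_gt0.
move=> x y Kx Ky; have [->|xy] := eqVneq x y.
  have -> : enorm (y - y) = 0 by apply/eqP; rewrite subrr enorm_eq0.
  rewrite expr0n mulr0; apply: integral_ge0 => z _; rewrite lee_fin adm_ge0//.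
have n0 : 0 < enorm (x - y) by rewrite lt_def enorm_ge0 enorm_eq0 subr_eq0 xy.
have Km : K (mid x y).
  rewrite /mid (_ : _ *: _ = 2^-1 *: x + (1 - 2^-1) *: y); last first.
    by apply/rowP => i; rewrite !mxE; field.
  by apply: (adm_convex adm) => //; lra.
apply: le_trans (adm_le_integral (measurable_cball _ _)).
have := @adm_cone D (mid x y) (enorm (x - y) / 2) D0 KD Km.
have -> : c1 * volK / (2 * D) ^+ d * enorm (x - y) ^+ d =
    c1 * ((enorm (x - y) / 2 / D) ^+ d * volK).
  rewrite !expr_div_n exprMn; field.
  by rewrite !expf_neq0 ?gt_eqF.
rewrite divr_gt0// => /(_ isT) h; rewrite EFinM lee_pmul2l ?fin_numE//.
  by apply: h; have := KD _ _ Kx Ky; lra.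
by rewrite lte_fin (adm_c1 adm).
Qed.

End Geometry.

(** * Continuity of translations in mean *)

Section Translation.
Context {R : realType} {d' : nat}.
Local Notation d := d'.+1.
Local Notation pt := (pt R d).
Local Notation Rd := (Rd R d).
Local Notation lebd := (@lebesgue_d R d).

Definition trans_dist (g : Rd -> R) (w : pt) : \bar R :=
  (\int[lebd]_x (`|g (x + w)%R - g x|)%:E)%E.

Definition trans_cont (g : Rd -> R) : Prop :=
  measurable_fun setT g /\
  forall e, 0 < e -> exists2 r, 0 < r &
    forall w : pt, enorm w <= r -> (trans_dist g w <= e%:E)%E.

Lemma measurable_shift (w : pt) : measurable_fun [set: Rd] (fun x : Rd => (x + w)%R : Rd).
Proof. by apply: measurable_RdD => //; exact: measurable_cst. Qed.

Lemma ge0_integral_shift (w : pt) (g : Rd -> \bar R) :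
  measurable_fun setT g -> (forall x, 0 <= g x)%E ->
  (\int[lebd]_x g (x + w)%R = \int[lebd]_x g x)%E.
Proof.
move=> mg g0; rewrite -[RHS]mul1e -(invr1 R) -(expr1n R d).
rewrite -(ge0_integral_affine w ltr01)//.
by apply: eq_integral => x _; rewrite /affine scale1r.
Qed.

Lemma measurable_abs_sub dT (T : measurableType dT) (g h : T -> R) :
  measurable_fun setT g -> measurable_fun setT h ->
  measurable_fun setT (fun x => (`|g x - h x|)%:E).
Proof.
move=> mg mh; apply/measurable_EFinP; apply: measurableT_comp => //.
exact: measurable_funB.
Qed.

Lemma measurable_shift_diff (g : Rd -> R) (w : pt) : measurable_fun setT g ->
  measurable_fun setT (fun x : Rd => (`|g (x + w)%R - g x|)%:E).
Proof.
move=> mg; apply: measurable_abs_sub => //.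
exact: (measurableT_comp mg (measurable_shift w)).
Qed.

(** Serves finite unions of boxes, whose indicators are maxima. *)
Lemma trans_cont_max (g h : Rd -> R) : trans_cont g -> trans_cont h ->
  trans_cont (fun x => Num.max (g x) (h x)).
Proof.
move=> [mg cg] [mh ch]; split; first exact: measurable_maxr.
move=> e e0; have e20 : 0 < e / 2 by rewrite divr_gt0.
have [r1 r10 h1] := cg _ e20; have [r2 r20 h2] := ch _ e20.
exists (Num.min r1 r2); first by rewrite lt_min r10.
move=> w; rewrite le_min => /andP[w1 w2].
apply: (@le_trans _ _ (trans_dist g w + trans_dist h w)%E); last first.
  by rewrite [e]splitr EFinD leeD// ?h1 ?h2.
rewrite -ge0_integralD//; last 2 first.
- exact: measurable_shift_diff.
- exact: measurable_shift_diff.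
apply: ge0_le_integral => //.
- by apply: measurable_shift_diff; exact: measurable_maxr.
- by apply: emeasurable_funD; exact: measurable_shift_diff.
move=> x _; rewrite -EFinD lee_fin.
move: (g _) (h _) (g x) (h x) => a b a' b'.
have := ler_norm (a - a'); have := ler_norm (b - b').
have := ler_norm (a' - a); have := ler_norm (b' - b).
rewrite (distrC a' a) (distrC b' b) ler_norml.
have := normr_ge0 (a - a'); have := normr_ge0 (b - b').
rewrite /Num.max /Order.max; case: ifPn; case: ifPn; rewrite -?leNgt => *; lra.
Qed.

Lemma trans_cont_add (g h : Rd -> R) : trans_cont g -> trans_cont h ->
  trans_cont (fun x => g x + h x).
Proof.
move=> [mg cg] [mh ch]; split; first exact: measurable_funD.
move=> e e0; have e20 : 0 < e / 2 by rewrite divr_gt0.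
have [r1 r10 h1] := cg _ e20; have [r2 r20 h2] := ch _ e20.
exists (Num.min r1 r2); first by rewrite lt_min r10.
move=> w; rewrite le_min => /andP[w1 w2].
apply: (@le_trans _ _ (trans_dist g w + trans_dist h w)%E); last first.
  by rewrite [e]splitr EFinD leeD// ?h1 ?h2.
rewrite -ge0_integralD//; last 2 first.
- exact: measurable_shift_diff.
- exact: measurable_shift_diff.
apply: ge0_le_integral => //.
- by apply: measurable_shift_diff; exact: measurable_funD.
- by apply: emeasurable_funD; exact: measurable_shift_diff.
move=> x _; rewrite -EFinD lee_fin.
by rewrite opprD addrACA ler_normD.
Qed.

Lemma trans_cont_cst0 : trans_cont (fun=> 0).
Proof.
split => // e e0; exists 1 => // w _.
by rewrite /trans_dist subrr normr0 integral0 lee_fin ltW.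
Qed.

Lemma trans_cont_scale (c : R) (g : Rd -> R) : trans_cont g ->
  trans_cont (fun x => c * g x).
Proof.
move=> [mg cg]; split; first exact: measurable_funM.
move=> e e0; have c0 : 0 < `|c| + 1 by rewrite ltr_wpDl.
have [r r0 h] := cg (e / (`|c| + 1)) (divr_gt0 e0 c0).
exists r => // w /h {}h.
apply: (@le_trans _ _ ((`|c| + 1)%:E * trans_dist g w)%E); last first.
  by rewrite -lee_pdivlMl// -EFinM mulrC.
rewrite -ge0_integralZl//; last exact: measurable_shift_diff.
apply: ge0_le_integral => //.
- by apply: measurable_shift_diff; exact: measurable_funM.
- by apply: emeasurable_funM => //; exact: measurable_shift_diff.
move=> x _; rewrite -EFinM lee_fin -mulrBr normrM ler_wpM2r//.
by rewrite lerDl.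
Qed.

Lemma trans_cont_sum (I : Type) (s : seq I) (g : I -> Rd -> R) :
  (forall i, trans_cont (g i)) -> trans_cont (fun x => \sum_(i <- s) g i x).
Proof.
move=> cg; elim: s => [|i s IH].
  by under [X in trans_cont X]eq_fun do rewrite big_nil; exact: trans_cont_cst0.
by under [X in trans_cont X]eq_fun do rewrite big_cons; exact: trans_cont_add.
Qed.

(** A three-term estimate: by translation invariance the approximation error at [x + w] costs as
    much as the one at [x]. *)
Lemma trans_cont_approx (g : Rd -> R) : measurable_fun setT g ->
  (forall e, 0 < e -> exists2 h, trans_cont h &
     (\int[lebd]_x (`|g x - h x|)%:E <= e%:E)%E) ->
  trans_cont g.
Proof.
move=> mg app; split=> // e e0.
have e30 : 0 < e / 3 by rewrite divr_gt0.
have [h [mh ch] gh] := app _ e30.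
have [r r0 hr] := ch _ e30.
exists r => // w /hr {}hr.
have mgh := measurable_abs_sub mg mh.
have mghw : measurable_fun setT (fun x : Rd => (`|g (x + w)%R - h (x + w)%R|)%:E).
  by apply: measurable_abs_sub; [exact: (measurableT_comp mg (measurable_shift w))|
    exact: (measurableT_comp mh (measurable_shift w))].
apply: (@le_trans _ _ (\int[lebd]_x (`|g (x + w)%R - h (x + w)%R|)%:E +
   (trans_dist h w + \int[lebd]_x (`|g x - h x|)%:E))%E); last first.
  rewrite (_ : e = e / 3 + (e / 3 + e / 3)); last by field.
  rewrite 2!EFinD leeD ?leeD//.
  by rewrite (ge0_integral_shift w mgh).
have mhw := measurable_shift_diff w mh.
rewrite -ge0_integralD// -ge0_integralD//; last 2 first.
- by move=> x _; rewrite adde_ge0.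
- exact: emeasurable_funD.
apply: ge0_le_integral => //.
- exact: measurable_shift_diff.
- by apply: emeasurable_funD => //; exact: emeasurable_funD.
move=> x _; rewrite -!EFinD lee_fin.
rewrite (_ : g (x + w)%R - g x = (g (x + w)%R - h (x + w)%R) +
  ((h (x + w)%R - h x) - (g x - h x))); last by ring.
apply: le_trans (ler_normD _ _) _; rewrite lerD2l.
exact: ler_normB.
Qed.

(** For a shift of norm at most [r'] the two indicators differ only between the box widened by [r']
    at every face and the box shrunk by [r'], and the volume in between tends to 0 with [r']. *)
Lemma trans_cont_box (a b : pt) : trans_cont (\1_(box a b) : Rd -> R).
Proof.
split; first by apply: measurable_indic; exact: measurable_box.
move=> e e0.
(* Every side grows by [s r]: with [s = 2] each face moves outwards by [r], with [s = -2]
   inwards. *)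
pose V (s r : R) : R := \prod_(i < d) Num.max 0 (b ord0 i - a ord0 i + s * r).
have Vcvg s : V s r @[r --> (0 : R)] --> V s 0.
  apply: cvg_big => [|i _]; first exact: mul_continuous.
  apply: (@continuous_max R R^o (fun=> 0)
    (fun r => b ord0 i - a ord0 i + s * r) 0); first exact: cvg_cst.
  apply: cvgD; first exact: cvg_cst.
  by apply: cvgM; [exact: cvg_cst|exact: cvg_id].
have : (V 2 r - V (- 2) r) @[r --> (0 : R)] --> V 2 0 - V (- 2) 0.
  by apply: cvgB; exact: Vcvg.
rewrite [X in _ --> X](_ : _ = 0); last by rewrite /V !mulr0 subrr.
move=> /cvgrPdist_le/(_ e e0)/nbhs_ballP[r /= r0 hr].
exists (r / 2); first by rewrite divr_gt0.
move=> w wr; set r' := r / 2.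
have r'0 : 0 <= r' by rewrite divr_ge0// ltW.
have {}hr : V 2 r' - V (- 2) r' <= e.
  have /hr : ball (0 : R) r r'.
    rewrite -ball_normE/= sub0r normrN ger0_norm//; rewrite /r'; lra.
  by rewrite sub0r normrN; apply: le_trans; exact: ler_norm.
pose lo (s : R) : pt := \row_i (a ord0 i + s).
pose hi (s : R) : pt := \row_i (b ord0 i + s).
have volo : boxvol (lo (- r')) (hi r') = V 2 r'.
  by apply: eq_bigr => i _; rewrite !mxE; congr (Num.max _ _); ring.
have voli : boxvol (lo r') (hi (- r')) = V (- 2) r'.
  by apply: eq_bigr => i _; rewrite !mxE; congr (Num.max _ _); ring.
have mi (s t : R) : measurable_fun [set: Rd] (fun x => (\1_(box (lo s) (hi t)) x)%:E : \bar R).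
  by apply/measurable_EFinP; apply: measurable_indic; exact: measurable_box.
have md : measurable_fun [set: Rd]
    (fun x : Rd => (`|\1_(box a b) (x + w)%R - \1_(box a b) x|)%:E : \bar R).
  by apply: measurable_shift_diff; apply: measurable_indic; exact: measurable_box.
have vi s t : (\int[lebd]_x (\1_(box (lo s) (hi t)) x)%:E = (boxvol (lo s) (hi t))%:E)%E.
  rewrite integral_indic// ?setIT; last exact: measurable_box.
  exact: lebesgue_d_box.
(* Written as a sum, so that only integrals of nonnegative functions are added. *)
have key : (trans_dist \1_(box a b) w + (V (- 2) r')%:E <= (V 2 r')%:E)%E.
  rewrite -volo -voli -!vi -ge0_integralD//.
  apply: ge0_le_integral => //.
  - by move=> x _; rewrite adde_ge0.
  - exact: emeasurable_funD.
  move=> x _; rewrite -EFinD lee_fin !indicE.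
  have wi i : - r' <= w ord0 i <= r'.
    by rewrite -ler_norml (le_trans (coord_le_enorm w i)).
  have [xi|xi] := boolP (x \in box (lo r') (hi (- r'))).
    have xwab : x + w \in box a b.
      apply/mem_set => i; have := set_mem xi i; have := wi i; rewrite !mxE.
      by move=> /andP[? ?] /andP[? ?]; apply/andP; split; lra.
    have xab : x \in box a b.
      apply/mem_set => i; have := set_mem xi i; rewrite !mxE.
      by move=> /andP[? ?]; apply/andP; split; lra.
    have xo : x \in box (lo (- r')) (hi r').
      apply/mem_set => i; have := set_mem xi i; rewrite !mxE.
      by move=> /andP[? ?]; apply/andP; split; lra.
    by rewrite xwab xab xo subrr normr0 add0r.
  rewrite addr0.
  have [xwab|xwab] := boolP (x + w \in box a b).
    have -> : x \in box (lo (- r')) (hi r').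
      apply/mem_set => i; have := set_mem xwab i; have := wi i; rewrite !mxE.
      by move=> /andP[? ?] /andP[? ?]; apply/andP; split; lra.
    by case: (x \in box a b); rewrite ?subrr ?subr0 ?normr0 ?normr1.
  have [xab|xab] := boolP (x \in box a b).
    have -> : x \in box (lo (- r')) (hi r').
      apply/mem_set => i; have := set_mem xab i; rewrite !mxE.
      by move=> /andP[? ?]; apply/andP; split; lra.
    by rewrite sub0r normrN normr1.
  by rewrite subrr normr0.
apply: (@le_trans _ _ ((V 2 r')%:E - (V (- 2) r')%:E)%E).
  by rewrite leeBrDr.
by rewrite -EFinB lee_fin.
Qed.

Lemma trans_cont_bigcup_box (a b : nat -> pt) n :
  trans_cont (\1_(\bigcup_(k < n) box (a k) (b k)) : Rd -> R).
Proof.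
elim: n => [|n IH].
  rewrite bigcup_mkord big_ord0 indic0; exact: trans_cont_cst0.
have -> : \1_(\bigcup_(k < n.+1) box (a k) (b k)) = (fun x : Rd =>
    Num.max (\1_(\bigcup_(k < n) box (a k) (b k)) x) (\1_(box (a n) (b n)) x)) :> (Rd -> R).
  apply/funext => x; rewrite !bigcup_mkord big_ord_recr/= !indicE in_setU.
  by case: (_ \in _); case: (_ \in _); rewrite /= /Num.max /Order.max ?ltxx ?ltr01 ?ltr10.
exact: trans_cont_max (trans_cont_box _ _).
Qed.

(** The definition by covers provides boxes whose union [U] exceeds [A] by at most [e / 2], and
    finitely many of them carry all but [e / 2] of the measure of [U]. *)
Lemma trans_cont_indic (A : set Rd) : measurable A -> (lebd A < +oo)%E ->
  trans_cont (\1_A : Rd -> R).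
Proof.
move=> mA Aoo; apply: trans_cont_approx => [|e e0].
  exact: measurable_indic.
have Afin : lebd A \is a fin_num by rewrite ge0_fin_numE ?measure_ge0.
have e20 : 0 < e / 2 by rewrite divr_gt0.
have [_ [a [b [Aab ->]]] /ltW abA] := lb_ereal_inf_adherent e20 Afin.
have mbox k : measurable (box (a k) (b k) : set Rd) by exact: measurable_box.
pose U := \bigcup_k (box (a k) (b k) : set Rd).
pose Un n := \bigcup_(k < n) (box (a k) (b k) : set Rd).
have mU : measurable U by exact: bigcupT_measurable.
have mUn n : measurable (Un n) by apply: bigcup_measurable.
have UA : (lebd U <= lebd A + (e / 2)%:E)%E.
  apply: le_trans abA; apply: le_trans (measure_sigma_subadditive lebd mbox mU _) _ => //.
  by apply: lee_nneseries => // k _; exact: lebesgue_d_box_le.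
have Uoo : (lebd U < +oo)%E.
  by apply: le_lt_trans UA _; rewrite -(fineK Afin) -EFinD ltry.
have UnU n : Un n `<=` U by move=> x [k _ xk]; exists k.
have ndUn : nondecreasing_seq Un.
  move=> m n mn; apply/subsetPset => x [k /= km xk]; exists k => //=.
  exact: leq_trans km mn.
have cvgU : (lebd \o Un) n @[n --> \oo] --> lebd U.
  have UE : U = \bigcup_n Un n.
    apply/seteqP; split=> x; first by move=> [k _ xk]; exists k.+1 => //; exists k => /=.
    by move=> [n _]; exact: UnU.
  by rewrite UE; apply: nondecreasing_cvg_mu => //; rewrite -UE.
have [n Un_e] : exists n, (lebd U <= lebd (Un n) + (e / 2)%:E)%E.
  have Ufin : lebd U \is a fin_num by rewrite ge0_fin_numE ?measure_ge0.
  apply: contrapT => /forallNP h.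
  have : (lebd U <= lebd U - (e / 2)%:E)%E.
    apply: (cvge_le _ cvgU); apply: nearW => n.
    by rewrite leeBrDr// leNgt; apply/negP => /ltW; exact: h.
  by rewrite -(fineK Ufin) -EFinB lee_fin; lra.
exists (\1_(Un n)); first exact: trans_cont_bigcup_box.
have mi B : measurable B -> measurable_fun [set: Rd] (fun x : Rd => (\1_B x)%:E : \bar R).
  by move=> mB; apply/measurable_EFinP; exact: measurable_indic.
apply: (@le_trans _ _ (lebd (U `\` A) + lebd (U `\` Un n))%E).
  have iE (B : set Rd) : measurable B -> lebd B = (\int[lebd]_x (\1_B x)%:E)%E.
    by move=> mB; rewrite integral_indic// setIT.
  rewrite (iE _ (measurableD mU mA)) (iE _ (measurableD mU (mUn n))).
  rewrite -ge0_integralD//; last 2 first.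
  - by apply: mi; exact: measurableD.
  - by apply: mi; exact: measurableD.
  apply: ge0_le_integral => //.
  - by apply: measurable_abs_sub; exact: measurable_indic.
  - by apply: emeasurable_funD; apply: mi; exact: measurableD.
  move=> x _; rewrite -EFinD lee_fin !indicE !in_setD.
  have [xA|xA] := boolP (x \in A).
    have -> : x \in U by apply/mem_set/Aab/set_mem.
    by case: (x \in Un n); rewrite ?subrr ?normr0 ?subr0 ?normr1 ?addr0 ?add0r.
  have [xn|xn] := boolP (x \in Un n).
    have -> : x \in U by apply/mem_set/(UnU n)/set_mem.
    by rewrite sub0r normrN normr1 lerDl.
  by rewrite subrr normr0 addr_ge0.
have UnE : (lebd (U `\` Un n) <= (e / 2)%:E)%E.
  rewrite measureD//= (setIidr (UnU n)).
  by rewrite leeBlDl// ge0_fin_numE ?measure_ge0// (le_lt_trans _ Uoo)// le_outer_measure.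
have UAE : (lebd (U `\` A) <= (e / 2)%:E)%E.
  by rewrite measureD//= (setIidr Aab) leeBlDl.
by rewrite [e]splitr EFinD leeD.
Qed.

(** The sum counts the integers from 1 to [N] that do not exceed [t], so it is the integer part of
    [t]. *)
Lemma floor_sum (t : R) (N : nat) : 0 <= t <= N%:R ->
  t - 1 <= \sum_(k < N) ((k.+1%:R <= t :> R)%:R : R) <= t.
Proof.
elim: N t => [|N IH] t /andP[t0 tN].
  by rewrite big_ord0 t0 andbT; lra.
rewrite big_ord_recr/=.
have [h|h] := leP t N%:R.
  have -> : (N.+1%:R <= t) = false by apply/negbTE; rewrite -ltNge (le_lt_trans h)// ltr_nat.
  by rewrite addr0 IH// t0.
rewrite (eq_bigr (fun=> 1)); last first.
  move=> k _; rewrite (le_trans _ (ltW h))// ler_nat; exact: ltn_ord.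
rewrite sumr_const card_ord -natr1 in tN *.
by have [h1|h1] := leP (N%:R + 1) t; rewrite /= ?addr0; apply/andP; split; lra.
Qed.

(** The step function with levels [k c2 / N] is within [c2 / N] of [f] on [K] and vanishes outside,
    so its L^1 error is at most [vol(K) c2 / N]. The superlevel sets belong to positive levels; they
    lie in [K] and have finite volume. *)
Lemma adm_trans_cont (K : set Rd) (f : Rd -> R) (c1 c2 : R) :
  admissible K f c1 c2 -> trans_cont f.
Proof.
move=> adm; have mf := adm_mf adm.
apply: trans_cont_approx => // e e0.
have c20 := adm_c2_gt0 adm.
pose N := (Num.truncn (volK K * c2 / e)).+1.
have N0 : 0 < N%:R :> R by rewrite ltr0n.
pose A (k : nat) : set Rd := [set x | k.+1%:R * (c2 / N%:R) <= f x].
have mA k : measurable (A k).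
  rewrite (_ : A k = f @^-1` `[k.+1%:R * (c2 / N%:R), +oo[%classic).
    by rewrite -[X in measurable X]setTI; exact: mf.
  by apply/seteqP; split=> x; rewrite /A/= in_itv/= andbT.
have cN : 0 < c2 / N%:R by rewrite divr_gt0.
have AK k : A k `<=` K.
  move=> x; rewrite /A/= => h; apply: contrapT => nKx; move: h.
  by rewrite (adm_out adm)// leNgt mulr_gt0// ltr0n.
exists (fun x => (c2 / N%:R) * \sum_(k < N) \1_(A k) x).
  apply: trans_cont_scale; apply: trans_cont_sum => k; apply: trans_cont_indic => //.
  by apply: le_lt_trans (adm_K_lty adm); apply: le_outer_measure; exact: AK.
have mKi : measurable_fun [set: Rd] (fun x : Rd => ((c2 / N%:R) * \1_K x)%:E : \bar R).
  apply/measurable_EFinP; apply: measurable_funM => //.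
  by apply: measurable_indic; exact: (adm_mK adm).
apply: (@le_trans _ _ (\int[lebd]_x ((c2 / N%:R) * \1_K x)%:E)%E).
  apply: ge0_le_integral => //.
    apply: measurable_abs_sub => //; apply: measurable_funM => //.
    by apply: measurable_sum => k; exact: measurable_indic.
  move=> x _; rewrite lee_fin indicE.
  have [Kx|Kx] := pselect (K x); last first.
    rewrite (adm_out adm)// memNset// big1 ?mulr0 ?subrr ?normr0// => k _.
    by rewrite indicE memNset// => /AK.
  rewrite mem_set// mulr1.
  pose t := f x / (c2 / N%:R).
  have fE : f x = (c2 / N%:R) * t by rewrite /t mulrCA mulfV ?mulr1// gt_eqF.
  have sE : \sum_(k < N) \1_(A k) x = \sum_(k < N) ((k.+1%:R <= t :> R)%:R : R).
    apply: eq_bigr => k _; rewrite indicE; congr (nat_of_bool _)%:R.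
    rewrite /t ler_pdivlMr//; apply/idP/idP; first by move/set_mem.
    by move=> h; exact/mem_set.
  have /floor_sum/andP[h1 h2] : 0 <= t <= N%:R.
    rewrite divr_ge0 ?(adm_ge0 adm) ?(ltW cN)//= ler_pdivrMr// mulrCA mulfV ?gt_eqF//.
    by rewrite mulr1 (adm_le adm).
  rewrite fE sE -mulrBr normrM (gtr0_norm cN) -[leRHS]mulr1 ler_pM2l//.
  by rewrite ler_norml; apply/andP; split; lra.
under eq_integral do rewrite EFinM.
rewrite ge0_integralZl//; last 2 first.
- by apply/measurable_EFinP; apply: measurable_indic; exact: (adm_mK adm).
- by rewrite lee_fin ltW.
rewrite integral_indic ?setIT//; last exact: (adm_mK adm).
rewrite /= (volKE adm) -EFinM lee_fin.
have h : volK K * c2 / e < N%:R by exact: truncnS_gt.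
rewrite mulrAC ler_pdivrMr// mulrC (mulrC e).
by move: h; rewrite ltr_pdivrMr// => /ltW; rewrite mulrC.
Qed.

End Translation.

(** * The limit of the rescaled pair integral *)

Section RealEstimates.
Context {R : realType}.
Implicit Types (a b p s t : R) (m n c : nat).

Lemma distr_exprn_le a b m : 0 <= a <= 1 -> 0 <= b <= 1 ->
  `|a ^+ m - b ^+ m| <= m%:R * `|a - b|.
Proof.
move=> /andP[a0 a1] /andP[b0 b1]; elim: m => [|m IH].
  by rewrite !expr0 subrr normr0 mul0r.
rewrite !exprS (_ : a * a ^+ m - _ = a * (a ^+ m - b ^+ m) + b ^+ m * (a - b)); last by ring.
apply: le_trans (ler_normD _ _) _; rewrite !normrM -natr1 mulrDl mul1r lerD//.
  by rewrite (ger0_norm a0) (le_trans _ IH)// ler_piMl.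
by rewrite ger0_norm ?exprn_ge0// ler_piMl// exprn_ile1.
Qed.

Lemma expRN_ge1B t : 1 - t <= expR (- t).
Proof. exact: expR_ge1Dx. Qed.

Lemma distr_expRN_le s t : 0 <= s -> 0 <= t -> `|expR (- s) - expR (- t)| <= `|s - t|.
Proof.
wlog st : s t / s <= t.
  move=> H s0 t0; have [st|/ltW ts] := leP s t; first exact: H.
  by rewrite distrC (distrC s); exact: H.
move=> s0 t0; rewrite ger0_norm; last by rewrite subr_ge0 ler_expR lerN2.
rewrite ler0_norm ?subr_le0// opprB.
rewrite (_ : - t = - s - (t - s)); last by ring.
rewrite expRD -[X in X - _]mulr1 -mulrBr.
apply: (@le_trans _ _ (1 * (t - s))); last by rewrite mul1r.
apply: ler_pM; rewrite ?expR_ge0//.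
- by rewrite subr_ge0 -expR0 ler_expR oppr_le0 subr_ge0.
- by rewrite -expR0 ler_expR oppr_le0.
- by have := expRN_ge1B (t - s); lra.
Qed.

Lemma expRN_quad t : 0 <= t -> expR (- t) - (1 - t) <= t ^+ 2.
Proof.
move=> t0; have t1 : 0 < 1 + t by lra.
have : expR (- t) <= (1 + t)^-1.
  by rewrite expRN lef_pV2 ?posrE ?expR_gt0// expR_ge1Dx.
suff : (1 + t)^-1 - (1 - t) <= t ^+ 2 by lra.
rewrite (_ : _ - _ = t ^+ 2 / (1 + t)); last by field; rewrite gt_eqF.
by rewrite ler_pdivrMr// mulrDr mulr1 lerDl mulr_ge0// sqr_ge0.
Qed.

(** Poisson limit with an explicit error: [(1 - p)^(n - c)] is compared with [b^(n - c)] for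
    [b = exp (- a / n)], and the [c] missing factors cost at most [a c / n]. The parameter [c]
    counts the points already used as endpoints. *)
Lemma pow_exp_bound n c p a : (0 < n)%N -> (c <= n)%N -> 0 <= p <= 1 -> 0 <= a ->
  `|(1 - p) ^+ (n - c) - expR (- a)| <=
    `|n%:R * p - a| + (a ^+ 2 + a * c%:R) / n%:R.
Proof.
move=> n0 cn /andP[p0 p1] a0; have nR : 0 < n%:R :> R by rewrite ltr0n.
set m := (n - c)%N; set b := expR (- (a / n%:R)).
have an0 : 0 <= a / n%:R by rewrite divr_ge0// ltW.
have b01 : 0 <= b <= 1 by rewrite expR_ge0/= -expR0 ler_expR oppr_le0.
have mn : m%:R <= n%:R :> R by rewrite ler_nat leq_subr.
have mE : m%:R = n%:R - c%:R :> R by rewrite natrB.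
have bm : b ^+ m = expR (- (a * m%:R / n%:R)).
  by rewrite -expRM_natl; congr expR; rewrite -mulr_natl; field; rewrite gt_eqF.
have h1 : `|(1 - p) ^+ m - b ^+ m| <= `|n%:R * p - a| + a ^+ 2 / n%:R.
  apply: le_trans (@distr_exprn_le (1 - p) b m _ b01) _; first by apply/andP; split; lra.
  apply: (@le_trans _ _ (n%:R * `|(1 - p) - b|)); first by rewrite ler_wpM2r.
  have : `|1 - p - b| <= `|p - a / n%:R| + (a / n%:R) ^+ 2.
    rewrite (_ : 1 - p - b = (a / n%:R - p) - (b - (1 - a / n%:R))); last by ring.
    apply: le_trans (ler_normB _ _) _; rewrite distrC lerD2l ger0_norm.
      exact: expRN_quad.
    by rewrite subr_ge0; exact: expRN_ge1B.
  move=> h; apply: le_trans (_ : n%:R * (`|p - a / n%:R| + (a / n%:R) ^+ 2) <= _).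
    by rewrite ler_pM2l.
  have nn : n%:R != 0 :> R by rewrite gt_eqF.
  rewrite mulrDr -{1}(gtr0_norm nR) -normrM.
  rewrite (_ : n%:R * (p - a / n%:R) = n%:R * p - a); last by field.
  by rewrite (_ : n%:R * (a / n%:R) ^+ 2 = a ^+ 2 / n%:R)//; field.
have h2 : `|b ^+ m - expR (- a)| <= a * c%:R / n%:R.
  rewrite bm; apply: le_trans (distr_expRN_le _ a0) _.
    by rewrite !mulr_ge0 ?invr_ge0// ltW.
  rewrite (_ : _ - a = - (a * c%:R / n%:R)); last by rewrite mE; field; rewrite gt_eqF.
  by rewrite normrN ger0_norm// !mulr_ge0// ltW// invr_gt0.
rewrite (_ : _ - expR (- a) = ((1 - p) ^+ m - b ^+ m) + (b ^+ m - expR (- a))); last by ring.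
apply: le_trans (ler_normD _ _) _.
by rewrite mulrDl addrA lerD.
Qed.

Lemma expr1B_le_expR p m : 0 <= p <= 1 -> (1 - p) ^+ m <= expR (- (p * m%:R)).
Proof.
move=> /andP[p0 p1]; have q0 : 0 <= 1 - p by lra.
rewrite mulrC -mulrN expRM_natl.
by rewrite lerXn2r ?nnegrE ?expR_ge0// expRN_ge1B.
Qed.

Lemma ecvg_sandwich (u : nat -> \bar R) (l : R) :
  (forall e, 0 < e -> \forall n \near \oo, ((l - e)%:E <= u n <= (l + e)%:E)%E) ->
  u @ \oo --> l%:E.
Proof.
move=> h; apply/fine_cvgP; split.
  have := h 1 ltr01; apply: filterS => n /andP[h1 h2].
  by rewrite fin_numE -ltNye -ltey (lt_le_trans (ltNyr _) h1) (le_lt_trans h2 (ltry _)).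
apply/cvgrPdist_le => e e0; have := h e e0; apply: filterS => n /=.
case: (u n) => [r||] /=; rewrite ?lee_fin ?leye_eq ?leeNy_eq ?andbF//.
  by move=> /andP[h1 h2]; rewrite ler_norml; apply/andP; split; lra.
Qed.

End RealEstimates.

(** * The mass of the ball on a diameter *)

Section Kernel.
Context {R : realType} {d' : nat}.
Local Notation d := d'.+1.
Local Notation pt := (pt R d).
Local Notation Rd := (Rd R d).
Local Notation lebd := (@lebesgue_d R d).
Variables (K : set Rd) (f : Rd -> R) (c1 c2 : R).
Hypothesis adm : admissible K f c1 c2.

Definition ball_prob (x y : pt) : R := fine (\int[lebd]_(z in gball x y) (f z)%:E)%E.

Definition in_gball (p : Rd * Rd) (z : Rd) : bool :=
  enorm (z - mid p.1 p.2) <= enorm (p.1 - p.2) / 2.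

Lemma measurable_gball (x y : pt) : measurable (gball x y).
Proof. exact: measurable_cball. Qed.

Let mfE : measurable_fun [set: Rd] (fun x => (f x)%:E).
Proof. by apply/measurable_EFinP; exact: (adm_mf adm). Qed.

Lemma adm_set_le1 (A : set Rd) : measurable A -> (\int[lebd]_(z in A) (f z)%:E <= 1)%E.
Proof.
move=> mA; rewrite -(adm_int adm); apply: ge0_subset_integral => //.
by move=> x _; rewrite lee_fin (adm_ge0 adm).
Qed.

Lemma adm_set_ge0 (A : set Rd) : (0 <= \int[lebd]_(z in A) (f z)%:E)%E.
Proof. by apply: integral_ge0 => x _; rewrite lee_fin (adm_ge0 adm). Qed.

Lemma ball_probE (x y : pt) : (\int[lebd]_(z in gball x y) (f z)%:E = (ball_prob x y)%:E)%E.
Proof.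
rewrite fineK// ge0_fin_numE ?adm_set_ge0//.
by apply: le_lt_trans (adm_set_le1 (measurable_gball x y)) _; rewrite ltry.
Qed.

Lemma ball_prob01 (x y : pt) : 0 <= ball_prob x y <= 1.
Proof.
rewrite -!lee_fin -ball_probE adm_set_ge0 adm_set_le1//; exact: measurable_gball.
Qed.

Lemma measurable_mid dT (T : measurableType dT) (g h : T -> Rd) :
  measurable_fun setT g -> measurable_fun setT h ->
  measurable_fun setT (fun w => mid (g w) (h w) : Rd).
Proof.
by move=> mg mh; apply: measurable_RdZ => //; exact: measurable_RdD.
Qed.

Lemma measurable_enormB dT (T : measurableType dT) (g h : T -> Rd) :
  measurable_fun setT g -> measurable_fun setT h ->
  measurable_fun setT (fun w => enorm (g w - h w) : R).
Proof.
move=> mg mh; apply: (measurableT_comp measurable_enorm).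
exact: measurable_RdB.
Qed.

Lemma measurable_in_gball :
  measurable_fun setT (fun q : (Rd * Rd) * Rd => in_gball q.1 q.2).
Proof.
apply: measurable_fun_ler.
  by apply: measurable_enormB; [mproj|apply: measurable_mid; mproj].
by apply: measurable_funM => //; apply: measurable_enormB; mproj.
Qed.

(** It is a partial integral of a jointly measurable function, so Tonelli applies. *)
Lemma measurable_ball_prob : measurable_fun setT (fun p : Rd * Rd => ball_prob p.1 p.2).
Proof.
pose g (q : (Rd * Rd) * Rd) : \bar R := (f q.2 * (in_gball q.1 q.2)%:R)%:E.
have mb : measurable_fun setT (fun b : bool => b%:R : R) by [].
have mg : measurable_fun setT g.
  apply/measurable_EFinP; apply: measurable_funM.
    by apply: (measurableT_comp (adm_mf adm)); exact: measurable_snd.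
  exact: (measurableT_comp mb measurable_in_gball).
have g0 q : (0 <= g q)%E by rewrite lee_fin mulr_ge0 ?(adm_ge0 adm).
have := @measurable_fun_fubini_tonelli_F _ _ _ _ _ lebd _ mg g0.
rewrite (_ : fubini_F _ _ = (fun p : Rd * Rd => (ball_prob p.1 p.2)%:E)).
  by move/measurable_EFinP.
apply/funext => p; rewrite /fubini_F -ball_probE [RHS]integral_mkcond.
apply: eq_integral => z _; rewrite patchE /g mem_cball /in_gball /=.
by case: ifP; rewrite ?mulr1 ?mulr0.
Qed.

End Kernel.

Section NonnegIntegral.
Context dT (T : measurableType dT) (R : realType) (mu : {measure set T -> \bar R}).
Implicit Types f g : T -> \bar R.
Local Open Scope ereal_scope.

Lemma ge0_integralTZl (k : R) f : measurable_fun setT f -> (forall x, 0 <= f x) ->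
  (0 <= k)%R -> \int[mu]_x (k%:E * f x) = k%:E * \int[mu]_x f x.
Proof. by move=> mf f0 k0; rewrite ge0_integralZl. Qed.

Lemma ge0_integralTD f g : measurable_fun setT f -> measurable_fun setT g ->
  (forall x, 0 <= f x) -> (forall x, 0 <= g x) ->
  \int[mu]_x (f x + g x) = \int[mu]_x f x + \int[mu]_x g x.
Proof. by move=> mf mg f0 g0; rewrite ge0_integralD. Qed.

Lemma ge0_le_integralT f g : measurable_fun setT f -> measurable_fun setT g ->
  (forall x, 0 <= f x) -> (forall x, f x <= g x) ->
  \int[mu]_x f x <= \int[mu]_x g x.
Proof. by move=> mf mg f0 fg; apply: ge0_le_integral. Qed.

End NonnegIntegral.

Local Opaque ball_prob enorm powR.

(** * Rescaling of the pair integral and its domination *)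

Section ScaledLimit.
Context {R : realType} {d' : nat}.
Local Notation d := d'.+1.
Local Notation pt := (pt R d).
Local Notation Rd := (Rd R d).
Local Notation lebd := (@lebesgue_d R d).
Local Notation v := (@unit_vol R d').
Variables (K : set Rd) (f : Rd -> R) (c1 c2 : R).
Hypothesis adm : admissible K f c1 c2.
Variable alpha : R.
Hypothesis alpha0 : 0 <= alpha.
Local Notation ball_prob := (@ball_prob R d' f).

Let f0 x : 0 <= f x. Proof. exact: adm_ge0 adm x. Qed.
Let fc2 x : f x <= c2. Proof. exact: adm_le adm x. Qed.
Let c20 : 0 < c2. Proof. exact: adm_c2_gt0 adm. Qed.
Let mf : measurable_fun [set: Rd] f. Proof. exact: adm_mf adm. Qed.

Definition pair_ker (m : nat) (x y : Rd) : R :=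
  f x * f y * (enorm (x - y) `^ alpha * (1 - ball_prob x y) ^+ m).

(** The expected weight of one given pair in the presence of [m] other points; see [expect_edge]. *)
Definition pairint (m : nat) : \bar R := (\int[lebd]_x \int[lebd]_y (pair_ker m x y)%:E)%E.

(* The typical distance between neighbouring points. *)
Definition spacing (n : nat) : R := n%:R `^ (- d%:R^-1).

(* [pair_ker] in the variables [z = (y - x) / spacing n] and [x], up to a power of [n]. *)
Definition scaled_ker (n m : nat) (z x : Rd) : R :=
  f x * f (x + spacing n *: z) * (enorm z `^ alpha * (1 - ball_prob x (x + spacing n *: z)) ^+ m).

Lemma ball_prob_compl01 x y : 0 <= 1 - ball_prob x y <= 1.
Proof. by have /andP[? ?] := ball_prob01 adm x y; apply/andP; split; lra. Qed.

Lemma pair_ker_ge0 m x y : 0 <= pair_ker m x y.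
Proof.
have /andP[h _] := ball_prob_compl01 x y.
by rewrite !mulr_ge0 ?powR_ge0 ?exprn_ge0.
Qed.

Lemma scaled_ker_ge0 n m z x : 0 <= scaled_ker n m z x.
Proof.
have /andP[h _] := ball_prob_compl01 x (x + spacing n *: z).
by rewrite !mulr_ge0 ?powR_ge0 ?exprn_ge0.
Qed.

Lemma spacing_gt0 n : (0 < n)%N -> 0 < spacing n.
Proof. by move=> n0; rewrite powR_gt0// ltr0n. Qed.

Lemma spacing_exprn n : (0 < n)%N -> spacing n ^+ d = n%:R^-1.
Proof.
move=> n0; rewrite -powR_mulrn ?(ltW (spacing_gt0 n0))// -powRrM mulNr mulVf ?pnatr_eq0//.
by rewrite powR_inv1.
Qed.

Lemma spacing_powR n : spacing n `^ alpha = n%:R `^ (- (alpha / d%:R)).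
Proof. by rewrite -powRrM; congr (_ `^ _); ring. Qed.

Lemma spacing_small e : 0 < e -> \forall n \near \oo, spacing n <= e.
Proof.
move=> e0; exists (Num.truncn (e ^- d)).+1 => // n /= hN.
have n0 : (0 < n)%N by exact: leq_trans hN.
rewrite -(@ler_pXn2r _ d)// ?nnegrE ?(ltW (spacing_gt0 n0)) ?(ltW e0)//.
rewrite spacing_exprn// -[leRHS]invrK lef_pV2 ?posrE ?ltr0n ?invr_gt0 ?exprn_gt0//.
by apply: le_trans (ltW (truncnS_gt _)) _; rewrite ler_nat.
Qed.

Lemma measurable_kernel dT (T : measurableType dT) (m : nat) (g h : T -> Rd) (w : T -> R) :
  measurable_fun setT g -> measurable_fun setT h -> measurable_fun setT w ->
  measurable_fun setT (fun t => (f (g t) * f (h t) *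
     (w t `^ alpha * (1 - ball_prob (g t) (h t)) ^+ m))%:E).
Proof.
move=> mg mh mw; apply/measurable_EFinP; apply: measurable_funM.
  by apply: measurable_funM; apply: (measurableT_comp mf).
apply: measurable_funM; first exact: (measurableT_comp (measurable_powR alpha)).
apply: measurable_funX; apply: measurable_funB => //.
exact: (measurableT_comp (measurable_ball_prob adm) (measurable_fun_pair mg mh)).
Qed.

Lemma measurable_pair_ker m : measurable_fun setT (fun p : Rd * Rd => (pair_ker m p.1 p.2)%:E).
Proof. by apply: measurable_kernel; [mproj|mproj|apply: measurable_enormB; mproj]. Qed.

Lemma measurable_scaled_ker n m : measurable_fun setT (fun p : Rd * Rd => (scaled_ker n m p.1 p.2)%:E).
Proof.
apply: measurable_kernel; first mproj.
  by apply: measurable_RdD; [mproj|apply: measurable_RdZ; [mproj|]].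
by apply: (measurableT_comp measurable_enorm); mproj.
Qed.

Local Opaque spacing.

(** The substitution [y = x + spacing n z] yields the Jacobian [1 / n] and a factor [n^(- alpha/d)]
    from the norm, which the prefactor removes. Tonelli puts [z] outside, because convergence will
    hold in mean over [x] for each fixed [z]. *)
Lemma pairint_scaled n m : (0 < n)%N ->
  ((n%:R `^ (1 + alpha / d%:R))%:E * pairint m =
   \int[lebd]_z \int[lebd]_x (scaled_ker n m z x)%:E)%E.
Proof.
move=> n0; have h0 := spacing_gt0 n0.
have nR : 0 < n%:R :> R by rewrite ltr0n.
have msk := measurable_scaled_ker n m.
have mks x : measurable_fun setT (fun z : Rd => (scaled_ker n m z x)%:E).
  exact: (measurableT_comp msk (pair2_measurable x)).
have sk0 x z : (0 <= (scaled_ker n m z x)%:E)%E by rewrite lee_fin scaled_ker_ge0.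
have aux (a b : \bar R) : a = ((n%:R)%:E * b)%E -> b = ((n%:R^-1)%:E * a)%E.
  by move=> ->; rewrite muleA -EFinM mulVf ?gt_eqF// mul1e.
have hd : spacing n ^- d = n%:R by rewrite spacing_exprn// invrK.
have kerE x z : pair_ker m x (affine (spacing n) x z) = spacing n `^ alpha * scaled_ker n m z x.
  rewrite /pair_ker /scaled_ker /affine [_ *: _ + x]addrC.
  have -> : x - (x + spacing n *: z) = - (spacing n *: z) by rewrite opprD addNKr.
  rewrite enormN enormZ (gtr0_norm h0) powRM ?enorm_ge0 ?(ltW h0)//.
  move: (spacing n `^ alpha) (enorm z `^ alpha) (f x) (f _) (_ ^+ m) => *; ring.
have inner x : (\int[lebd]_y (pair_ker m x y)%:E =
    (n%:R `^ (- (1 + alpha / d%:R)))%:E * \int[lebd]_z (scaled_ker n m z x)%:E)%E.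
  have mk : measurable_fun setT (fun y : Rd => (pair_ker m x y)%:E).
    exact: (measurableT_comp (measurable_pair_ker m) (pair1_measurable x)).
  have k0 (y : Rd) : (0 <= (pair_ker m x y)%:E)%E by rewrite lee_fin pair_ker_ge0.
  have h := ge0_integral_affine x h0 mk k0.
  move: h; rewrite hd => /aux h.
  apply: (eq_trans h) => {h}.
  have -> : n%:R `^ (- (1 + alpha / d%:R)) = n%:R^-1 * spacing n `^ alpha.
    by rewrite spacing_powR opprD powRD ?(gt_eqF nR) ?implybT// powR_inv1// ltW.
  rewrite EFinM -muleA; congr (_ * _)%E.
  rewrite -(ge0_integralTZl lebd (mks x) (sk0 x) (powR_ge0 _ _)).
  by apply: eq_integral => z _; rewrite kerE EFinM.
have sk0' (p : Rd * Rd) : (0 <= (scaled_ker n m p.1 p.2)%:E)%E by exact: sk0.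
have mF := measurable_fun_fubini_tonelli_G (m1 := lebd) _ msk sk0'.
pose G := fubini_G lebd (fun p : Rd * Rd => (scaled_ker n m p.1 p.2)%:E).
have F0 x : (0 <= G x)%E by apply: integral_ge0 => z _; exact: sk0.
have -> : pairint m = (\int[lebd]_x ((n%:R `^ (- (1 + alpha / d%:R)))%:E * G x))%E.
  by apply: eq_integral => x _; exact: inner.
rewrite (ge0_integralTZl lebd mF F0 (powR_ge0 _ _)).
rewrite muleA -EFinM -powRD ?(gt_eqF nR) ?implybT// subrr powRr0 mul1e.
exact/esym/(fubini_tonelli (m1 := lebd) (m2 := lebd) _ msk sk0').
Qed.

(** Use [1 - p <= exp (- p)] with [p >= c0 |z|^d / n]; the condition [2 c <= n] leaves an exponent
    of at least [n / 2], whence [kap = c0 / 2]. If one of the two points is outside the support, the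
    kernel is 0. *)
Lemma scaled_ker_bound : exists2 kap : R, 0 < kap & forall c n z x,
  (0 < n)%N -> (2 * c <= n)%N ->
  scaled_ker n (n - c) z x <=
    f x * (c2 * (enorm z `^ alpha * expR (- (kap * enorm z ^+ d)))).
Proof.
have [c0 c00 c0P] := adm_ball_bound adm.
exists (c0 / 2); first by rewrite divr_gt0.
move=> c n z x n0 cn.
have h0 := spacing_gt0 n0; have nR : 0 < n%:R :> R by rewrite ltr0n.
set y := x + spacing n *: z.
have rhs0 : 0 <= f x * (c2 * (enorm z `^ alpha * expR (- (c0 / 2 * enorm z ^+ d)))).
  by rewrite !mulr_ge0 ?powR_ge0 ?expR_ge0// ltW.
rewrite /scaled_ker -/y.
have [Kx|Kx] := pselect (K x); last by rewrite (adm_out adm Kx) !mul0r.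
have [Ky|Ky] := pselect (K y); last by rewrite (adm_out adm Ky) mulr0 mul0r.
rewrite -mulrA ler_wpM2l// ler_pM ?mulr_ge0 ?powR_ge0 ?exprn_ge0//.
  by have /andP[] := ball_prob_compl01 x y.
rewrite ler_wpM2l ?powR_ge0//.
apply: le_trans (expr1B_le_expR _ (ball_prob01 adm x y)) _.
rewrite ler_expR lerN2.
have := c0P _ _ Kx Ky; rewrite (ball_probE adm) lee_fin.
rewrite (_ : x - y = - (spacing n *: z)); last by rewrite /y opprD addNKr.
rewrite enormN enormZ (gtr0_norm h0) exprMn spacing_exprn// => h.
apply: (@le_trans _ _ (c0 * (n%:R^-1 * enorm z ^+ d) * (n - c)%:R)); last by rewrite ler_wpM2r.
have mn : n%:R / 2 <= (n - c)%:R :> R.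
  rewrite natrB; last by lia.
  have : (2 * c)%:R <= n%:R :> R by rewrite ler_nat.
  by rewrite natrM; lra.
rewrite (_ : c0 / 2 * _ = c0 * (n%:R^-1 * enorm z ^+ d) * (n%:R / 2)); last first.
  by field; rewrite gt_eqF.
by rewrite ler_wpM2l// !mulr_ge0 ?invr_ge0 ?exprn_ge0 ?enorm_ge0// ltW.
Qed.

End ScaledLimit.

Local Opaque ball_prob enorm powR spacing.

(** * The error at a fixed displacement *)

Section LocalLimit.
Context {R : realType} {d' : nat}.
Local Notation d := d'.+1.
Local Notation pt := (pt R d).
Local Notation Rd := (Rd R d).
Local Notation lebd := (@lebesgue_d R d).
Local Notation v := (@unit_vol R d').
Variables (K : set Rd) (f : Rd -> R) (c1 c2 : R).
Hypothesis adm : admissible K f c1 c2.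
Variable alpha : R.
Hypothesis alpha0 : 0 <= alpha.
Local Notation ball_prob := (@ball_prob R d' f).
Local Notation spacing := (@spacing R d').
Local Notation scaled_ker := (@scaled_ker R d' f alpha).

Let f0 x : 0 <= f x. Proof. exact: adm_ge0 adm x. Qed.
Let fc2 x : f x <= c2. Proof. exact: adm_le adm x. Qed.
Let c20 : 0 < c2. Proof. exact: adm_c2_gt0 adm. Qed.
Let mf : measurable_fun [set: Rd] f. Proof. exact: adm_mf adm. Qed.
Let mfE : measurable_fun [set: Rd] (fun x => (f x)%:E).
Proof. exact/measurable_EFinP. Qed.

Definition ballvol (z : pt) : R := (enorm z / 2) ^+ d * v.

Lemma ballvol_ge0 (z : pt) : 0 <= ballvol z.
Proof. by rewrite mulr_ge0 ?unit_vol_ge0// exprn_ge0// divr_ge0// enorm_ge0. Qed.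

Lemma gball0_vol (z : pt) : lebd (gball 0%R z) = (ballvol z)%:E.
Proof.
by rewrite lebesgue_d_cball ?divr_ge0 ?enorm_ge0// sub0r enormN.
Qed.

Lemma gball0_le (z u : pt) : gball 0%R z u -> enorm u <= enorm z.
Proof.
rewrite /gball /cball /mid/= add0r sub0r enormN => h.
have := enorm_triangle (u - 2^-1 *: z) (2^-1 *: z); rewrite subrK enormZ ger0_norm//.
lra.
Qed.

(** The ball with diameter from [x] to [x + spacing n z] is the affine image of the one with
    diameter from 0 to [z], and [n] cancels the Jacobian. *)
Lemma ball_prob_scale n (x z : pt) : (0 < n)%N ->
  ((n%:R * ball_prob x (x + spacing n *: z)%R)%:E =
   \int[lebd]_(u in gball 0%R z) (f (x + spacing n *: u)%R)%:E)%E.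
Proof.
move=> n0; have h0 : 0 < spacing n by exact: spacing_gt0.
have nR : 0 < n%:R :> R by rewrite ltr0n.
set y := x + spacing n *: z.
pose g (w : Rd) : \bar R := ((f w)%:E * (\1_(gball x y) w)%:E)%E.
have mg : measurable_fun setT g.
  apply: emeasurable_funM => //; apply/measurable_EFinP.
  by apply: measurable_indic; exact: measurable_gball.
have g0 w : (0 <= g w)%E by rewrite mule_ge0 ?lee_fin.
have hd : spacing n ^- d = n%:R by rewrite spacing_exprn// invrK.
have intg : (\int[lebd]_w g w = (ball_prob x y)%:E)%E.
  by rewrite -(ball_probE adm) [RHS]integral_mkcond epatch_indic.
have h := ge0_integral_affine x h0 mg g0.
rewrite hd intg -EFinM in h; rewrite -h [RHS]integral_mkcond epatch_indic.
apply: eq_integral => u _; rewrite /g /affine [_ *: u + x]addrC /=.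
congr (_ * _)%E; rewrite !indicE; congr ((nat_of_bool _)%:R)%:E.
rewrite !mem_cball.
have -> : x + spacing n *: u - mid x y = spacing n *: (u - mid 0 z).
  by rewrite /mid /y; apply/rowP => i; rewrite !mxE; field.
have -> : x - y = spacing n *: (0 - z) by rewrite /y; apply/rowP => i; rewrite !mxE; ring.
by rewrite !enormZ (gtr0_norm h0) -mulrA ler_pM2l.
Qed.

(** [f x * ballvol z] is the integral of the constant [f x] over the same ball, so the error is at
    most the integrated oscillation of [f]. *)
Lemma ball_prob_error n (x z : pt) : (0 < n)%N ->
  ((`|n%:R * ball_prob x (x + spacing n *: z)%R - f x * ballvol z|)%:E <=
   \int[lebd]_(u in gball 0%R z) (`|f (x + spacing n *: u)%R - f x|)%:E)%E.
Proof.
move=> n0.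
have mB : measurable (gball 0%R z : set Rd) by exact: measurable_gball.
have msh : measurable_fun setT (fun u : Rd => (x + spacing n *: u)%R : Rd).
  by apply: measurable_RdD => //; apply: measurable_RdZ.
have mfs : measurable_fun setT (fun u : Rd => f (x + spacing n *: u)).
  exact: (measurableT_comp mf msh).
have mA : measurable_fun (gball 0%R z) (fun u : Rd => (f (x + spacing n *: u)%R)%:E).
  by apply: measurable_funTS; exact/measurable_EFinP.
have mD : measurable_fun (gball 0%R z) (fun u : Rd => (`|f (x + spacing n *: u)%R - f x|)%:E).
  by apply: measurable_funTS; exact: measurable_abs_sub.
set A := n%:R * _; set B := f x * _.
set D := (\int[lebd]_(u in _) _)%E.
have AE : (A%:E = \int[lebd]_(u in gball 0%R z) (f (x + spacing n *: u)%R)%:E)%E.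
  exact: ball_prob_scale.
have BE : (B%:E = \int[lebd]_(u in gball 0%R z) (cst (f x)%:E u))%E.
  by rewrite integral_cst// /B EFinM -gball0_vol.
have tri (g1 g2 g3 : Rd -> \bar R) :
    measurable_fun (gball 0%R z) g1 -> measurable_fun (gball 0%R z) g2 ->
    measurable_fun (gball 0%R z) g3 ->
    (forall u, 0 <= g1 u)%E -> (forall u, 0 <= g2 u)%E -> (forall u, 0 <= g3 u)%E ->
    (forall u, g1 u <= g2 u + g3 u)%E ->
    (\int[lebd]_(u in gball 0%R z) g1 u <= \int[lebd]_(u in gball 0%R z) g2 u +
       \int[lebd]_(u in gball 0%R z) g3 u)%E.
  move=> m1 m2 m3 p1 p2 p3 le123; rewrite -ge0_integralD//.
  by apply: ge0_le_integral => //; exact: emeasurable_funD.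
have AB : (A%:E <= B%:E + D)%E.
  rewrite AE BE; apply: tri => //; try by move=> u; rewrite /= lee_fin.
  by move=> u; rewrite -EFinD lee_fin -lerBlDl ler_norm.
have BA : (B%:E <= A%:E + D)%E.
  rewrite AE BE; apply: tri => //; try by move=> u; rewrite /= lee_fin.
  by move=> u; rewrite -EFinD lee_fin -lerBlDl distrC ler_norm.
move: AB BA; case: D => [r| |] //=; last by rewrite !leey.
  rewrite -!EFinD !lee_fin => h1 h2; rewrite ler_norml; apply/andP; split; lra.
Qed.

(** After Tonelli the bound is an integral, over [u] in the ball, of translation distances of [f];
    the ball with diameter from 0 to [z] stays within [|z|] of 0, so each shift has length at most
    [spacing n * |z|]. *)
Lemma ball_prob_error_int n (z : pt) (e : R) : (0 < n)%N ->
  (forall w : pt, enorm w <= spacing n * enorm z -> (trans_dist f w <= e%:E)%E) ->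
  (\int[lebd]_x (`|n%:R * ball_prob x (x + spacing n *: z)%R - f x * ballvol z|)%:E <=
    (e * ballvol z)%:E)%E.
Proof.
move=> n0 he; have h0 : 0 < spacing n by exact: spacing_gt0.
pose g (p : Rd * Rd) : \bar R :=
  ((`|f (p.1 + spacing n *: p.2)%R - f p.1|)%:E * (\1_(gball 0%R z) p.2)%:E)%E.
have msh : measurable_fun setT (fun p : Rd * Rd => (p.1 + spacing n *: p.2)%R : Rd).
  by apply: measurable_RdD; [mproj|apply: measurable_RdZ; [mproj|]].
have mg : measurable_fun setT g.
  apply: emeasurable_funM.
    apply: measurable_abs_sub; first exact: (measurableT_comp mf msh).
    by apply: (measurableT_comp mf); mproj.
  apply/measurable_EFinP.
  have mi : measurable_fun [set: Rd] (\1_(gball 0%R z) : Rd -> R).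
    by apply: measurable_indic; exact: measurable_gball.
  by apply: (measurableT_comp mi); mproj.
have g0 p : (0 <= g p)%E by rewrite mule_ge0 ?lee_fin.
have gx x : (\int[lebd]_u g (x, u) =
    \int[lebd]_(u in gball 0%R z) (`|f (x + spacing n *: u)%R - f x|)%:E)%E.
  by rewrite [RHS]integral_mkcond epatch_indic.
have mFx := measurable_fun_fubini_tonelli_F (m2 := lebd) _ mg g0.
have mE : measurable_fun setT
    (fun x : Rd => (`|n%:R * ball_prob x (x + spacing n *: z)%R - f x * ballvol z|)%:E).
  have msx : measurable_fun setT (fun x : Rd => (x + spacing n *: z)%R : Rd).
    exact: measurable_shift.
  apply: measurable_abs_sub; apply: measurable_funM => //.
  exact: (measurableT_comp (measurable_ball_prob adm) (measurable_fun_pair (@measurable_id _ _ setT) msx)).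
apply: (@le_trans _ _ (\int[lebd]_x \int[lebd]_u g (x, u))%E).
  apply: ge0_le_integralT => //.
  by move=> x; rewrite gx; exact: ball_prob_error.
rewrite (fubini_tonelli (m1 := lebd) (m2 := lebd) _ mg g0).
have mG := measurable_fun_fubini_tonelli_G (m1 := lebd) _ mg g0.
apply: (@le_trans _ _ (\int[lebd]_u (e%:E * (\1_(gball 0%R z) u)%:E))%E); last first.
  have e0 : 0 <= e.
    have := he 0; rewrite (_ : enorm 0 = 0); last by apply/eqP; rewrite enorm_eq0.
    rewrite mulr_ge0 ?enorm_ge0 ?(ltW h0)// => /(_ isT) h.
    by rewrite -lee_fin; apply: le_trans h; exact: integral_ge0.
  rewrite ge0_integralTZl//; last first.
    by apply/measurable_EFinP; apply: measurable_indic; exact: measurable_gball.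
  rewrite integral_indic ?setIT//; last exact: measurable_gball.
  by rewrite [X in (_ * X)%E]gball0_vol EFinM.
apply: ge0_le_integralT => //.
- apply: emeasurable_funM => //; apply/measurable_EFinP.
  by apply: measurable_indic; exact: measurable_gball.
- by move=> u; apply: integral_ge0.
move=> u; rewrite indicE; have [ub|ub] := boolP (u \in gball 0%R z).
  rewrite mule1; apply: (@le_trans _ _ (trans_dist f (spacing n *: u))).
    by under eq_integral do rewrite /g indicE/= ub mule1.
  apply: he; rewrite enormZ (gtr0_norm h0) ler_pM2l//.
  exact/gball0_le/set_mem.
rewrite mule0 integral0_eq// => x _.
by rewrite /g indicE/= (negbTE ub) mule0.
Qed.

Definition limit_ker (z x : Rd) : R :=
  f x * f x * (enorm z `^ alpha * expR (- (f x * ballvol z))).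

Lemma limit_ker_ge0 z x : 0 <= limit_ker z x.
Proof. by rewrite !mulr_ge0 ?powR_ge0 ?expR_ge0. Qed.

(* An upper bound for [|scaled_ker - limit_ker|] that is small in L^1 for fixed [z]. *)
Definition error_ker (c n : nat) (z x : Rd) : R := enorm z `^ alpha *
  (c2 * `|f (x + spacing n *: z) - f x| +
   (c2 ^+ 2 * `|n%:R * ball_prob x (x + spacing n *: z) - f x * ballvol z| +
    c2 * (((c2 * ballvol z) ^+ 2 + c2 * ballvol z * c%:R) / n%:R) * f x)).

(** The error splits into the change of one density and the change of the avoidance probability;
    [pow_exp_bound] controls the second. *)
Lemma scaled_ker_limit_ker c n (z x : Rd) : (0 < n)%N -> (c <= n)%N ->
  `|scaled_ker n (n - c) z x - limit_ker z x| <= error_ker c n z x.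
Proof.
move=> n0 cn; rewrite /scaled_ker /limit_ker /error_ker.
set w := enorm z `^ alpha; set y := x + spacing n *: z.
have w0 : 0 <= w by exact: powR_ge0.
have V0 := ballvol_ge0 z; set V := ballvol z in V0 *.
have nR : 0 < n%:R :> R by rewrite ltr0n.
have a0 : 0 <= f x * V by rewrite mulr_ge0.
have := pow_exp_bound n0 cn (ball_prob01 adm x y) a0.
have /andP[q0 q1] := ball_prob_compl01 adm x y.
have Q0 : 0 <= (1 - ball_prob x y) ^+ (n - c) <= 1 by rewrite exprn_ge0//= exprn_ile1.
move: ((1 - ball_prob x y) ^+ (n - c)) Q0 => Q /andP[Q0 Q1].
set E := expR _; set A := `|n%:R * ball_prob x y - _|; set C := (_ / n%:R).
set C' := (_ / n%:R) => h.
have CC : C <= C'.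
  rewrite ler_pM2r ?invr_gt0//.
  have aV : f x * V <= c2 * V by rewrite ler_wpM2r.
  by rewrite lerD// ?ler_wpM2r// lerXn2r ?nnegrE// (le_trans a0).
have C0 : 0 <= C by rewrite divr_ge0 ?(ltW nR)// addr_ge0 ?sqr_ge0// mulr_ge0.
have -> : f x * f y * (w * Q) - f x * f x * (w * E) =
  w * (f x * ((f y - f x) * Q) + f x * f x * (Q - E)) by ring.
rewrite normrM (ger0_norm w0) ler_wpM2l//.
apply: le_trans (ler_normD _ _) _; apply: lerD.
  rewrite !normrM (ger0_norm (f0 x)) (ger0_norm Q0).
  by rewrite ler_pM ?mulr_ge0// ler_piMr.
rewrite !normrM (ger0_norm (f0 x)).
apply: (@le_trans _ _ (f x * f x * (A + C))).
  by rewrite ler_wpM2l// mulr_ge0.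
rewrite mulrDr lerD//.
  by apply: ler_wpM2r; [exact: normr_ge0|rewrite expr2 ler_pM].
(* One factor [f x] is kept instead of being bounded by [c2]: a constant would not be integrable
   over the whole space. *)
apply: (@le_trans _ _ (c2 * f x * C')); last by rewrite mulrAC.
by apply: ler_pM => //; [exact: mulr_ge0|rewrite ler_wpM2r].
Qed.

End LocalLimit.

Section PairLimit.
Context {R : realType} {d' : nat}.
Local Notation d := d'.+1.
Local Notation pt := (pt R d).
Local Notation Rd := (Rd R d).
Local Notation lebd := (@lebesgue_d R d).
Local Notation v := (@unit_vol R d').
Variables (K : set Rd) (f : Rd -> R) (c1 c2 : R).
Hypothesis adm : admissible K f c1 c2.
Variable alpha : R.
Hypothesis alpha0 : 0 <= alpha.
Local Notation ball_prob := (@ball_prob R d' f).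
Local Notation spacing := (@spacing R d').
Local Notation scaled_ker := (@scaled_ker R d' f alpha).
Local Notation limit_ker := (@limit_ker R d' f alpha).
Local Notation error_ker := (@error_ker R d' f c2 alpha).

Let f0 x : 0 <= f x. Proof. exact: adm_ge0 adm x. Qed.
Let fc2 x : f x <= c2. Proof. exact: adm_le adm x. Qed.
Let c20 : 0 < c2. Proof. exact: adm_c2_gt0 adm. Qed.
Let mf : measurable_fun [set: Rd] f. Proof. exact: adm_mf adm. Qed.
Let mfE : measurable_fun [set: Rd] (fun x => (f x)%:E).
Proof. exact/measurable_EFinP. Qed.

Lemma measurable_limit_ker : measurable_fun setT (fun p : Rd * Rd => (limit_ker p.1 p.2)%:E).
Proof.
have mn : measurable_fun setT (fun p : Rd * Rd => enorm p.1 : R).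
  by apply: (measurableT_comp measurable_enorm); mproj.
have mf2 : measurable_fun setT (fun p : Rd * Rd => f p.2).
  by apply: (measurableT_comp mf); mproj.
apply/measurable_EFinP; apply: measurable_funM; first exact: measurable_funM.
apply: measurable_funM; first exact: (measurableT_comp (measurable_powR alpha)).
apply: measurableT_comp => //; apply: (measurableT_comp (@oppr_measurable R setT)).
apply: measurable_funM => //; apply: measurable_funM => //.
by apply: measurable_funX; apply: measurable_funM.
Qed.

Section FixedDisplacement.
Variable z : Rd.

Let mmove n : measurable_fun setT (fun x : Rd => (`|f (x + spacing n *: z)%R - f x|)%:E).
Proof.
by apply: measurable_abs_sub => //; exact: (measurableT_comp mf (measurable_shift _)).
Qed.

Let mgpe n : measurable_fun setT
  (fun x : Rd => (`|n%:R * ball_prob x (x + spacing n *: z)%R - f x * ballvol z|)%:E).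
Proof.
apply: measurable_abs_sub; apply: measurable_funM => //.
exact: (measurableT_comp (measurable_ball_prob adm)
  (measurable_fun_pair (@measurable_id _ _ setT) (measurable_shift _))).
Qed.

Lemma measurable_error_ker c n : measurable_fun setT (fun x : Rd => (error_ker c n z x)%:E).
Proof.
apply/measurable_EFinP; apply: measurable_funM => //.
apply: measurable_funD.
  by apply: measurable_funM => //; apply/measurable_EFinP; exact: (mmove n).
apply: measurable_funD; first by apply: measurable_funM => //; apply/measurable_EFinP; exact: (mgpe n).
exact: measurable_funM.
Qed.

Let errcst (c : nat) : R := (c2 * ballvol z) ^+ 2 + c2 * ballvol z * c%:R.

Let errcst_ge0 c : 0 <= errcst c.
Proof.
rewrite addr_ge0 ?sqr_ge0// mulr_ge0// mulr_ge0 ?ballvol_ge0//; exact: ltW.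
Qed.

Lemma error_ker_int c n e : (0 < n)%N -> 0 <= e ->
  (forall w : pt, enorm w <= spacing n * enorm z -> (trans_dist f w <= e%:E)%E) ->
  (\int[lebd]_x (error_ker c n z x)%:E <=
    (enorm z `^ alpha * (c2 * e + (c2 ^+ 2 * (e * ballvol z) + c2 * (errcst c / n%:R))))%:E)%E.
Proof.
move=> n0 e0 he; have h0 : 0 < spacing n by exact: spacing_gt0.
have w0 : 0 <= enorm z `^ alpha by exact: powR_ge0.
pose g1 (x : Rd) : \bar R := (c2%:E * (`|f (x + spacing n *: z)%R - f x|)%:E)%E.
pose g2 (x : Rd) : \bar R :=
  ((c2 ^+ 2)%:E * (`|n%:R * ball_prob x (x + spacing n *: z)%R - f x * ballvol z|)%:E)%E.
pose g3 (x : Rd) : \bar R := ((c2 * (errcst c / n%:R))%:E * (f x)%:E)%E.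
have mg1 : measurable_fun setT g1 by exact: emeasurable_funM.
have mg2 : measurable_fun setT g2 by exact: emeasurable_funM.
have mg3 : measurable_fun setT g3 by exact: emeasurable_funM.
have c2' : 0 <= c2 by exact: ltW.
have k3 : 0 <= c2 * (errcst c / n%:R) by rewrite mulr_ge0// divr_ge0.
have p1 x : (0 <= g1 x)%E by rewrite mule_ge0.
have p2 x : (0 <= g2 x)%E by rewrite mule_ge0// lee_fin exprn_ge0.
have p3 x : (0 <= g3 x)%E by rewrite mule_ge0// lee_fin.
have p23 x : (0 <= g2 x + g3 x)%E by rewrite adde_ge0.
have p123 x : (0 <= g1 x + (g2 x + g3 x))%E by rewrite adde_ge0.
have m23 := emeasurable_funD mg2 mg3.
have m123 := emeasurable_funD mg1 m23.
have -> : (\int[lebd]_x (error_ker c n z x)%:E =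
   (enorm z `^ alpha)%:E * \int[lebd]_x (g1 x + (g2 x + g3 x)))%E.
  rewrite -(ge0_integralTZl lebd m123 p123 w0).
  by [].
rewrite EFinM lee_wpmul2l ?lee_fin//.
rewrite (ge0_integralTD lebd mg1 m23 p1 p23) (ge0_integralTD lebd mg2 mg3 p2 p3).
rewrite !EFinD; apply: leeD; last apply: leeD.
- rewrite (ge0_integralTZl lebd (mmove n) _ c2'); last by move=> x; rewrite lee_fin.
  rewrite EFinM lee_wpmul2l// he// enormZ (gtr0_norm h0)//.
- rewrite (ge0_integralTZl lebd (mgpe n)) ?exprn_ge0//.
  rewrite [leRHS]EFinM lee_wpmul2l ?lee_fin ?exprn_ge0//.
  exact: (ball_prob_error_int adm n0 he).
- rewrite (ge0_integralTZl lebd mfE _ k3); last by move=> x; rewrite lee_fin.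
  by rewrite (adm_int adm) mule1.
Qed.

Lemma error_ker_small c eta : 0 < eta ->
  \forall n \near \oo, (\int[lebd]_x (error_ker c n z x)%:E <= eta%:E)%E.
Proof.
move=> eta0; have w0 : 0 <= enorm z `^ alpha by exact: powR_ge0.
set w := enorm z `^ alpha in w0 *.
have V0 := ballvol_ge0 z.
(* [S] dominates the coefficient of [e], and the added 1 keeps it positive when [w = 0]. Half of
   [eta] is spent on the translation error, half on the term in [1 / n]. *)
pose S := w * (c2 + c2 ^+ 2 * ballvol z) + 1.
have S0 : 0 < S.
  have c2' : 0 <= c2 by exact: ltW.
  by rewrite ltr_wpDl// mulr_ge0// addr_ge0// mulr_ge0// exprn_ge0.
pose e := eta / 2 / S.
have e0 : 0 < e by rewrite !divr_gt0.
have [r r0 hr] := (adm_trans_cont adm).2 e e0.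
have z1 : 0 < enorm z + 1 by rewrite ltr_wpDl// enorm_ge0.
have hsm := spacing_small (divr_gt0 r0 z1).
near=> n.
have n0 : (0 < n)%N by near: n; exact: nbhs_infty_gt.
have hnz : spacing n * enorm z <= r.
  have : spacing n <= r / (enorm z + 1) by near: n.
  rewrite ler_pdivlMr// => h; apply: le_trans h.
  by rewrite ler_pM2l ?spacing_gt0// lerDl.
apply: le_trans (error_ker_int c n0 (ltW e0) _) _.
  by move=> u uz; apply: hr; exact: le_trans uz hnz.
rewrite lee_fin.
have hc : w * (c2 * errcst c) / n%:R <= eta / 2.
  rewrite ler_pdivrMr ?ltr0n// [eta / 2 * _]mulrC -ler_pdivrMr ?divr_gt0//.
  near: n; exact: nbhs_infty_ger.
have hS : S * e = eta / 2 by rewrite /e mulrC divfK// gt_eqF.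
have : w * (c2 * e + c2 ^+ 2 * (e * ballvol z)) <= S * e.
  rewrite /S mulrDl mul1r.
  rewrite (_ : w * _ = w * (c2 + c2 ^+ 2 * ballvol z) * e); last by ring.
  by rewrite lerDl ltW.
rewrite hS => h.
rewrite (_ : w * _ = w * (c2 * e + c2 ^+ 2 * (e * ballvol z)) +
  w * (c2 * errcst c) / n%:R); last by rewrite /w; ring.
lra.
Unshelve. all: by end_near. Qed.

Let msker n m : measurable_fun setT (fun x : Rd => (scaled_ker n m z x)%:E).
Proof. exact: (measurableT_comp (measurable_scaled_ker adm alpha n m) (pair1_measurable z)). Qed.

Let mlim : measurable_fun setT (fun x : Rd => (limit_ker z x)%:E).
Proof. exact: (measurableT_comp measurable_limit_ker (pair1_measurable z)). Qed.

Let lim0 x : (0 <= (limit_ker z x)%:E)%E.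
Proof. by rewrite lee_fin (limit_ker_ge0 adm). Qed.

Let sk0 n m x : (0 <= (scaled_ker n m z x)%:E)%E.
Proof. by rewrite lee_fin (scaled_ker_ge0 adm). Qed.

Lemma limit_ker_int_le :
  (\int[lebd]_x (limit_ker z x)%:E <= (c2 * enorm z `^ alpha)%:E)%E.
Proof.
have k0 : 0 <= c2 * enorm z `^ alpha by rewrite mulr_ge0 ?powR_ge0// ltW.
rewrite -[leRHS]mule1 -(adm_int adm) -(ge0_integralTZl lebd mfE _ k0); last first.
  by move=> x; rewrite lee_fin.
apply: ge0_le_integralT => //; first exact: emeasurable_funM.
move=> x; rewrite -EFinM lee_fin /limit_ker -/(ballvol z).
rewrite [leRHS]mulrC -mulrA ler_wpM2l// ler_pM ?mulr_ge0 ?powR_ge0 ?expR_ge0//.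
rewrite ler_piMr ?powR_ge0// -expR0 ler_expR oppr_le0 mulr_ge0//.
exact: ballvol_ge0.
Qed.

Lemma scaled_ker_cvg c :
  (fun n => \int[lebd]_x (scaled_ker n (n - c) z x)%:E)%E @ \oo -->
  (\int[lebd]_x (limit_ker z x)%:E)%E.
Proof.
have Lfin : (\int[lebd]_x (limit_ker z x)%:E)%E \is a fin_num.
  rewrite ge0_fin_numE ?integral_ge0//.
  by apply: le_lt_trans limit_ker_int_le _; rewrite ltry.
rewrite -(fineK Lfin); apply: ecvg_sandwich => e e0.
have hsm := error_ker_small c e0.
near=> n.
have n0 : (0 < n)%N by near: n; exact: nbhs_infty_gt.
have cn : (c <= n)%N by near: n; exact: nbhs_infty_ge.
have he : (\int[lebd]_x (error_ker c n z x)%:E <= e%:E)%E by near: n.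
have ek x : (0 <= (error_ker c n z x)%:E)%E.
  by rewrite lee_fin (le_trans (normr_ge0 _) (scaled_ker_limit_ker adm alpha z x n0 cn)).
have mek := measurable_error_ker c n.
apply/andP; split.
  rewrite EFinB (fineK Lfin) leeBlDr//.
  apply: (@le_trans _ _ (\int[lebd]_x ((scaled_ker n (n - c) z x)%:E + (error_ker c n z x)%:E))%E).
    apply: ge0_le_integralT => //; first exact: emeasurable_funD.
    move=> x; rewrite -EFinD lee_fin; have := scaled_ker_limit_ker adm alpha z x n0 cn.
    by rewrite ler_norml => /andP[h _]; lra.
  by rewrite ge0_integralTD// leeD2l.
rewrite EFinD (fineK Lfin).
apply: (@le_trans _ _ (\int[lebd]_x ((limit_ker z x)%:E + (error_ker c n z x)%:E))%E).
  apply: ge0_le_integralT => //; first exact: emeasurable_funD.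
  move=> x; rewrite -EFinD lee_fin; have := scaled_ker_limit_ker adm alpha z x n0 cn.
  by rewrite ler_norml => /andP[_ h]; lra.
by rewrite ge0_integralTD// leeD2l.
Unshelve. all: by end_near. Qed.

End FixedDisplacement.

End PairLimit.

(** * Dominated convergence and the value of the limit *)

Section PairLimitValue.
Context {R : realType} {d' : nat}.
Local Notation d := d'.+1.
Local Notation pt := (pt R d).
Local Notation Rd := (Rd R d).
Local Notation lebd := (@lebesgue_d R d).
Local Notation v := (@unit_vol R d').
Variables (K : set Rd) (f : Rd -> R) (c1 c2 : R).
Hypothesis adm : admissible K f c1 c2.
Variable alpha : R.
Hypothesis alpha0 : 0 <= alpha.
Local Notation scaled_ker := (@scaled_ker R d' f alpha).
Local Notation limit_ker := (@limit_ker R d' f alpha).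

Let f0 x : 0 <= f x. Proof. exact: adm_ge0 adm x. Qed.
Let c20 : 0 < c2. Proof. exact: adm_c2_gt0 adm. Qed.
Let mf : measurable_fun [set: Rd] f. Proof. exact: adm_mf adm. Qed.
Let mfE : measurable_fun [set: Rd] (fun x => (f x)%:E).
Proof. exact/measurable_EFinP. Qed.

Lemma scaled_ker_int_le : exists2 kap : R, 0 < kap & forall c n (z : Rd),
  (0 < n)%N -> (2 * c <= n)%N ->
  (\int[lebd]_x (scaled_ker n (n - c) z x)%:E <=
   (c2 * (enorm z `^ alpha * expR (- (kap * enorm z ^+ d))))%:E)%E.
Proof.
have [kap kap0 kapP] := scaled_ker_bound adm alpha0.
exists kap => // c n z n0 cn.
set B := c2 * _.
have B0 : 0 <= B by rewrite !mulr_ge0 ?powR_ge0 ?expR_ge0// ltW.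
rewrite -[leRHS]mule1 -(adm_int adm) -(ge0_integralTZl lebd mfE _ B0); last first.
  by move=> x; rewrite lee_fin.
apply: ge0_le_integralT.
- exact: (measurableT_comp (measurable_scaled_ker adm alpha n (n - c)) (pair1_measurable z)).
- exact: emeasurable_funM.
- by move=> x; rewrite lee_fin (scaled_ker_ge0 adm).
- by move=> x; rewrite -EFinM lee_fin mulrC; exact: kapP.
Qed.

Lemma scaled_cvg c :
  (fun n => \int[lebd]_z \int[lebd]_x (scaled_ker n (n - c) z x)%:E)%E @ \oo -->
  (\int[lebd]_z \int[lebd]_x (limit_ker z x)%:E)%E.
Proof.
have [kap kap0 kapP] := scaled_ker_int_le.
(* After this shift [0 < n] and [2 c <= n] hold at every index, so the domination needed by
   [dominated_cvg] holds throughout. *)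
pose N0 := (2 * c).+1.
rewrite -(cvg_shiftn N0).
have mg : measurable_fun setT (fun z : Rd =>
    (c2 * (enorm z `^ alpha * expR (- (kap * enorm z ^+ d))))%:E).
  apply/measurable_EFinP; apply: measurable_funM => //.
  by apply/measurable_EFinP; exact: measurable_enorm_powR_expR.
have sk0 n (z : Rd) : (0 <= \int[lebd]_x (scaled_ker n (n - c) z x)%:E)%E.
  by apply: integral_ge0 => x _; rewrite lee_fin (scaled_ker_ge0 adm).
apply: (@dominated_cvg _ _ _ lebd setT measurableT
  (fun n z => \int[lebd]_x (scaled_ker (n + N0) (n + N0 - c) z x)%:E)%E
  (fun z => \int[lebd]_x (limit_ker z x)%:E)%E
  (fun z => (c2 * (enorm z `^ alpha * expR (- (kap * enorm z ^+ d))))%:E)) => //.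
- move=> n.
  have sk0' (p : Rd * Rd) : (0 <= (scaled_ker (n + N0) (n + N0 - c) p.1 p.2)%:E)%E.
    by rewrite lee_fin (scaled_ker_ge0 adm).
  exact: (measurable_fun_fubini_tonelli_F (m2 := lebd) _
    (measurable_scaled_ker adm alpha (n + N0) (n + N0 - c)) sk0').
- move=> z _; have := scaled_ker_cvg adm (alpha := alpha) (z := z) c.
  by rewrite -(cvg_shiftn N0).
- apply/integrableP; split=> //.
  under eq_integral => z _.
    rewrite gee0_abs; last first.
      by rewrite lee_fin !mulr_ge0 ?powR_ge0 ?expR_ge0// ltW.
    rewrite EFinM; over.
  rewrite ge0_integralTZl ?(ltW c20)//; last 2 first.
  - exact: measurable_enorm_powR_expR.
  - by move=> z; rewrite lee_fin mulr_ge0 ?powR_ge0 ?expR_ge0.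
  by rewrite integral_radial_moment// -EFinM ltry.
- move=> n z _; rewrite gee0_abs//; apply: kapP; rewrite /N0; lia.
Qed.

(** For [x] in the support the [z]-integral is a radial moment of rate [t = f x * v / 2^d], the
    power of 2 because the ball has radius [|z| / 2]. Together with the factor [f x * f x] this
    leaves [f x] to the power [1 - alpha/d], and [(v / 2^d)^(-(1 + alpha/d))] produces
    [2^(d + alpha)]. *)
Lemma limit_ker_value :
  (\int[lebd]_z \int[lebd]_x (limit_ker z x)%:E =
   (2 `^ (d%:R + alpha) * v `^ (- (alpha / d%:R)) * Gamma (1 + alpha / d%:R))%:E *
   \int[lebd]_(x in K) (f x `^ ((d%:R - alpha) / d%:R))%:E)%E.
Proof.
have ml := measurable_limit_ker adm alpha.
have l0 (p : Rd * Rd) : (0 <= (limit_ker p.1 p.2)%:E)%E by rewrite lee_fin (limit_ker_ge0 adm).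
rewrite (fubini_tonelli (m1 := lebd) (m2 := lebd) _ ml l0).
set C := 2 `^ _ * _ * _.
have C0 : 0 <= C by rewrite !mulr_ge0 ?powR_ge0 ?Gamma_ge0.
have mp : measurable_fun setT (fun x : Rd => (f x `^ ((d%:R - alpha) / d%:R))%:E).
  by apply/measurable_EFinP; exact: (measurableT_comp (measurable_powR _) mf).
rewrite [X in (_ * X)%E]integral_mkcond -ge0_integralTZl//; last 2 first.
- by apply: (iffLR (measurable_restrictT _ (adm_mK adm))); exact: measurable_funTS.
- by move=> x; rewrite erestrict_ge0// => y _; rewrite lee_fin powR_ge0.
apply: eq_integral => x _; rewrite patchE.
have v0 : 0 < v by exact: unit_vol_gt0.
case: ifPn => [/set_mem Kx|/negP xK]; last first.
  rewrite mule0 integral0_eq// => z _.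
  by rewrite /limit_ker (adm_out adm) ?mul0r// => Kx; apply: xK; exact/mem_set.
have fx0 : 0 < f x.
  by have /andP[h _] := adm_in adm Kx; apply: lt_le_trans h; exact: (adm_c1 adm).
pose t := f x * (v / 2 ^+ d).
have t0 : 0 < t by rewrite mulr_gt0// divr_gt0// exprn_gt0.
have h : (\int[lebd]_z (limit_ker z x)%:E =
    (f x * f x)%:E * \int[lebd]_z (enorm z `^ alpha * expR (- (t * enorm z ^+ d)))%:E)%E.
  rewrite -(ge0_integralTZl lebd (measurable_enorm_powR_expR alpha t)); last 2 first.
  - by move=> z; rewrite lee_fin mulr_ge0 ?powR_ge0 ?expR_ge0.
  - by rewrite mulr_ge0// ltW.
  apply: eq_integral => z _; rewrite /limit_ker -EFinM; congr (_ * (_ * expR _))%:E.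
  by rewrite /ballvol /t expr_div_n; field.
rewrite h integral_radial_moment// -!EFinM; congr (_%:E).
set b := alpha / d%:R; set G := Gamma _.
have vd0 : 0 < v / 2 ^+ d by rewrite divr_gt0// exprn_gt0.
have -> : (d%:R - alpha) / d%:R = 2%:R + - (1 + b) :> R.
  by rewrite mulrBl divff ?pnatr_eq0//; rewrite /b; ring.
rewrite powRD ?(gt_eqF fx0) ?implybT// powR_mulrn ?(ltW fx0)//.
rewrite /t powRM ?(ltW fx0) ?(ltW vd0)//.
have -> : (v / 2 ^+ d) `^ (- (1 + b)) = v^-1 * v `^ (- b) * 2 `^ (d%:R + alpha).
  rewrite powRM ?(ltW v0) ?invr_ge0 ?exprn_ge0//; congr (_ * _).
    by rewrite opprD powRD ?(gt_eqF v0) ?implybT// powR_inv1// ltW.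
  have -> : (2 ^+ d)^-1 = 2 `^ (- d%:R) :> R by rewrite powRN powR_mulrn.
  rewrite -powRrM; congr (_ `^ _).
  by rewrite mulrNN mulrDr mulr1 /b mulrC divfK ?pnatr_eq0.
rewrite /C -/b -/G expr2; field; rewrite gt_eqF//.
Qed.

(* Twice the limit in the theorem: ordered pairs count every edge twice. *)
Definition pair_limit : R :=
  2 `^ (d%:R + alpha) * v `^ (- (alpha / d%:R)) * Gamma (1 + alpha / d%:R) *
  fine (\int[lebd]_(x in K) (f x `^ ((d%:R - alpha) / d%:R))%:E).

Lemma pair_limitE :
  (\int[lebd]_z \int[lebd]_x (limit_ker z x)%:E = pair_limit%:E)%E.
Proof.
rewrite limit_ker_value /pair_limit [in RHS]EFinM fineK// ge0_fin_numE; last first.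
  by apply: integral_ge0 => x _; rewrite lee_fin powR_ge0.
set p := (d%:R - alpha) / d%:R.
have mp : measurable_fun setT (fun x : Rd => (f x `^ p)%:E).
  by apply/measurable_EFinP; exact: (measurableT_comp (measurable_powR _) mf).
have c10 := adm_c1 adm.
have mK := adm_mK adm.
(* The exponent [p] may have either sign, so the bound uses the powers of both [c1] and [c2]. *)
apply: (@le_lt_trans _ _ (\int[lebd]_(x in K) (cst (c1 `^ p + c2 `^ p)%:E x))%E).
  apply: ge0_le_integral => //.
  - by move=> x _; rewrite lee_fin powR_ge0.
  - exact: measurable_funTS.
  move=> x Kx; rewrite lee_fin; have /andP[h1 h2] := adm_in adm Kx.
  have fx0 : 0 < f x := lt_le_trans c10 h1.
  have [p0|p0] := leP 0 p.
    apply: (@le_trans _ _ (c2 `^ p)); last by rewrite lerDr powR_ge0.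
    by rewrite ge0_ler_powR// nnegrE ltW.
  apply: (@le_trans _ _ (c1 `^ p)); last by rewrite lerDl powR_ge0.
  rewrite -[p]opprK !(powRN _ (- p)) lef_pV2 ?posrE ?powR_gt0//.
  have np0 : 0 <= - p by rewrite oppr_ge0 ltW.
  by rewrite (ge0_ler_powR np0)// nnegrE ltW.
by rewrite integral_cst// [X in (_ * X)%E](volKE adm) -EFinM ltry.
Qed.

Lemma pairint_cvg c :
  (fun n => (n%:R `^ (1 + alpha / d%:R))%:E * pairint f alpha (n - c))%E @ \oo -->
  pair_limit%:E.
Proof.
rewrite -pair_limitE.
apply: cvg_trans (scaled_cvg c); apply: near_eq_cvg; near=> n.
rewrite (pairint_scaled adm)//; near: n; exact: nbhs_infty_gt.
Unshelve. all: by end_near. Qed.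

End PairLimitValue.

(** * First and second moments of the edge sum *)

Section MonotoneIntegral.
Context dT (T : measurableType dT) (R : realType) (mu : {measure set T -> \bar R}).
Local Open Scope ereal_scope.

(* Unlike [ge0_le_integral], no measurability is needed: the integral of a
   nonnegative function is a supremum over the simple functions below it. *)
Lemma ge0_le_integral_any (f g : T -> \bar R) :
  (forall x, 0 <= f x) -> (forall x, f x <= g x) ->
  \int[mu]_x f x <= \int[mu]_x g x.
Proof.
move=> f0 fg; have g0 x : 0 <= g x := le_trans (f0 x) (fg x).
rewrite !ge0_integralTE//; apply: le_ereal_sup => _ [h hf <-].
by exists h => // x; exact: le_trans (hf x) (fg x).
Qed.

(** Adding an infinite value on [N] to the larger function makes the comparison hold everywhere and
    leaves its integral unchanged. *)
Lemma ge0_le_integral_off_null (N : set T) (f g : T -> \bar R) :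
  measurable N -> mu N = 0 -> measurable_fun setT g ->
  (forall x, 0 <= f x) -> (forall x, 0 <= g x) ->
  (forall x, ~ N x -> f x <= g x) -> \int[mu]_x f x <= \int[mu]_x g x.
Proof.
move=> mN N0 mg f0 g0 fg.
pose k : T -> \bar R := (cst +oo) \_ N.
have mk : measurable_fun setT k.
  by apply: (iffLR (measurable_restrictT _ mN)); exact: measurable_cst.
have k0 x : 0 <= k x by rewrite /k erestrict_ge0// => y _; rewrite /cst leey.
apply: (@le_trans _ _ (\int[mu]_x (g x + k x))).
  apply: ge0_le_integral_any => // x; rewrite /k patchE.
  case: ifPn => [_|/negP xN]; first by rewrite addey ?leey// gt_eqF// (lt_le_trans (ltNyr 0%R) (g0 x)).
  by rewrite adde0 fg// => Nx; apply: xN; exact/mem_set.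
rewrite (ge0_integralTD mu mg mk g0 k0) [X in _ + X](_ : _ = 0) ?adde0//.
by rewrite /k -integral_mkcond integral_cst// N0 mule0.
Qed.

End MonotoneIntegral.

(** * Bounds for integrals under the common law of the points *)

Section Law.
Context {R : realType} {d' : nat}.
Local Notation d := d'.+1.
Local Notation pt := (pt R d).
Local Notation Rd := (Rd R d).
Local Notation lebd := (@lebesgue_d R d).
Local Notation v := (@unit_vol R d').
Variables (K : set Rd) (f : Rd -> R) (c1 c2 : R).
Hypothesis adm : admissible K f c1 c2.
Variable F : probability Rd R.
Hypothesis FE : forall A : set Rd, measurable A ->
  F A = (\int[lebd]_(x in A) (f x)%:E)%E.

Let f0 x : 0 <= f x. Proof. exact: adm_ge0 adm x. Qed.
Let fc2 x : f x <= c2. Proof. exact: adm_le adm x. Qed.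
Let c20 : 0 < c2. Proof. exact: adm_c2_gt0 adm. Qed.
Let mf : measurable_fun [set: Rd] f. Proof. exact: adm_mf adm. Qed.

Lemma integral_law (g : Rd -> \bar R) :
  measurable_fun setT g -> (forall x, 0 <= g x)%E ->
  (\int[F]_x g x = \int[lebd]_x (g x * (f x)%:E))%E.
Proof. exact: ge0_integral_density. Qed.

Lemma integral_law_le (g : Rd -> \bar R) :
  measurable_fun setT g -> (forall x, 0 <= g x)%E ->
  (\int[F]_x g x <= c2%:E * \int[lebd]_x g x)%E.
Proof.
move=> mg g0; rewrite integral_law// -ge0_integralTZl ?(ltW c20)//.
by apply: ge0_le_integral_any => x; rewrite 1?muleC ?mule_ge0 ?lee_wpmul2r ?lee_fin.
Qed.

Lemma law_outside : F (~` K) = 0%E.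
Proof.
rewrite FE; last by apply: measurableC; exact: (adm_mK adm).
by apply: integral0_eq => x Kx; rewrite (adm_out adm).
Qed.

(** The law charges only [K], so estimates valid for points of the support can be used inside nested
    integrals. *)
Lemma integral_law_mono (g h : Rd -> \bar R) : measurable_fun setT h ->
  (forall x, 0 <= g x)%E -> (forall x, 0 <= h x)%E ->
  (forall x, K x -> g x <= h x)%E -> (\int[F]_x g x <= \int[F]_x h x)%E.
Proof.
move=> mh g0 h0 gh; apply: (@ge0_le_integral_off_null _ _ _ F (~` K)) => //.
- by apply: measurableC; exact: (adm_mK adm).
- exact: law_outside.
- by move=> x /contrapT; exact: gh.
Qed.

(** The shape of the upper bounds for one edge; [t] will be a multiple of [n]. *)
Definition decay (a t : R) (x y : pt) : R :=
  enorm (x - y) `^ a * expR (- (t * enorm (x - y) ^+ d)).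

Lemma decay_ge0 a t x y : 0 <= decay a t x y.
Proof. by rewrite mulr_ge0 ?powR_ge0 ?expR_ge0. Qed.

Lemma measurable_decay a t (x : Rd) : measurable_fun setT (fun y : Rd => (decay a t x y)%:E).
Proof.
have := measurable_enorm_powR_expR (d' := d') a t => /measurable_EFinP h.
apply/measurable_EFinP; apply: (measurableT_comp h); exact: measurable_RdB.
Qed.

(** The bound [f <= c2] and translation invariance make this uniform in [x]. With [t] a multiple of
    [n] it is of order [n^(-(1 + a/d))]. *)
Lemma law_decay_le a t x : 0 <= a -> 0 < t ->
  (\int[F]_y (decay a t x y)%:E <=
    (c2 * (v * Gamma (1 + a / d%:R) * t `^ (- (1 + a / d%:R))))%:E)%E.
Proof.
move=> a0 t0; have d0 y : (0 <= (decay a t x y)%:E)%E by rewrite lee_fin decay_ge0.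
have md := measurable_decay a t x.
apply: le_trans (integral_law_le md d0) _.
rewrite [leRHS]EFinM lee_wpmul2l ?lee_fin ?(ltW c20)//.
rewrite -(integral_radial_moment a0 t0) -(ge0_integral_shift (x : pt) md d0).
apply: ge0_le_integral_any => [y|y]; first exact: d0.
by rewrite /decay opprD [- y - x]addrC addrA subrr sub0r enormN.
Qed.

Lemma measurable_near (x : Rd) (r : R) :
  measurable_fun setT (fun z : Rd => ((enorm (x - z) <= r)%R%:R : R)%:E).
Proof.
have mb : measurable_fun setT (fun b : bool => b%:R : R) by [].
apply/measurable_EFinP; apply: (measurableT_comp mb).
by apply: measurable_fun_ler => //; exact: measurable_enormB.
Qed.

Lemma law_ball_le (x : pt) (r : R) : 0 <= r ->
  (\int[F]_z ((enorm (x - z) <= r)%R%:R)%:E <= (c2 * (v * r ^+ d))%:E)%E.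
Proof.
move=> r0; have d0 (z : Rd) : (0 <= ((enorm (x - z) <= r)%R%:R : R)%:E)%E by rewrite lee_fin.
apply: le_trans (integral_law_le (measurable_near x r) d0) _.
rewrite [leRHS]EFinM lee_wpmul2l ?lee_fin ?(ltW c20)//.
rewrite [v * _]mulrC -(lebesgue_d_cball x r0) -[cball x r]setIT.
rewrite -integral_indic//; last exact: measurable_cball.
apply: ge0_le_integral_any => // z.
by rewrite lee_fin indicE mem_cball enorm_distC.
Qed.

(** [q] lies below both exponentials, hence below their geometric mean. This is a product of two
    decays at half the rate, whence [c / 2]. *)
Lemma sep_expr_le (q p p' r s c t : R) m : 0 <= q -> q <= 1 - p -> q <= 1 - p' ->
  c * r <= p -> c * s <= p' -> 0 <= r -> 0 <= s -> t <= m%:R * (c / 2) ->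
  q ^+ m <= expR (- (t * r)) * expR (- (t * s)).
Proof.
move=> q0 qp qp' rp sp r0 s0 tm; rewrite -expRD.
have h1 : q <= expR (- (c * r)).
  by apply: le_trans (expRN_ge1B _); apply: le_trans qp _; lra.
have h2 : q <= expR (- (c * s)).
  by apply: le_trans (expRN_ge1B _); apply: le_trans qp' _; lra.
have h : q <= expR (- (c / 2 * (r + s))).
  rewrite -(@ler_pXn2r _ 2)// ?nnegrE ?expR_ge0// -expRM_natl.
  rewrite (_ : 2%:R * _ = - (c * r) + - (c * s)); last by field.
  by rewrite expRD expr2 ler_pM.
apply: (@le_trans _ _ (expR (- (c / 2 * (r + s))) ^+ m)).
  by rewrite lerXn2r ?nnegrE ?expR_ge0.
rewrite -expRM_natl ler_expR.
have : t * (r + s) <= m%:R * (c / 2) * (r + s) by rewrite ler_wpM2r// addr_ge0.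
by move=> ?; lra.
Qed.

End Law.

Lemma integral_probability_cst dT (T : measurableType dT) (R : realType)
  (P : probability T R) (c : R) : (\int[P]_x (cst c%:E x) = c%:E)%E.
Proof.
rewrite integral_cst// [X in (_ * X)%E](_ : _ = 1%E) ?mule1//; exact: probability_setT.
Qed.

(** * One edge, and two edges with a common endpoint *)

Section PointIntegrals.
Context {R : realType} {d' : nat}.
Local Notation d := d'.+1.
Local Notation pt := (pt R d).
Local Notation Rd := (Rd R d).
Local Notation lebd := (@lebesgue_d R d).
Local Notation v := (@unit_vol R d').
Variables (K : set Rd) (f : Rd -> R) (c1 c2 : R).
Hypothesis adm : admissible K f c1 c2.
Variable F : probability Rd R.
Hypothesis FE : forall A : set Rd, measurable A ->
  F A = (\int[lebd]_(x in A) (f x)%:E)%E.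
Variable alpha : R.
Hypothesis alpha0 : 0 <= alpha.
Local Notation ball_prob := (@ball_prob R d' f).

Let f0 x : 0 <= f x. Proof. exact: adm_ge0 adm x. Qed.
Let c20 : 0 < c2. Proof. exact: adm_c2_gt0 adm. Qed.
Let mf : measurable_fun [set: Rd] f. Proof. exact: adm_mf adm. Qed.

Definition clear (p : Rd * Rd) (z : Rd) : bool := ~~ in_gball p z.

Lemma measurable_clear_fun : measurable_fun setT (fun q : (Rd * Rd) * Rd => clear q.1 q.2).
Proof. by apply: measurable_neg; exact: measurable_in_gball. Qed.

Lemma clear_set p : [set z | clear p z] = ~` gball p.1 p.2.
Proof. by apply/seteqP; split => z /=; rewrite /clear /in_gball => /negP. Qed.

Lemma law_gball x y : F (gball x y) = (ball_prob x y)%:E.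
Proof. by rewrite FE ?(ball_probE adm)//; exact: measurable_gball. Qed.

Lemma clear_probE x y : clear_prob F clear (x, y) = 1 - ball_prob x y.
Proof.
rewrite /clear_prob clear_set probability_setC; last exact: measurable_gball.
by rewrite law_gball.
Qed.

Section ClearProb.
Context dU (U : measurableType dU) (cl : U -> Rd -> bool) (u : U).
Hypothesis mcl : measurable_fun setT (fun p : U * Rd => cl p.1 p.2).

Let mset : measurable [set z | cl u z]. Proof. exact: measurable_clear. Qed.

Lemma clear_prob_ge0 : 0 <= clear_prob F cl u. Proof. exact: fine_ge0. Qed.

Lemma clear_prob_le x y : (forall z, cl u z -> clear (x, y) z) ->
  clear_prob F cl u <= 1 - ball_prob x y.
Proof.
move=> h; rewrite -clear_probE; apply: fine_le; rewrite ?fin_num_measure//.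
  by rewrite clear_set; apply: measurableC; exact: measurable_gball.
apply: le_measure; rewrite ?inE//.
by rewrite clear_set; apply: measurableC; exact: measurable_gball.
Qed.

Lemma clear_prob_disjoint x y z t :
  (forall w, cl u w -> clear (x, y) w /\ clear (z, t) w) ->
  gball x y `&` gball z t = set0 ->
  clear_prob F cl u <= (1 - ball_prob x y) * (1 - ball_prob z t).
Proof.
move=> h dis.
have mB a b : measurable (gball a b : set Rd) by exact: measurable_gball.
have mU : measurable (gball x y `|` gball z t : set Rd) by exact: measurableU.
have : (F [set w | cl u w] <= (1 - (ball_prob x y + ball_prob z t))%:E)%E.
  have FU : (F (gball x y `|` gball z t) = (ball_prob x y + ball_prob z t)%:E)%E.
    by apply: (eq_trans (measureU F (mB x y) (mB z t) dis)); rewrite EFinD; congr (_ + _)%E; exact: law_gball.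
  rewrite EFinB -FU -(probability_setC F mU).
  apply: le_measure; rewrite ?inE//; first exact: measurableC.
  move=> w /= /h[]; rewrite /clear /in_gball/= => /negP h1 /negP h2.
  by move=> [].
rewrite -[X in (X <= _)%E]fineK ?fin_num_measure// lee_fin => hq.
apply: le_trans hq _; have /andP[p0 _] := ball_prob01 adm x y; have /andP[q0 _] := ball_prob01 adm z t.
move: (ball_prob x y) (ball_prob z t) p0 q0 => p q p0 q0.
rewrite (_ : (1 - p) * _ = 1 - (p + q) + p * q); last by ring.
by rewrite lerDl mulr_ge0.
Qed.

End ClearProb.

Lemma gball_endl (x y w : pt) : gball x y w -> enorm (w - x) <= enorm (x - y).
Proof.
rewrite /gball /cball/= => h.
have := enorm_triangle (w - mid x y) (mid x y - x); rewrite addrA subrK.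
have -> : mid x y - x = 2^-1 *: (y - x) by rewrite /mid; apply/rowP => i; rewrite !mxE; field.
rewrite enormZ ger0_norm// (enorm_distC y); lra.
Qed.

(** Each ball stays within its edge length of [x] or of [z], and both lengths are less than half of
    [|x - z|]. *)
Lemma gball_disjoint (x y z t : pt) :
  2 * enorm (x - y) < enorm (x - z) -> 2 * enorm (z - t) < enorm (x - z) ->
  gball x y `&` gball z t = set0.
Proof.
move=> h1 h2; apply/seteqP; split => // w [/gball_endl hw1 /gball_endl hw2].
have := enorm_triangle (x - w) (w - z); rewrite addrA subrK (enorm_distC x w).
by move=> ?; exfalso; lra.
Qed.

Lemma law_pairint a m :
  (\int[F]_x \int[F]_y (enorm (x - y)%R `^ a * (1 - ball_prob x y) ^+ m)%:E = pairint f a m)%E.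
Proof.
pose g (p : Rd * Rd) : \bar R := (enorm (p.1 - p.2)%R `^ a * (1 - ball_prob p.1 p.2) ^+ m)%:E.
have mg : measurable_fun setT g.
  apply/measurable_EFinP; apply: measurable_funM.
    by apply: (measurableT_comp (measurable_powR a)); apply: measurable_enormB; mproj.
  by apply: measurable_funX; apply: measurable_funB => //; exact: (measurable_ball_prob adm).
have g0 p : (0 <= g p)%E.
  have /andP[h _] := ball_prob_compl01 adm p.1 p.2.
  by rewrite lee_fin mulr_ge0 ?powR_ge0 ?exprn_ge0.
have mG := measurable_fun_fubini_tonelli_F (m2 := F) _ mg g0.
have G0 x : (0 <= fubini_F F g x)%E by apply: integral_ge0.
have h := integral_law adm FE mG G0; rewrite /fubini_F /g/= in h.
rewrite h /pairint; apply: eq_integral => x _.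
have mgx : measurable_fun setT (fun y => g (x, y)) by exact: (measurableT_comp mg (pair1_measurable x)).
have h' := integral_law adm FE mgx (fun y => g0 _); rewrite /g/= in h'.
rewrite h' muleC -ge0_integralTZl//.
- by apply: eq_integral => y _; rewrite /g/= -!EFinM /pair_ker; congr (_%:E); ring.
- by apply: emeasurable_funM => //; exact/measurable_EFinP.
- by move=> y; rewrite mule_ge0 ?lee_fin//; exact: (g0 (x, y)).
Qed.

Variable c0 : R.
Hypothesis c00 : 0 < c0.
Hypothesis c0P : forall x y, K x -> K y -> c0 * enorm (x - y) ^+ d <= ball_prob x y.

Definition decay_mass (a t : R) : R :=
  c2 * (v * Gamma (1 + a / d%:R) * t `^ (- (1 + a / d%:R))).

Lemma decay_mass_ge0 a t : 0 <= decay_mass a t.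
Proof. by rewrite !mulr_ge0 ?powR_ge0 ?unit_vol_ge0 ?Gamma_ge0// ltW. Qed.

Section Exponential.
Variables (t : R) (m : nat).
Hypothesis t0 : 0 < t.
Hypothesis tm : t <= m%:R * (c0 / 2).

Lemma decay_bound dU (U : measurableType dU) (cl : U -> Rd -> bool) (u : U) x y x' y' :
  measurable_fun setT (fun p : U * Rd => cl p.1 p.2) ->
  (forall w, cl u w -> clear (x, y) w /\ clear (x', y') w) ->
  K x -> K y -> K x' -> K y' ->
  enorm (x - y) `^ alpha * enorm (x' - y') `^ alpha * clear_prob F cl u ^+ m <=
    decay alpha t x y * decay alpha t x' y'.
Proof.
move=> mcl h Kx Ky Kx' Ky'.
rewrite /decay mulrACA ler_wpM2l ?mulr_ge0 ?powR_ge0//.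
apply: (@sep_expr_le _ _ (ball_prob x y) (ball_prob x' y') _ _ c0) => //.
- exact: clear_prob_ge0.
- by apply: clear_prob_le => // w /h[].
- by apply: clear_prob_le => // w /h[].
- exact: c0P.
- exact: c0P.
- by rewrite exprn_ge0 ?enorm_ge0.
- by rewrite exprn_ge0 ?enorm_ge0.
Qed.

Definition clear3 (u : Rd * (Rd * Rd)) (w : Rd) : bool :=
  clear (u.1, u.2.1) w && clear (u.1, u.2.2) w.

Lemma measurable_clear3 :
  measurable_fun setT (fun p : (Rd * (Rd * Rd)) * Rd => clear3 p.1 p.2).
Proof.
pose V := (Rd * (Rd * Rd) * Rd)%type.
have h1 : measurable_fun setT (fun p : V => ((p.1.1, p.1.2.1), p.2)) by mpairs.
have h2 : measurable_fun setT (fun p : V => ((p.1.1, p.1.2.2), p.2)) by mpairs.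
exact: (measurable_and (measurableT_comp measurable_clear_fun h1)
  (measurableT_comp measurable_clear_fun h2)).
Qed.

(** Integrating over [z] and then over [y], each decay yields one mass. For [t] of order [n] the
    bound is of order [n^(-2(1 + alpha/d))], against about [n^3] pairs of edges with a common
    endpoint. *)
Lemma law_shared :
  (\int[F]_x \int[F]_y \int[F]_z (enorm (x - y)%R `^ alpha * enorm (x - z)%R `^ alpha *
     clear_prob F clear3 (x, (y, z)) ^+ m)%:E <= (decay_mass alpha t ^+ 2)%:E)%E.
Proof.
set M := decay_mass alpha t.
have M0 : 0 <= M by exact: decay_mass_ge0.
have q0 (a b c : Rd) : (0 <= (enorm (a - b)%R `^ alpha * enorm (a - c)%R `^ alpha *
     clear_prob F clear3 (a, (b, c)) ^+ m)%:E)%E.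
  by rewrite lee_fin !mulr_ge0 ?powR_ge0 ?exprn_ge0 ?clear_prob_ge0.
have dM x : (\int[F]_y (decay alpha t x y)%:E <= M%:E)%E by exact: (law_decay_le adm FE).
have de0 (x y : Rd) : (0 <= (decay alpha t x y)%:E)%E by rewrite lee_fin decay_ge0.
apply: (@le_trans _ _ (\int[F]_x (cst (M ^+ 2)%:E x))%E); last first.
  by rewrite integral_probability_cst.
apply: (integral_law_mono adm FE) => //.
- by move=> x; apply: integral_ge0 => y _; exact: integral_ge0.
- by move=> x; rewrite lee_fin exprn_ge0.
move=> x Kx.
apply: (@le_trans _ _ (\int[F]_y (M%:E * (decay alpha t x y)%:E))%E); last first.
  rewrite (ge0_integralTZl F (measurable_decay _ _ _) (de0 x) M0) /cst expr2 [leRHS]EFinM.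
  by apply: lee_wpmul2l; [rewrite lee_fin|exact: dM].
apply: (integral_law_mono adm FE) => //.
- by apply: emeasurable_funM => //; exact: measurable_decay.
- by move=> y; exact: integral_ge0.
- by move=> y; rewrite mule_ge0.
move=> y Ky.
apply: (@le_trans _ _ (\int[F]_z ((decay alpha t x y)%:E * (decay alpha t x z)%:E))%E); last first.
  rewrite (ge0_integralTZl F (measurable_decay _ _ _) (de0 x) (decay_ge0 _ _ _ _)) [leLHS]muleC.
  by apply: lee_wpmul2r; [exact: de0|exact: dM].
apply: (integral_law_mono adm FE) => //.
- by apply: emeasurable_funM => //; exact: measurable_decay.
- by move=> z; rewrite mule_ge0.
move=> z Kz; rewrite -EFinM lee_fin; apply: decay_bound => //.
  exact: measurable_clear3.
by move=> w /andP[].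
Qed.

End Exponential.

End PointIntegrals.

(** * Two edges without common endpoint *)

Section FourPointIntegrals.
Context {R : realType} {d' : nat}.
Local Notation d := d'.+1.
Local Notation pt := (pt R d).
Local Notation Rd := (Rd R d).
Local Notation lebd := (@lebesgue_d R d).
Local Notation v := (@unit_vol R d').
Variables (K : set Rd) (f : Rd -> R) (c1 c2 : R).
Hypothesis adm : admissible K f c1 c2.
Variable F : probability Rd R.
Hypothesis FE : forall A : set Rd, measurable A ->
  F A = (\int[lebd]_(x in A) (f x)%:E)%E.
Variable alpha : R.
Hypothesis alpha0 : 0 <= alpha.
Local Notation ball_prob := (@ball_prob R d' f).
Local Notation decay_mass := (@decay_mass R d' c2).

Let c20 : 0 < c2. Proof. exact: adm_c2_gt0 adm. Qed.

Definition clear4 (u : Rd * (Rd * (Rd * Rd))) (w : Rd) : bool :=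
  clear (u.1, u.2.1) w && clear (u.2.2.1, u.2.2.2) w.

Lemma measurable_clear4 :
  measurable_fun setT (fun p : (Rd * (Rd * (Rd * Rd))) * Rd => clear4 p.1 p.2).
Proof.
pose V := (Rd * (Rd * (Rd * Rd)) * Rd)%type.
have h1 : measurable_fun setT (fun p : V => ((p.1.1, p.1.2.1), p.2)) by mpairs.
have h2 : measurable_fun setT (fun p : V => ((p.1.2.2.1, p.1.2.2.2), p.2)) by mpairs.
exact: (measurable_and (measurableT_comp measurable_clear_fun h1)
  (measurableT_comp measurable_clear_fun h2)).
Qed.

Definition wt4 (u : Rd * (Rd * (Rd * Rd))) : R :=
  enorm (u.1 - u.2.1) `^ alpha * enorm (u.2.2.1 - u.2.2.2) `^ alpha.

(** Deliberately asymmetric: the other kind of closeness is this one with the two edges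
    exchanged. *)
Definition near4 (u : Rd * (Rd * (Rd * Rd))) : bool :=
  enorm (u.1 - u.2.2.1) <= 2 * enorm (u.1 - u.2.1).

(* Both conditions together force the balls of the two edges to be disjoint. *)
Definition far4 (u : Rd * (Rd * (Rd * Rd))) : bool :=
  (2 * enorm (u.1 - u.2.1) < enorm (u.1 - u.2.2.1)) &&
  (2 * enorm (u.2.2.1 - u.2.2.2) < enorm (u.1 - u.2.2.1)).

(** The volume of the region near an edge is absorbed as a higher moment of its length. *)
Lemma decay_expn a t (x y : pt) : 0 <= a ->
  enorm (x - y) ^+ d * decay a t x y = decay (a + d%:R) t x y.
Proof.
move=> a0; rewrite /decay powRD; last first.
  by rewrite (gt_eqF (ltr_wpDl a0 _)) ?ltr0n.
rewrite powR_mulrn ?enorm_ge0//; ring.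
Qed.

Section Near.
Variable c0 : R.
Hypothesis c00 : 0 < c0.
Hypothesis c0P : forall x y, K x -> K y -> c0 * enorm (x - y) ^+ d <= ball_prob x y.
Variables (t : R) (m : nat).
Hypothesis t0 : 0 < t.
Hypothesis tm : t <= m%:R * (c0 / 2).

(** First [z'] is integrated freely; then [z], confined to the ball around [x] of radius
    [2 |x - y|], raises the moment of [|x - y|] by [d]; then [y]. The higher moment gains a factor
    [1 / n] over the far configurations. *)
Lemma law_near :
  (\int[F]_x \int[F]_y \int[F]_z \int[F]_z'
    ((near4 (x, (y, (z, z'))))%:R * wt4 (x, (y, (z, z'))) *
     clear_prob F clear4 (x, (y, (z, z'))) ^+ m)%:E <=
   (decay_mass alpha t * (c2 * (v * 2 ^+ d)) * decay_mass (alpha + d%:R) t)%:E)%E.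
Proof.
set M := decay_mass alpha t; set C := c2 * (v * 2 ^+ d).
set M' := decay_mass (alpha + d%:R) t.
have M0 : 0 <= M by exact: (decay_mass_ge0 adm).
have M'0 : 0 <= M' by exact: (decay_mass_ge0 adm).
have C0 : 0 <= C by rewrite mulr_ge0 ?(ltW c20)// mulr_ge0 ?unit_vol_ge0// exprn_ge0.
have MC0 : 0 <= M * C by rewrite mulr_ge0.
pose q (x y z z' : Rd) : \bar R :=
  ((near4 (x, (y, (z, z'))))%:R * wt4 (x, (y, (z, z'))) *
     clear_prob F clear4 (x, (y, (z, z'))) ^+ m)%:E.
have q0 x y z z' : (0 <= q x y z z')%E.
  by rewrite lee_fin !mulr_ge0 ?powR_ge0 ?exprn_ge0 ?clear_prob_ge0.
have ad0 : 0 <= alpha + d%:R by rewrite addr_ge0 ?ler0n.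
have dM x : (\int[F]_y (decay alpha t x y)%:E <= M%:E)%E.
  exact: (law_decay_le adm FE).
have dM' x : (\int[F]_y (decay (alpha + d%:R) t x y)%:E <= M'%:E)%E.
  exact: (law_decay_le adm FE x ad0 t0).
have de0 a (x y : Rd) : (0 <= (decay a t x y)%:E)%E by rewrite lee_fin decay_ge0.
apply: (@le_trans _ _ (\int[F]_x (cst (M * C * M')%:E x))%E); last first.
  by rewrite integral_probability_cst.
clearbody M M'.
apply: (integral_law_mono adm FE).
- exact: measurable_cst.
- by move=> x; do 3 (apply: integral_ge0 => ? _); exact: q0.
- by move=> x; rewrite lee_fin mulr_ge0.
move=> x Kx.
apply: (@le_trans _ _ (\int[F]_y ((M * C)%:E * (decay (alpha + d%:R) t x y)%:E))%E); last first.
  rewrite (ge0_integralTZl F (measurable_decay _ _ _) (de0 _ x) MC0) /cst [leRHS]EFinM.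
  by apply: lee_wpmul2l; [rewrite lee_fin|exact: dM'].
apply: (integral_law_mono adm FE).
- by apply: emeasurable_funM => //; exact: measurable_decay.
- by move=> y; do 2 (apply: integral_ge0 => ? _); exact: q0.
- by move=> y; rewrite mule_ge0 ?lee_fin ?decay_ge0.
move=> y Ky.
have k0 : 0 <= M * decay alpha t x y by rewrite mulr_ge0 ?decay_ge0.
have r0 : 0 <= 2 * enorm (x - y) by rewrite mulr_ge0 ?enorm_ge0.
have mn := measurable_near x (2 * enorm (x - y)).
have n0 (z : Rd) : (0 <= ((enorm (x - z) <= 2 * enorm (x - y))%R%:R : R)%:E)%E by rewrite lee_fin.
apply: (@le_trans _ _ (\int[F]_z ((M * decay alpha t x y)%:E *
    ((enorm (x - z) <= 2 * enorm (x - y))%R%:R : R)%:E))%E); last first.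
  rewrite (ge0_integralTZl F mn n0 k0).
  apply: (@le_trans _ _ ((M * decay alpha t x y)%:E * (c2 * (v * (2 * enorm (x - y)) ^+ d))%:E)%E).
    by apply: lee_wpmul2l; [rewrite lee_fin|exact: (law_ball_le adm FE)].
  rewrite -!EFinM lee_fin -decay_expn// exprMn.
  rewrite le_eqVlt; apply/orP; left; apply/eqP; rewrite /C.
  move: (decay _ _ _ _) (enorm _ ^+ d) (2 ^+ d : R) => p1 p2 p3; ring.
apply: (integral_law_mono adm FE).
- by apply: emeasurable_funM.
- by move=> z; apply: integral_ge0 => ? _; exact: q0.
- by move=> z; rewrite mule_ge0 ?lee_fin.
move=> z Kz.
have k1 : 0 <= (enorm (x - z) <= 2 * enorm (x - y))%R%:R * decay alpha t x y.
  by rewrite mulr_ge0 ?decay_ge0.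
apply: (@le_trans _ _ (\int[F]_z' (((enorm (x - z) <= 2 * enorm (x - y))%R%:R *
   decay alpha t x y)%:E * (decay alpha t z z')%:E))%E); last first.
  rewrite (ge0_integralTZl F (measurable_decay _ _ _) (de0 _ z) k1).
  apply: (@le_trans _ _ (((enorm (x - z) <= 2 * enorm (x - y))%R%:R *
   decay alpha t x y)%:E * M%:E)%E).
    by apply: lee_wpmul2l; [rewrite lee_fin|exact: dM].
  by rewrite -!EFinM lee_fin mulrC mulrA mulrAC.
apply: (integral_law_mono adm FE).
- by apply: emeasurable_funM => //; exact: measurable_decay.
- by move=> z'; exact: q0.
- by move=> z'; rewrite -EFinM lee_fin mulr_ge0 ?decay_ge0.
move=> z' Kz'; rewrite -EFinM lee_fin -[leLHS]mulrA -[leRHS]mulrA.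
apply: ler_wpM2l; first exact: ler0n.
rewrite /wt4/=.
apply: (@decay_bound _ _ _ _ _ _ adm F FE alpha c0 c0P t m tm) => //.
  exact: measurable_clear4.
by move=> w /andP[].
Qed.

End Near.

(** Here no constant may be lost, since the bound has to be the square of the first moment;
    disjointness of the balls makes the integrand at most a product. *)
Lemma law_far m pm : pairint f alpha m = pm%:E ->
  (\int[F]_x \int[F]_y \int[F]_z \int[F]_z'
    ((far4 (x, (y, (z, z'))))%:R * wt4 (x, (y, (z, z'))) *
     clear_prob F clear4 (x, (y, (z, z'))) ^+ m)%:E <= (pm * pm)%:E)%E.
Proof.
move=> pmE.
pose g (p : Rd * Rd) : R := enorm (p.1 - p.2)%R `^ alpha * (1 - ball_prob p.1 p.2) ^+ m.
have mg : measurable_fun setT (fun p => (g p)%:E).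
  apply/measurable_EFinP; apply: measurable_funM.
    by apply: (measurableT_comp (measurable_powR _)); apply: measurable_enormB; mproj.
  by apply: measurable_funX; apply: measurable_funB => //; exact: (measurable_ball_prob adm).
have g0 p : 0 <= g p.
  have /andP[h _] := ball_prob_compl01 adm p.1 p.2.
  by rewrite mulr_ge0 ?powR_ge0 ?exprn_ge0.
have g0E p : (0 <= (g p)%:E)%E by rewrite lee_fin.
have mgx x : measurable_fun setT (fun y => (g (x, y))%:E).
  exact: (measurableT_comp mg (pair1_measurable x)).
have mG := measurable_fun_fubini_tonelli_F (m2 := F) _ mg g0E.
have G0 x : (0 <= \int[F]_y (g (x, y))%:E)%E by apply: integral_ge0 => y _; exact: g0E.
have intg : (\int[F]_x \int[F]_y (g (x, y))%:E = pm%:E)%E.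
  by rewrite -pmE; exact: (law_pairint adm FE).
have pm0 : 0 <= pm by rewrite -lee_fin -intg; exact: integral_ge0.
rewrite [leRHS]EFinM -{2}intg.
rewrite -(ge0_integralTZl F mG G0 pm0).
apply: ge0_le_integral_any => [x|x].
  do 3 (apply: integral_ge0 => ? _).
  by rewrite lee_fin !mulr_ge0 ?powR_ge0 ?exprn_ge0 ?clear_prob_ge0.
rewrite /fubini_F/= -(ge0_integralTZl F (mgx x) _ pm0)//.
apply: ge0_le_integral_any => [y|y].
  do 2 (apply: integral_ge0 => ? _).
  by rewrite lee_fin !mulr_ge0 ?powR_ge0 ?exprn_ge0 ?clear_prob_ge0.
rewrite muleC -{1}intg -(ge0_integralTZl F mG G0 (g0 _)).
apply: ge0_le_integral_any => [z|z].
  apply: integral_ge0 => ? _.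
  by rewrite lee_fin !mulr_ge0 ?powR_ge0 ?exprn_ge0 ?clear_prob_ge0.
rewrite /fubini_F/= -(ge0_integralTZl F (mgx z) _ (g0 _))//.
apply: ge0_le_integral_any => [z'|z'].
  by rewrite lee_fin !mulr_ge0 ?powR_ge0 ?exprn_ge0 ?clear_prob_ge0.
rewrite -EFinM lee_fin /far4/=.
case: andP => [[h1 h2]|_]; last by rewrite !mul0r mulr_ge0.
rewrite mul1r /g/= mulrACA /wt4/= ler_wpM2l ?mulr_ge0 ?powR_ge0//.
rewrite -exprMn lerXn2r ?nnegrE ?clear_prob_ge0//.
  have /andP[h3 _] := ball_prob_compl01 adm x y; have /andP[h4 _] := ball_prob_compl01 adm z z'.
  exact: (mulr_ge0 h3 h4).
apply: (clear_prob_disjoint adm FE) => //.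
- exact: measurable_clear4.
- by move=> w /andP[].
- exact: gball_disjoint.
Qed.

End FourPointIntegrals.

Definition rest (n : nat) (s : seq nat) : seq nat := [seq k <- iota 0 n | k \notin s].

Lemma uniq_cat_rest n s : uniq s -> uniq (s ++ rest n s).
Proof.
move=> us; rewrite cat_uniq us filter_uniq ?iota_uniq// andbT.
by apply/hasPn => k; rewrite mem_filter => /andP[].
Qed.

Lemma size_rest n s : uniq s -> (forall k, k \in s -> (k < n)%N) ->
  size (rest n s) = (n - size s)%N.
Proof.
move=> us sn; have h : perm_eq (s ++ rest n s) (iota 0 n).
  apply: uniq_perm; rewrite ?uniq_cat_rest ?iota_uniq// => k.
  rewrite mem_cat mem_filter mem_iota /= add0n.
  by case: (boolP (k \in s)) => //= /sn ->; rewrite ?leq0n.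
by have := perm_size h; rewrite size_cat size_iota => e; rewrite -[in RHS]e addKn.
Qed.

Lemma sub_rest n s s' : {subset s <= s'} -> {subset rest n s' <= rest n s}.
Proof.
move=> ss k; rewrite !mem_filter => /andP[ks ->]; rewrite andbT.
by apply: contra ks; exact: ss.
Qed.

Lemma natr_and_le (R : realType) (a b c : bool) : (a -> b -> c) ->
  a%:R * b%:R <= c%:R :> R.
Proof.
case: a; case: b => // h; rewrite ?mul0r ?mulr0 ?ler0n//.
by rewrite mulr1 (h isT isT).
Qed.

(** * Expected products of edge weights *)

Section PathWeights.
Context {R : realType} {d' : nat}.
Local Notation d := d'.+1.
Local Notation pt := (pt R d).
Local Notation Rd := (Rd R d).
Local Notation lebd := (@lebesgue_d R d).
Local Notation v := (@unit_vol R d').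
Variables (K : set Rd) (f : Rd -> R) (c1 c2 : R).
Hypothesis adm : admissible K f c1 c2.
Variable F : probability Rd R.
Hypothesis FE : forall A : set Rd, measurable A ->
  F A = (\int[lebd]_(x in A) (f x)%:E)%E.
Context {dT : measure_display} {T : measurableType dT}.
Variables (P : probability T R) (X : nat -> T -> Rd).
Hypothesis mX : forall i, measurable_fun [set: T] (X i).
Hypothesis lawX : forall i B, measurable B -> P (X i @^-1` B) = F B.
Hypothesis indepX : forall (I : seq nat) (B : nat -> set Rd),
  uniq I -> (forall i, measurable (B i)) ->
  P (cyl X I B) = (\prod_(i <- I) P (X i @^-1` B i))%E.
Variable alpha : R.
Hypothesis alpha0 : 0 <= alpha.
Local Notation ball_prob := (@ball_prob R d' f).
Local Notation decay_mass := (@decay_mass R d' c2).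

(** Emptiness is tested by index: a third point that coincides with an endpoint counts as an
    obstacle. This suits independence, and it agrees with the Gabriel graph when the points are
    distinct. *)
Definition edge_weight n i j (w : T) : R :=
  enorm (X i w - X j w) `^ alpha *
  (all (clear (X i w, X j w)) (others X (rest n [:: i; j]) w))%:R.

Lemma edge_weight_ge0 n i j w : 0 <= edge_weight n i j w.
Proof. by rewrite mulr_ge0 ?powR_ge0. Qed.

Lemma measurable_clear_weight dU (U : measurableType dU) (cl : U -> Rd -> bool)
    (Phi : U -> R) (u : T -> U) s :
  measurable_fun setT (fun p : U * Rd => cl p.1 p.2) -> measurable_fun setT Phi ->
  measurable_fun setT u ->
  measurable_fun setT (fun w => Phi (u w) * (all (cl (u w)) (others X s w))%:R).
Proof.
move=> mcl mPhi mu; apply: measurable_funM; first exact: (measurableT_comp mPhi).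
exact: (measurableT_comp (measurable_all_clear mcl (n := size s))
  (measurable_fun_pair mu (measurable_others mX (s := s)))).
Qed.

Let dist (p : Rd * Rd) : R := enorm (p.1 - p.2).

Let mdist a : measurable_fun setT (fun p => dist p `^ a).
Proof. by apply: (measurableT_comp (measurable_powR a)); apply: measurable_enormB; mproj. Qed.

Lemma measurable_edge_weight n i j : measurable_fun setT (edge_weight n i j).
Proof.
exact: (measurable_clear_weight (rest n [:: i; j]) measurable_clear_fun (mdist alpha)
  (measurable_fun_pair (mX i) (mX j))).
Qed.

Lemma expect_edge_power a n i j : i != j -> (i < n)%N -> (j < n)%N ->
  (\int[P]_w (enorm (X i w - X j w)%R `^ a *
    (all (clear (X i w, X j w)) (others X (rest n [:: i; j]) w))%:R)%:E =
   pairint f a (n - 2))%E.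
Proof.
move=> ij i_n j_n; have us : uniq [:: i; j] by rewrite /= inE ij.
rewrite -(law_pairint adm FE).
have := expect2 mX lawX indepX measurable_clear_fun (mdist a) (fun p => powR_ge0 _ _)
  (uniq_cat_rest n us).
rewrite /dist/= => ->; apply: eq_integral => x _; apply: eq_integral => y _.
rewrite (clear_probE adm FE) size_rest// => k; rewrite !inE.
by move=> /orP[]/eqP ->.
Qed.

Lemma expect_edge n i j : i != j -> (i < n)%N -> (j < n)%N ->
  (\int[P]_w (edge_weight n i j w)%:E = pairint f alpha (n - 2))%E.
Proof. exact: expect_edge_power. Qed.

(** The emptiness indicator is its own square, so squaring just doubles the exponent. *)
Lemma expect_edge_sqr n i j : i != j -> (i < n)%N -> (j < n)%N ->
  (\int[P]_w (edge_weight n i j w * edge_weight n i j w)%:E =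
   pairint f (2 * alpha) (n - 2))%E.
Proof.
move=> ij i_n j_n; rewrite -(expect_edge_power _ ij i_n j_n).
apply: eq_integral => w _; rewrite /edge_weight mulrACA; congr (_ * _)%:E.
  by rewrite [2 * alpha]mulrC powRrM powR_mulrn ?powR_ge0// expr2.
by case: all; rewrite ?mulr1 ?mulr0.
Qed.

Lemma edge_weightC n i j w : edge_weight n i j w = edge_weight n j i w.
Proof.
have e : rest n [:: i; j] = rest n [:: j; i].
  by apply: eq_filter => k; rewrite !inE orbC.
rewrite /edge_weight e enorm_distC; congr (_ * (nat_of_bool _)%:R).
by apply: eq_all => z; rewrite /clear /in_gball /= (enorm_distC (X i w)) /mid [X i w + _]addrC.
Qed.

(** A longer list of excluded indices leaves fewer points to test. *)
Lemma all_restS (c c' : Rd -> bool) n s s' w : {subset s <= s'} -> (forall z, c z -> c' z) ->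
  all c (others X (rest n s) w) -> all c' (others X (rest n s') w).
Proof.
move=> ss cc /allP h; apply/allP => _ /mapP[k ks ->]; apply/cc/h.
by apply/map_f/(sub_rest ss).
Qed.

Variable c0 : R.
Hypothesis c00 : 0 < c0.
Hypothesis c0P : forall x y, K x -> K y -> c0 * enorm (x - y) ^+ d <= ball_prob x y.

(** An upper bound results from forgetting that the third endpoint must avoid the other ball too;
    then both balls are tested on the same [n - 3] points. *)
Lemma expect_shared n i j k t : uniq [:: i; j; k] ->
  (i < n)%N -> (j < n)%N -> (k < n)%N -> 0 < t -> t <= (n - 3)%:R * (c0 / 2) ->
  (\int[P]_w (edge_weight n i j w * edge_weight n i k w)%:E <=
   (decay_mass alpha t ^+ 2)%:E)%E.
Proof.
move=> us i_n j_n k_n t0 tm; set s := [:: i; j; k].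
have sz : size (rest n s) = (n - 3)%N.
  by rewrite size_rest// => l; rewrite !inE => /or3P[]/eqP ->.
pose Phi (u : Rd * (Rd * Rd)) := dist (u.1, u.2.1) `^ alpha * dist (u.1, u.2.2) `^ alpha.
have mPhi : measurable_fun setT Phi.
  have h1 : measurable_fun setT (fun u : Rd * (Rd * Rd) => (u.1, u.2.1)) by mpairs.
  have h2 : measurable_fun setT (fun u : Rd * (Rd * Rd) => (u.1, u.2.2)) by mpairs.
  exact: (measurable_funM (measurableT_comp (mdist alpha) h1)
    (measurableT_comp (mdist alpha) h2)).
have Phi0 u : 0 <= Phi u by rewrite mulr_ge0 ?powR_ge0.
have h := expect3 mX lawX indepX measurable_clear3 mPhi Phi0 (uniq_cat_rest n us).
rewrite -sz in tm; have h' := law_shared adm FE alpha0 c0P t0 tm.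
apply: le_trans h'; rewrite -[X in (_ <= X)%E]h.
apply: ge0_le_integral_any => [w|w].
  by rewrite lee_fin mulr_ge0 ?edge_weight_ge0.
rewrite lee_fin /edge_weight mulrACA; apply: ler_wpM2l; first exact: Phi0 (X i w, (X j w, X k w)).
apply: natr_and_le => h1 h2; apply/allP => z zs; apply/andP; split.
  have sub : {subset [:: i; j] <= s} by move=> l; rewrite !inE => /orP[]->; rewrite ?orbT.
  exact: (allP (all_restS sub (fun=> id) h1)).
have sub : {subset [:: i; k] <= s} by move=> l; rewrite !inE => /orP[]->; rewrite ?orbT.
exact: (allP (all_restS sub (fun=> id) h2)).
Qed.

Definition quad i j k l (w : T) := (X i w, (X j w, (X k w, X l w))).

Definition quad_weight (c : Rd * (Rd * (Rd * Rd)) -> bool) n i j k l (w : T) : R :=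
  (c (quad i j k l w))%:R * wt4 alpha (quad i j k l w) *
  (all (clear4 (quad i j k l w)) (others X (rest n [:: i; j; k; l]) w))%:R.

Section Quad.
Variable c : Rd * (Rd * (Rd * Rd)) -> bool.
Hypothesis mc : measurable_fun setT c.

Let Phi u := (c u)%:R * wt4 alpha u.

Let mPhi : measurable_fun setT Phi.
Proof.
apply: measurable_funM.
  have mb : measurable_fun setT (fun b : bool => b%:R : R) by [].
  exact: (measurableT_comp mb mc).
have h1 : measurable_fun setT (fun u : Rd * (Rd * (Rd * Rd)) => (u.1, u.2.1)) by mpairs.
have h2 : measurable_fun setT (fun u : Rd * (Rd * (Rd * Rd)) => (u.2.2.1, u.2.2.2)) by mpairs.
exact: (measurable_funM (measurableT_comp (mdist alpha) h1)
  (measurableT_comp (mdist alpha) h2)).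
Qed.

Lemma quad_weight_ge0 n i j k l w : 0 <= quad_weight c n i j k l w.
Proof. by rewrite !mulr_ge0 ?powR_ge0. Qed.

Lemma measurable_quad_weight n i j k l :
  measurable_fun setT (fun w => (quad_weight c n i j k l w)%:E).
Proof.
apply/measurable_EFinP.
apply: (@measurable_clear_weight _ _ _ Phi (quad i j k l)) => //.
  exact: measurable_clear4.
by do 3 (apply: measurable_fun_pair => //).
Qed.

Lemma expect_quad n i j k l : uniq [:: i; j; k; l] ->
  (\int[P]_w (quad_weight c n i j k l w)%:E =
   \int[F]_x \int[F]_y \int[F]_z \int[F]_z' (Phi (x, (y, (z, z'))) *
     clear_prob F clear4 (x, (y, (z, z'))) ^+ size (rest n [:: i; j; k; l]))%:E)%E.
Proof.
move=> us.
have Phi0 u : 0 <= Phi u by rewrite !mulr_ge0 ?powR_ge0.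
exact: (expect4 mX lawX indepX measurable_clear4 mPhi Phi0 (uniq_cat_rest n us)).
Qed.

End Quad.

Lemma measurable_near4 : measurable_fun setT (@near4 R d').
Proof.
apply: measurable_fun_ler; first by apply: measurable_enormB; mproj.
by apply: measurable_funM => //; apply: measurable_enormB; mproj.
Qed.

Lemma measurable_far4 : measurable_fun setT (@far4 R d').
Proof.
apply: measurable_and; apply: measurable_fun_ltr; last 1 first.
all: try by apply: measurable_enormB; mproj.
all: by apply: measurable_funM => //; apply: measurable_enormB; mproj.
Qed.

(** The same relaxation leaves [n - 4] common points. If the configuration is not far, the distance
    between the first endpoints is at most twice one of the edge lengths: it is near as it stands,
    or near with the edges exchanged. *)
Lemma edge_weight_prod_le n i j k l w :
  edge_weight n i j w * edge_weight n k l w <=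
  quad_weight (@far4 R d') n i j k l w +
  (quad_weight (@near4 R d') n i j k l w + quad_weight (@near4 R d') n k l i j w).
Proof.
have eqr : rest n [:: k; l; i; j] = rest n [:: i; j; k; l].
  apply: eq_filter => m; rewrite !inE; congr (~~ _).
  by do 4 case: (_ == _).
have base : edge_weight n i j w * edge_weight n k l w <=
    wt4 alpha (quad i j k l w) *
    (all (clear4 (quad i j k l w)) (others X (rest n [:: i; j; k; l]) w))%:R.
  rewrite /edge_weight mulrACA; apply: ler_wpM2l; first by rewrite mulr_ge0 ?powR_ge0.
  apply: natr_and_le => h1 h2; apply/allP => z zs; apply/andP; split.
    have sub : {subset [:: i; j] <= [:: i; j; k; l]}.
      by move=> m; rewrite !inE => /orP[]->; rewrite ?orbT.
    exact: (allP (all_restS sub (fun=> id) h1)).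
  have sub : {subset [:: k; l] <= [:: i; j; k; l]}.
    by move=> m; rewrite !inE => /orP[]->; rewrite ?orbT.
  exact: (allP (all_restS sub (fun=> id) h2)).
apply: le_trans base _.
have q0 (c : Rd * (Rd * (Rd * Rd)) -> bool) i' j' k' l' : 0 <= quad_weight c n i' j' k' l' w.
  exact: quad_weight_ge0.
set a := wt4 _ _ * _.
have qE c : quad_weight c n i j k l w = (c (quad i j k l w))%:R * a.
  by rewrite /quad_weight /a mulrA.
have qE' : quad_weight (@near4 R d') n k l i j w = (near4 (quad k l i j w))%:R * a.
  rewrite /quad_weight /a -mulrA; congr (_ * _).
  have -> : wt4 alpha (quad k l i j w) = wt4 alpha (quad i j k l w) by exact: mulrC.
  rewrite eqr; congr (_ * (nat_of_bool _)%:R).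
  by apply: eq_all => z; exact: andbC.
rewrite !qE qE' -!mulrDl; apply: ler_peMl; first by rewrite mulr_ge0 ?mulr_ge0 ?powR_ge0.
rewrite /far4 /near4 /= (enorm_distC (X k w) (X i w)).
move: (enorm (X i w - X k w)) (enorm (X i w - X j w)) (enorm (X k w - X l w)) => r1 r2 r3.
have [h1|h1] := leP r1 (2 * r2); have [h2|h2] := leP r1 (2 * r3); rewrite /= ?add0r ?addr0 ?lerDl//.
Qed.

Lemma expect_disjoint n i j k l t pm : uniq [:: i; j; k; l] ->
  (i < n)%N -> (j < n)%N -> (k < n)%N -> (l < n)%N ->
  0 < t -> t <= (n - 4)%:R * (c0 / 2) -> pairint f alpha (n - 4) = pm%:E ->
  (\int[P]_w (edge_weight n i j w * edge_weight n k l w)%:E <=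
   (pm * pm + 2 * (decay_mass alpha t * (c2 * (v * 2 ^+ d)) *
      decay_mass (alpha + d%:R) t))%:E)%E.
Proof.
move=> us i_n j_n k_n l_n t0 tm pmE.
have us' : uniq [:: k; l; i; j] := etrans (uniq_catC [:: k; l] [:: i; j]) us.
have sz : size (rest n [:: i; j; k; l]) = (n - 4)%N.
  by rewrite size_rest// => m; rewrite !inE => /or4P[]/eqP ->.
have sz' : size (rest n [:: k; l; i; j]) = (n - 4)%N.
  by rewrite size_rest// => m; rewrite !inE => /or4P[]/eqP ->.
have mqf := measurable_quad_weight measurable_far4 n i j k l.
have mqn := measurable_quad_weight measurable_near4 n i j k l.
have mqn' := measurable_quad_weight measurable_near4 n k l i j.
have q0 (c : Rd * (Rd * (Rd * Rd)) -> bool) i' j' k' l' w :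
    (0 <= (quad_weight c n i' j' k' l' w)%:E)%E.
  by rewrite lee_fin quad_weight_ge0.
apply: (@le_trans _ _ (\int[P]_w ((quad_weight (@far4 R d') n i j k l w)%:E +
  ((quad_weight (@near4 R d') n i j k l w)%:E + (quad_weight (@near4 R d') n k l i j w)%:E)))%E).
  apply: ge0_le_integral_any => [w|w].
    by rewrite lee_fin mulr_ge0 ?edge_weight_ge0.
  by rewrite -!EFinD lee_fin edge_weight_prod_le.
have q02 w : (0 <= (quad_weight (@near4 R d') n i j k l w)%:E +
    (quad_weight (@near4 R d') n k l i j w)%:E)%E by rewrite adde_ge0.
rewrite (ge0_integralTD P mqf (emeasurable_funD mqn mqn') (q0 _ i j k l) q02).
rewrite (ge0_integralTD P mqn mqn' (q0 _ i j k l) (q0 _ k l i j)).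
rewrite mulr_natl mulr2n !EFinD; apply: leeD; last apply: leeD.
- rewrite (expect_quad measurable_far4)// sz.
  exact: (law_far adm FE pmE).
- rewrite (expect_quad measurable_near4)// sz.
  exact: (law_near adm FE alpha0 c0P t0 tm).
- rewrite (expect_quad measurable_near4)// sz'.
  exact: (law_near adm FE alpha0 c0P t0 tm).
Qed.

End PathWeights.

Lemma sum_ltn_pairs n : \sum_(p : 'I_n * 'I_n | (p.1 < p.2)%N) 1%N = 'C(n, 2).
Proof.
rewrite -(pair_big_dep xpredT (fun i j : 'I_n => (i < j)%N) (fun _ _ => 1%N)) /=.
rewrite (exchange_big_dep xpredT)//= -bin2_sum big_mkord.
apply: eq_bigr => j _.
rewrite -(big_ord_widen n (fun=> 1%N)) ?(ltnW (ltn_ord j))//.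
by rewrite sum1_card card_ord.
Qed.

(** * Counting pairs of index pairs *)

Section CountPairs.
Variable R : realType.

Definition npairs (n : nat) : R := n%:R * (n%:R - 1) / 2.

Lemma sum_pairs_cst n (c : R) :
  \sum_(p : 'I_n * 'I_n | (p.1 < p.2)%N) c = npairs n * c.
Proof.
rewrite sumr_const -sum1_card sum_ltn_pairs -mulr_natl; congr (_ * _).
rewrite /npairs; apply: (mulIf (x := 2%:R)); rewrite ?pnatr_eq0//.
rewrite divfK ?pnatr_eq0// -natrM.
have := bin_ffact n 2; rewrite (_ : 2`! = 2)%N// => ->.
case: n => [|n]; first by rewrite ffact0n mul0r.
by rewrite ffactnS ffactn1 natrM -natr1 addrK.
Qed.

(** A count of coinciding endpoints rather than a truth value: it can be summed term by term, and it
    is at least 1 when the pairs meet. *)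
Definition shared n (p q : 'I_n * 'I_n) : R :=
  (p.1 == q.1)%:R + (p.1 == q.2)%:R + (p.2 == q.1)%:R + (p.2 == q.2)%:R.

Let sum_eq1 n (j : 'I_n) : \sum_(i : 'I_n) (i == j)%:R = 1 :> R.
Proof.
by rewrite (bigD1 j)//= eqxx big1 ?addr0// => i /negbTE ->.
Qed.

(** Each of the four coincidences fixes one of the four indices and leaves three free. *)
Lemma sum_shared n : \sum_(p : 'I_n * 'I_n) \sum_(q : 'I_n * 'I_n) shared p q = 4 * n%:R ^+ 3.
Proof.
have h (F : 'I_n -> 'I_n -> 'I_n * 'I_n -> R) : (forall k q, \sum_i F i k q = 1) ->
    \sum_(p : 'I_n * 'I_n) \sum_(q : 'I_n * 'I_n) F p.1 p.2 q = n%:R ^+ 3.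
  move=> hF; rewrite exchange_big /=.
  under eq_bigr => q _.
    rewrite -(pair_big xpredT xpredT (fun i k => F i k q)) /= exchange_big /=.
    under eq_bigr do rewrite hF.
    rewrite sumr_const card_ord; over.
  by rewrite sumr_const card_prod card_ord -[LHS]mulr_natr natrM; ring.
have h' (F : 'I_n -> 'I_n -> 'I_n * 'I_n -> R) : (forall k q, \sum_i F k i q = 1) ->
    \sum_(p : 'I_n * 'I_n) \sum_(q : 'I_n * 'I_n) F p.1 p.2 q = n%:R ^+ 3.
  move=> hF; rewrite exchange_big /=.
  under eq_bigr => q _.
    rewrite -(pair_big xpredT xpredT (fun i k => F i k q)) /=.
    under eq_bigr do rewrite hF.
    rewrite sumr_const card_ord; over.
  by rewrite sumr_const card_prod card_ord -[LHS]mulr_natr natrM; ring.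
rewrite /shared.
under eq_bigr do rewrite !big_split /=.
rewrite !big_split /=.
rewrite (h (fun i k q => (i == q.1)%:R)) ?(h (fun i k q => (i == q.2)%:R)); last 2 first.
- by move=> k q; rewrite sum_eq1.
- by move=> k q; rewrite sum_eq1.
rewrite (h' (fun k i q => (i == q.1)%:R)) ?(h' (fun k i q => (i == q.2)%:R)); last 2 first.
- by move=> k q; rewrite sum_eq1.
- by move=> k q; rewrite sum_eq1.
ring.
Qed.

Lemma shared_ge0 n p q : 0 <= @shared n p q.
Proof. by rewrite !addr_ge0. Qed.

Lemma shared_ge1 n (p q : 'I_n * 'I_n) :
  [|| p.1 == q.1, p.1 == q.2, p.2 == q.1 | p.2 == q.2] -> 1 <= shared p q.
Proof.
rewrite /shared; case: (p.1 == q.1); case: (p.1 == q.2); case: (p.2 == q.1);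
  case: (p.2 == q.2) => //= _; rewrite ?mulr1n ?mulr0n; lra.
Qed.

(** [a] stands for two generic edges, [b] for a common endpoint, [c] for equal edges. The first is
    summed exactly, because it carries the limit; the other two are summed over all index pairs. *)
Lemma sum_pairs_bound n (a b c : R) : 0 <= a -> 0 <= b -> 0 <= c ->
  \sum_(p : 'I_n * 'I_n | (p.1 < p.2)%N) \sum_(q : 'I_n * 'I_n | (q.1 < q.2)%N)
     (a + b * shared p q + c * (p == q)%:R) <=
  npairs n ^+ 2 * a + b * (4 * n%:R ^+ 3) + c * n%:R ^+ 2.
Proof.
move=> a0 b0 c0.
have drop (F : 'I_n * 'I_n -> R) : (forall p, 0 <= F p) ->
    \sum_(p : 'I_n * 'I_n | (p.1 < p.2)%N) F p <= \sum_(p : 'I_n * 'I_n) F p.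
  move=> F0; rewrite [leRHS](bigID (fun p : 'I_n * 'I_n => (p.1 < p.2)%N))/= lerDl.
  exact: sumr_ge0.
under eq_bigr do rewrite !big_split /=.
rewrite !big_split /=; apply: lerD; first apply: lerD.
- by under eq_bigr do rewrite sum_pairs_cst; rewrite sum_pairs_cst expr2 mulrA.
- rewrite -sum_shared mulr_sumr; apply: le_trans (drop _ _) _.
    by move=> p; apply: sumr_ge0 => q _; rewrite mulr_ge0 ?shared_ge0.
  apply: ler_sum => p _; rewrite mulr_sumr; apply: drop => q.
  by rewrite mulr_ge0 ?shared_ge0.
- apply: le_trans (drop _ _) _; first by move=> p; apply: sumr_ge0 => q _; rewrite mulr_ge0.
  apply: (@le_trans _ _ (\sum_(p : 'I_n * 'I_n) c)); last first.
    by rewrite sumr_const card_prod card_ord -[leLHS]mulr_natr natrM expr2.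
  apply: ler_sum => p _; apply: le_trans (drop _ _) _; first by move=> q; rewrite mulr_ge0.
  by rewrite -mulr_sumr (bigD1 p)//= eqxx big1 ?addr0 ?mulr1// => q /negbTE; rewrite eq_sym => ->.
Qed.

End CountPairs.

(** * Moments of the edge sum *)

Section EdgeSum.
Context {R : realType} {d' : nat}.
Local Notation d := d'.+1.
Local Notation pt := (pt R d).
Local Notation Rd := (Rd R d).
Local Notation lebd := (@lebesgue_d R d).
Local Notation v := (@unit_vol R d').
Variables (K : set Rd) (f : Rd -> R) (c1 c2 : R).
Hypothesis adm : admissible K f c1 c2.
Variable F : probability Rd R.
Hypothesis FE : forall A : set Rd, measurable A ->
  F A = (\int[lebd]_(x in A) (f x)%:E)%E.
Context {dT : measure_display} {T : measurableType dT}.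
Variables (P : probability T R) (X : nat -> T -> Rd).
Hypothesis mX : forall i, measurable_fun [set: T] (X i).
Hypothesis lawX : forall i B, measurable B -> P (X i @^-1` B) = F B.
Hypothesis indepX : forall (I : seq nat) (B : nat -> set Rd),
  uniq I -> (forall i, measurable (B i)) ->
  P (cyl X I B) = (\prod_(i <- I) P (X i @^-1` B i))%E.
Variable alpha : R.
Hypothesis alpha0 : 0 <= alpha.
Local Notation ball_prob := (@ball_prob R d' f).
Local Notation decay_mass := (@decay_mass R d' c2).
Local Notation W n p w := (edge_weight X alpha n p.1 p.2 w).

Definition edge_sum n w : R := \sum_(p : 'I_n * 'I_n | (p.1 < p.2)%N) W n p w.

Lemma edge_sum_ge0 n w : 0 <= edge_sum n w.
Proof. by apply: sumr_ge0 => p _; exact: edge_weight_ge0. Qed.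

Lemma measurable_edge_sum n : measurable_fun setT (edge_sum n).
Proof.
rewrite /edge_sum; under eq_fun do rewrite -big_filter.
by apply: measurable_sum => p; exact: measurable_edge_weight.
Qed.

Lemma expect_edge_sum n pm : pairint f alpha (n - 2) = pm%:E ->
  (\int[P]_w (edge_sum n w)%:E = (npairs R n * pm)%:E)%E.
Proof.
move=> pmE; rewrite -sum_pairs_cst -sumEFin.
under eq_integral do rewrite /edge_sum -sumEFin -big_filter.
rewrite ge0_integral_sum//; last 2 first.
- by move=> p; apply/measurable_EFinP; exact: measurable_edge_weight.
- by move=> p w _; rewrite lee_fin edge_weight_ge0.
rewrite big_filter; apply: eq_bigr => p lp; rewrite -pmE.
by apply: (expect_edge adm FE mX lawX indepX); rewrite ?ltn_ord// neq_ltn lp.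
Qed.

Variable c0 : R.
Hypothesis c00 : 0 < c0.
Hypothesis c0P : forall x y, K x -> K y -> c0 * enorm (x - y) ^+ d <= ball_prob x y.

Section SecondMoment.
Variables (n : nat) (t pm p2 : R).
Hypothesis t0 : 0 < t.
Hypothesis tn : t <= (n - 4)%:R * (c0 / 2).
Hypothesis pmE : pairint f alpha (n - 4) = pm%:E.
Hypothesis p2E : pairint f (2 * alpha) (n - 2) = p2%:E.

Definition near_mass : R :=
  decay_mass alpha t * (c2 * (v * 2 ^+ d)) * decay_mass (alpha + d%:R) t.

Let near_mass_ge0 : 0 <= near_mass.
Proof.
have c20 := adm_c2_gt0 adm.
apply: mulr_ge0; last exact: (decay_mass_ge0 adm).
apply: mulr_ge0; first exact: (decay_mass_ge0 adm).
by rewrite mulr_ge0 ?(ltW c20)// mulr_ge0 ?unit_vol_ge0 ?exprn_ge0.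
Qed.

Let main_ge0 : 0 <= pm * pm + 2 * near_mass.
Proof.
apply: addr_ge0; first by rewrite -expr2 sqr_ge0.
by apply: mulr_ge0 => //; exact: near_mass_ge0.
Qed.

Let p2_ge0 : 0 <= p2.
Proof.
rewrite -lee_fin -p2E; apply: integral_ge0 => x _; apply: integral_ge0 => y _.
by rewrite lee_fin (pair_ker_ge0 adm).
Qed.

(** The bounds for disjoint, meeting and equal edges are nonnegative and simply added, and each case
    uses one of them. Symmetry of the weights brings a common endpoint to the front. *)
Lemma expect_edge_prod (p q : 'I_n * 'I_n) : (p.1 < p.2)%N -> (q.1 < q.2)%N ->
  (\int[P]_w (W n p w * W n q w)%:E <=
   ((pm * pm + 2 * near_mass) + decay_mass alpha t ^+ 2 * shared R p q +
    p2 * (p == q)%:R)%:E)%E.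
Proof.
case: p q => [i j] [k l] /=; set A := pm * pm + _; set B := _ ^+ 2 => ij kl.
have A0 : 0 <= A by exact: main_ge0.
have B0 : 0 <= B by exact: sqr_ge0.
have tn3 : t <= (n - 3)%:R * (c0 / 2).
  by apply: le_trans tn _; rewrite ler_pM2r ?divr_gt0// ler_nat leq_sub2l.
have s0 := shared_ge0 R (i, j) (k, l).
have e0 : 0 <= p2 * ((i, j) == (k, l))%:R by rewrite mulr_ge0.
have ne (a b : 'I_n) : (a < b)%N -> (a != b :> nat) /\ (b != a :> nat).
  by move=> ab; split; rewrite neq_ltn ab ?orbT.
have nz (a b : 'I_n) : a <> b -> (a != b :> nat) /\ (b != a :> nat).
  by move=> ab; split; apply/eqP => e; apply: ab; apply: val_inj.
have [ij1 ij2] := ne _ _ ij; have [kl1 kl2] := ne _ _ kl.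
have shB x : (x <= B%:E)%E -> 1 <= shared R (i, j) (k, l) ->
    (x <= (A + B * shared R (i, j) (k, l) + p2 * ((i, j) == (k, l))%:R)%:E)%E.
  move=> xB s1; apply: le_trans xB _; rewrite lee_fin.
  have : B * 1 <= B * shared R (i, j) (k, l) by rewrite ler_wpM2l.
  by rewrite mulr1; lra.
have share (a b c : 'I_n) : uniq [:: a : nat; b : nat; c : nat] ->
    (\int[P]_w (W n (a, b) w * W n (a, c) w)%:E <= B%:E)%E.
  by move=> u; apply: (expect_shared adm FE mX lawX indepX alpha0 c0P).
have sw (a b : 'I_n) w : W n (a, b) w = W n (b, a) w by exact: edge_weightC.
have [ik|/nz[ik1 ik2]] := pselect (i = k).
  have [jl|/nz[jl1 jl2]] := pselect (j = l).
    subst k l; rewrite eqxx mulr1.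
    have := expect_edge_sqr adm FE mX lawX indepX alpha ij1 (ltn_ord i) (ltn_ord j).
    move=> ->; rewrite p2E lee_fin.
    have : 0 <= B * shared R (i, j) (i, j) by rewrite mulr_ge0.
    lra.
  subst k; apply: shB; last by apply: shared_ge1; rewrite /= eqxx ?orbT.
  by apply: share; rewrite /= !inE !negb_or ij1 kl1 jl1.
have [il|/nz[il1 il2]] := pselect (i = l).
  subst l; apply: shB; last by apply: shared_ge1; rewrite /= eqxx ?orbT.
  under eq_integral do rewrite (sw k i).
  by apply: share; rewrite /= !inE !negb_or ij1 ik1 (ne _ _ (ltn_trans kl ij)).2.
have [jk|/nz[jk1 jk2]] := pselect (j = k).
  subst k; apply: shB; last by apply: shared_ge1; rewrite /= eqxx ?orbT.
  under eq_integral do rewrite (sw i j).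
  by apply: share; rewrite /= !inE !negb_or ij2 kl1 il1.
have [jl|/nz[jl1 jl2]] := pselect (j = l).
  subst l; apply: shB; last by apply: shared_ge1; rewrite /= eqxx ?orbT.
  under eq_integral do rewrite (sw i j) (sw k j).
  by apply: share; rewrite /= !inE !negb_or ij2 jk1 ik1.
apply: (@le_trans _ _ A%:E).
  apply: (expect_disjoint adm FE mX lawX indepX alpha0 c0P _ _ _ _ _ t0 tn pmE); rewrite ?ltn_ord//.
  by rewrite /= !inE !negb_or ij1 ik1 il1 jk1 jl1 kl1.
have : 0 <= B * shared R (i, j) (k, l) by rewrite mulr_ge0.
by rewrite lee_fin; lra.
Qed.

Lemma expect_edge_sum_sqr :
  (\int[P]_w (edge_sum n w ^+ 2)%:E <=
   (npairs R n ^+ 2 * (pm * pm + 2 * near_mass) +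
    decay_mass alpha t ^+ 2 * (4 * n%:R ^+ 3) + p2 * n%:R ^+ 2)%:E)%E.
Proof.
have A0 : 0 <= pm * pm + 2 * near_mass by exact: main_ge0.
have B0 : 0 <= decay_mass alpha t ^+ 2 by exact: sqr_ge0.
apply: (@le_trans _ _ (\sum_(p : 'I_n * 'I_n | (p.1 < p.2)%N)
   \sum_(q : 'I_n * 'I_n | (q.1 < q.2)%N) \int[P]_w (W n p w * W n q w)%:E)%E); last first.
  apply: (@le_trans _ _ (\sum_(p : 'I_n * 'I_n | (p.1 < p.2)%N)
    \sum_(q : 'I_n * 'I_n | (q.1 < q.2)%N)
     ((pm * pm + 2 * near_mass) + decay_mass alpha t ^+ 2 * shared R p q +
      p2 * (p == q)%:R)%:E)%E).
    by apply: lee_sum => p lp; apply: lee_sum => q lq; exact: expect_edge_prod.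
  under eq_bigr do rewrite sumEFin.
  by rewrite sumEFin lee_fin sum_pairs_bound.
have mW (p q : 'I_n * 'I_n) : measurable_fun setT (fun w => (W n p w * W n q w)%:E).
  apply/measurable_EFinP; apply: measurable_funM; exact: measurable_edge_weight.
have W0 (p q : 'I_n * 'I_n) w : (0 <= (W n p w * W n q w)%:E)%E.
  by rewrite lee_fin mulr_ge0 ?edge_weight_ge0.
pose r := [seq p : 'I_n * 'I_n <- index_enum ('I_n * 'I_n)%type | (p.1 < p.2)%N].
pose G (p : 'I_n * 'I_n) w : \bar R := (\sum_(q <- r) (W n p w * W n q w)%:E)%E.
have mG p : measurable_fun setT (G p) by apply: emeasurable_sum => q; exact: mW.
have G0 p w : (0 <= G p w)%E by apply: sume_ge0 => q _; exact: W0.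
have -> : (\int[P]_w (edge_sum n w ^+ 2)%:E = \int[P]_w \sum_(p <- r) G p w)%E.
  apply: eq_integral => w _; rewrite expr2 /edge_sum -big_filter big_distrlr/= -sumEFin.
  by apply: eq_bigr => p _; rewrite -sumEFin.
rewrite (ge0_integral_sum P measurableT mG (fun p w _ => G0 p w)) big_filter.
apply: lee_sum => p _; rewrite -[leRHS]big_filter.
by rewrite (ge0_integral_sum P measurableT (mW p) (fun q w _ => W0 p q w)).
Qed.

End SecondMoment.
End EdgeSum.

(** Read [x = n], [z = n^(1 + alpha/d)], and [a], [p] as the pair integrals for [alpha] and
    [2 alpha]. The normalization is [z / x^2] and the edge masses are [B / z] and [B' / (z x)], so
    all terms but the leading square acquire a factor [1 / n]. *)
Lemma sqr_arith (R : realType) (x z a B C B' p : R) : 1 <= x -> 0 < z ->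
  0 <= B -> 0 <= C -> 0 <= B' ->
  (z / x ^+ 2) ^+ 2 *
    ((x * (x - 1) / 2) ^+ 2 * (a * a + 2 * (B * z^-1 * C * (B' * (z^-1 / x)))) +
      (B * z^-1) ^+ 2 * (4 * x ^+ 3) + p * x ^+ 2) <=
  (z * a) ^+ 2 / 4 + (B * C * B' / 2 + 4 * B ^+ 2 + z ^+ 2 / x * p) * x^-1.
Proof.
move=> x1 z0 B0 C0 B'0; have x0 : 0 < x by exact: lt_le_trans x1.
have e : (z / x ^+ 2) ^+ 2 *
    ((x * (x - 1) / 2) ^+ 2 * (a * a + 2 * (B * z^-1 * C * (B' * (z^-1 / x)))) +
      (B * z^-1) ^+ 2 * (4 * x ^+ 3) + p * x ^+ 2) =
   ((x - 1) / x) ^+ 2 * ((z * a) ^+ 2 / 4 + B * C * B' / 2 / x) +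
   (4 * B ^+ 2 + z ^+ 2 / x * p) * x^-1.
  by field; rewrite ?(gt_eqF x0) ?(gt_eqF z0).
rewrite e; have ix : 0 < x^-1 by rewrite invr_gt0.
have q01 : 0 <= (x - 1) / x <= 1.
  by rewrite divr_ge0 ?subr_ge0 ?(ltW x0)//= ler_pdivrMr// mul1r gerBl.
have U0 : 0 <= (z * a) ^+ 2 / 4 + B * C * B' / 2 / x.
  by rewrite addr_ge0// divr_ge0 ?sqr_ge0 ?mulr_ge0 ?invr_ge0 ?(ltW x0).
have : ((x - 1) / x) ^+ 2 * ((z * a) ^+ 2 / 4 + B * C * B' / 2 / x) <=
    (z * a) ^+ 2 / 4 + B * C * B' / 2 / x.
  by rewrite ler_piMl// exprn_ile1//; case/andP: q01.
rewrite !mulrDl; lra.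
Qed.

(** * Mean-square convergence of the edge sum *)

Section EdgeSumLimit.
Context {R : realType} {d' : nat}.
Local Notation d := d'.+1.
Local Notation pt := (pt R d).
Local Notation Rd := (Rd R d).
Local Notation lebd := (@lebesgue_d R d).
Local Notation v := (@unit_vol R d').
Variables (K : set Rd) (f : Rd -> R) (c1 c2 : R).
Hypothesis adm : admissible K f c1 c2.
Variable F : probability Rd R.
Hypothesis FE : forall A : set Rd, measurable A ->
  F A = (\int[lebd]_(x in A) (f x)%:E)%E.
Context {dT : measure_display} {T : measurableType dT}.
Variables (P : probability T R) (X : nat -> T -> Rd).
Hypothesis mX : forall i, measurable_fun [set: T] (X i).
Hypothesis lawX : forall i B, measurable B -> P (X i @^-1` B) = F B.
Hypothesis indepX : forall (I : seq nat) (B : nat -> set Rd),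
  uniq I -> (forall i, measurable (B i)) ->
  P (cyl X I B) = (\prod_(i <- I) P (X i @^-1` B i))%E.
Variable alpha : R.
Hypothesis alpha0 : 0 <= alpha.
Local Notation ball_prob := (@ball_prob R d' f).
Local Notation decay_mass := (@decay_mass R d' c2).
Local Notation pair_limit := (@pair_limit R d' K f).

Definition pairint_real (a : R) (m : nat) : R := fine (pairint f a m).

(** The normalized integral converges to a real number, so it is finite from some index on, and the
    positive prefactor passes this to the integral. *)
Lemma pairint_fin a c : 0 <= a ->
  \forall n \near \oo, pairint f a (n - c) = (pairint_real a (n - c))%:E.
Proof.
move=> a0; have /fine_cvgP[h _] := pairint_cvg adm a0 c.
near=> n; have n0 : (0 < n)%N by near: n; exact: nbhs_infty_gt.
have : ((n%:R `^ (1 + a / d%:R))%:E * pairint f a (n - c))%E \is a fin_num by near: n.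
have : 0 < n%:R `^ (1 + a / d%:R) :> R by rewrite powR_gt0 ?ltr0n.
rewrite /pairint_real; case: (pairint f a _) => [r||] //= q0.
  by rewrite gt0_muley.
by rewrite gt0_muleNy.
Unshelve. all: by end_near. Qed.

Lemma pairint_real_cvg a c : 0 <= a ->
  (fun n => n%:R `^ (1 + a / d%:R) * pairint_real a (n - c)) @ \oo --> pair_limit a.
Proof.
move=> a0; have /fine_cvgP[_ h] := pairint_cvg adm a0 c.
apply: cvg_trans h; apply: near_eq_cvg.
have h := pairint_fin c a0; near=> n.
have e : pairint f a (n - c) = (pairint_real a (n - c))%:E by near: n.
by rewrite /= e.
Unshelve. all: by end_near. Qed.

Lemma inv_cvg : (fun n => (n%:R)^-1) @ \oo --> (0 : R).
Proof.
apply/gtr0_cvgV0; first by near=> n; rewrite ltr0n; near: n; exact: nbhs_infty_gt.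
exact: cvgr_idn.
Unshelve. all: by end_near. Qed.

Lemma decay_mass_scale a k x : 0 < k -> 0 < x ->
  decay_mass a (k * x) = decay_mass a k * x `^ (- (1 + a / d%:R)).
Proof. by move=> k0 x0; rewrite /decay_mass powRM ?ltW// !mulrA. Qed.

Definition scale (n : nat) : R := n%:R `^ ((alpha - d%:R) / d%:R).

(** There are about [n^2 / 2] pairs: the normalization of the theorem times [n^2] is the one under
    which [pairint] converges. *)
Lemma scale_sqr n : (0 < n)%N -> scale n * n%:R ^+ 2 = n%:R `^ (1 + alpha / d%:R).
Proof.
move=> n0; have nR : 0 < n%:R :> R by rewrite ltr0n.
rewrite /scale -powR_mulrn// -powRD ?(gt_eqF nR) ?implybT//; congr (_ `^ _).
by rewrite mulrBl divff ?pnatr_eq0//; ring.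
Qed.

Variable c0 : R.
Hypothesis c00 : 0 < c0.
Hypothesis c0P : forall x y, K x -> K y -> c0 * enorm (x - y) ^+ d <= ball_prob x y.

Let L : R := pair_limit alpha / 2.

(** The factor [(1 - 1/n) / 2] is [npairs n / n^2]. *)
Let mean_real (n : nat) : R :=
  (n%:R `^ (1 + alpha / d%:R) * pairint_real alpha (n - 2)) * (1 - n%:R^-1) / 2.

(** For [t = kap n] the condition [t <= (n - 4) c0 / 2] amounts to [n <= 4 (n - 4)], which holds
    from [n = 6] on. *)
Let kap : R := c0 / 8.
Let Cb := decay_mass alpha kap.
Let Cn := Cb * (c2 * (v * 2 ^+ d)) * decay_mass (alpha + d%:R) kap.

Let sqr_real (n : nat) : R :=
  (n%:R `^ (1 + alpha / d%:R) * pairint_real alpha (n - 4)) ^+ 2 / 4 +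
  (Cn / 2 + 4 * Cb ^+ 2 + n%:R `^ (1 + (2 * alpha) / d%:R) * pairint_real (2 * alpha) (n - 2)) * n%:R^-1.

Let kc (r : R) : (fun _ : nat => r) @ \oo --> r.
Proof. exact: cvg_cst. Qed.

Let mean_cvg : mean_real @ \oo --> L.
Proof.
have h : (fun n => 1 - n%:R^-1) @ \oo --> (1 - 0 : R).
  by apply: cvgB; [exact: cvg_cst|exact: inv_cvg].
rewrite subr0 in h.
have := cvgM (cvgM (pairint_real_cvg 2 alpha0) h) (@kc (2^-1)).
by rewrite mulr1; apply.
Qed.

Let sqr_cvg : sqr_real @ \oo --> L ^+ 2.
Proof.
have a20 : 0 <= 2 * alpha by rewrite mulr_ge0.
have h1 := pairint_real_cvg 4 alpha0; have h2 := pairint_real_cvg 2 a20.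
have := cvgD (cvgM (cvgM h1 h1) (@kc (4^-1)))
  (cvgM (cvgD (@kc (Cn / 2 + 4 * Cb ^+ 2)) h2) inv_cvg).
rewrite mulr0 addr0.
rewrite (_ : _ * _ / 4 = L ^+ 2); last by rewrite /L; field.
by apply.
Qed.

Let expect_scaled n (g : T -> R) : measurable_fun setT g -> (forall w, 0 <= g w) ->
  (\int[P]_w (scale n * g w)%:E = (scale n)%:E * \int[P]_w (g w)%:E)%E.
Proof.
move=> mg g0; rewrite -(ge0_integralTZl P) ?powR_ge0//; exact/measurable_EFinP.
Qed.

Let mE n : measurable_fun setT (fun w => scale n * edge_sum X alpha n w).
Proof. by apply: measurable_funM => //; exact: measurable_edge_sum. Qed.

Let E0 n w : 0 <= scale n * edge_sum X alpha n w.
Proof. by rewrite mulr_ge0 ?powR_ge0 ?edge_sum_ge0. Qed.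

Let mean_bound : \forall n \near \oo,
  (\int[P]_w (scale n * edge_sum X alpha n w)%:E = (mean_real n)%:E)%E.
Proof.
have h := pairint_fin 2 alpha0; near=> n.
have n0 : (0 < n)%N by near: n; exact: nbhs_infty_gt.
have nR : n%:R != 0 :> R by rewrite pnatr_eq0 -lt0n.
have e : pairint f alpha (n - 2) = (pairint_real alpha (n - 2))%:E by near: n; exact: h.
have mes : measurable_fun setT (edge_sum X alpha n) by exact: measurable_edge_sum.
rewrite (expect_scaled _ mes (edge_sum_ge0 _ _ _)).
rewrite (expect_edge_sum adm FE mX lawX indepX e) -EFinM; congr (_%:E).
by rewrite /mean_real -scale_sqr// /npairs; field.
Unshelve. all: by end_near. Qed.

Let sqr_bound : \forall n \near \oo,
  (\int[P]_w ((scale n * edge_sum X alpha n w) ^+ 2)%:E <= (sqr_real n)%:E)%E.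
Proof.
have a20 : 0 <= 2 * alpha by rewrite mulr_ge0.
have h := pairint_fin 4 alpha0; have := pairint_fin 2 a20.
move E : (2 * alpha) => a2.
move: (nbhs_infty_ge 6) h; apply: filterS3 => n /= n6 e e2.
have n0 : (0 < n)%N by exact: leq_trans n6.
have x0 : 0 < n%:R :> R by rewrite ltr0n.
have kap0 : 0 < kap by rewrite divr_gt0.
rewrite -E in e2.
have t0 : 0 < kap * n%:R by rewrite mulr_gt0.
have tn : kap * n%:R <= (n - 4)%:R * (c0 / 2).
  have : n%:R <= 4 * (n - 4)%:R :> R by rewrite -natrM ler_nat; lia.
  have : 0 < c0 / 8 by [].
  rewrite /kap; nra.
have mes : measurable_fun setT (edge_sum X alpha n) by exact: measurable_edge_sum.
have -> : (\int[P]_w ((scale n * edge_sum X alpha n w) ^+ 2)%:E =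
    (scale n ^+ 2)%:E * \int[P]_w (edge_sum X alpha n w ^+ 2)%:E)%E.
  rewrite -(ge0_integralTZl P) ?exprn_ge0 ?powR_ge0//.
  - by apply: eq_integral => w _; rewrite exprMn EFinM.
  - by apply/measurable_EFinP; exact: measurable_funX.
  - by move=> w; rewrite lee_fin sqr_ge0.
have := expect_edge_sum_sqr adm FE mX lawX indepX alpha0 c00 c0P t0 tn e e2.
set I := (\int[P]_w _)%E => hI.
apply: (@le_trans _ _ ((scale n ^+ 2)%:E * _)%E).
  by apply: lee_wpmul2l hI; rewrite lee_fin exprn_ge0 ?powR_ge0.
rewrite -EFinM lee_fin /near_mass (decay_mass_scale alpha kap0 x0).
rewrite (decay_mass_scale (alpha + d%:R) kap0 x0) -/Cb.
set b := 1 + alpha / d%:R.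
have -> : n%:R `^ (- (1 + (alpha + d%:R) / d%:R)) = (n%:R `^ b)^-1 / n%:R :> R.
  have -> : - (1 + (alpha + d%:R) / d%:R) = - b + -1.
    by rewrite mulrDl divff ?pnatr_eq0// /b; ring.
  by rewrite powRD ?(gt_eqF x0) ?implybT// powR_inv1 ?(ltW x0)// powRN.
have zE : n%:R `^ (1 + 2 * alpha / d%:R) = (n%:R `^ b) ^+ 2 / n%:R :> R.
  have -> : 1 + 2 * alpha / d%:R = b + b + -1 by rewrite /b; ring.
  by rewrite !powRD ?(gt_eqF x0) ?implybT// powR_inv1 ?(ltW x0)// expr2.
rewrite /sqr_real zE -/b powRN /Cn.
have -> : scale n = n%:R `^ b / n%:R ^+ 2.
  by rewrite -scale_sqr// mulfK// gt_eqF// exprn_gt0.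
set z := n%:R `^ b; have z0 : 0 < z by rewrite powR_gt0.
have Cb0 : 0 <= Cb by exact: (decay_mass_ge0 adm).
have Cb'0 : 0 <= decay_mass (alpha + d%:R) kap by exact: (decay_mass_ge0 adm).
have C0 : 0 <= c2 * (v * 2 ^+ d).
  by rewrite mulr_ge0 ?(ltW (adm_c2_gt0 adm))// mulr_ge0 ?unit_vol_ge0 ?exprn_ge0.
have x1 : 1 <= n%:R :> R by rewrite ler1n.
exact: (sqr_arith _ _ x1 z0 Cb0 C0 Cb'0).
Qed.

Lemma edge_sum_L2 :
  (fun n => \int[P]_w ((scale n * edge_sum X alpha n w - L) ^+ 2)%:E)%E @ \oo --> 0%E.
Proof.
(* Needed below to treat [2 L E Y] as the integral of a nonnegative function; [L] inherits its sign
   from the means. *)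
have L0 : 0 <= L.
  have : mean_real @ \oo --> L by exact: mean_cvg.
  move=> /cvg_lim <- //; apply: limr_ge; first by apply/cvg_ex; exists L; exact: mean_cvg.
  have h := mean_bound; near=> n.
  rewrite -lee_fin -(near h n)//; apply: integral_ge0 => w _; rewrite lee_fin; exact: E0.
have h1 := mean_bound; have h2 := sqr_bound.
have hr : (fun n => sqr_real n + L ^+ 2 - 2 * L * mean_real n) @ \oo --> (0 : R).
  have := cvgB (cvgD sqr_cvg (@kc (L ^+ 2))) (cvgM (@kc (2 * L)) mean_cvg).
  rewrite (_ : L ^+ 2 + L ^+ 2 - 2 * L * L = 0); last by ring.
  by apply.
apply: (@squeeze_cvge _ _ _ _ (fun=> 0%E) _ (fun n => (sqr_real n + L ^+ 2 - 2 * L * mean_real n)%:E)).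
- near=> n; apply/andP; split.
    by apply: integral_ge0 => w _; rewrite lee_fin sqr_ge0.
  have e1 : (\int[P]_w (scale n * edge_sum X alpha n w)%:E = (mean_real n)%:E)%E.
    by near: n; exact: h1.
  have e2 : (\int[P]_w ((scale n * edge_sum X alpha n w) ^+ 2)%:E <= (sqr_real n)%:E)%E.
    by near: n; exact: h2.
  have m1 : measurable_fun setT (fun w => ((scale n * edge_sum X alpha n w - L) ^+ 2)%:E).
    by apply/measurable_EFinP; apply: measurable_funX; exact: measurable_funB.
  have m2 : measurable_fun setT (fun w => (scale n * edge_sum X alpha n w)%:E).
    exact/measurable_EFinP.
  have m3 : measurable_fun setT (fun w => ((2 * L)%:E * (scale n * edge_sum X alpha n w)%:E)%E).
    exact: emeasurable_funM.
  have m4 : measurable_fun setT (fun w => ((scale n * edge_sum X alpha n w) ^+ 2)%:E).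
    by apply/measurable_EFinP; exact: measurable_funX.
  have p1 w : (0 <= ((scale n * edge_sum X alpha n w - L) ^+ 2)%:E)%E by rewrite lee_fin sqr_ge0.
  have p2 w : (0 <= (scale n * edge_sum X alpha n w)%:E)%E by rewrite lee_fin.
  have LL0 : 0 <= 2 * L by rewrite mulr_ge0.
  have p3 w : (0 <= (2 * L)%:E * (scale n * edge_sum X alpha n w)%:E)%E by rewrite mule_ge0.
  have p4 w : (0 <= ((scale n * edge_sum X alpha n w) ^+ 2)%:E)%E by rewrite lee_fin sqr_ge0.
  have p5 (w : T) : (0 <= cst (L ^+ 2)%:E w)%E by rewrite lee_fin sqr_ge0.
  (* The expansion of the square with the cross term moved to the left: all integrands are
     nonnegative and no integrability has to be known. *)
  have id : (\int[P]_w ((scale n * edge_sum X alpha n w - L) ^+ 2)%:E +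
      (2 * L)%:E * \int[P]_w (scale n * edge_sum X alpha n w)%:E =
      \int[P]_w ((scale n * edge_sum X alpha n w) ^+ 2)%:E + (L ^+ 2)%:E)%E.
    rewrite -(ge0_integralTZl P m2 p2 LL0) -(integral_probability_cst P (L ^+ 2)).
    rewrite -(ge0_integralTD P m1 m3 p1 p3) -(ge0_integralTD P m4 (measurable_cst _) p4 p5).
    apply: eq_integral => w _; rewrite /cst -EFinM -!EFinD; congr (_%:E); ring.
  move: id; rewrite e1 -EFinM.
  set I := (\int[P]_w _)%E; set J := (\int[P]_w _)%E in e2 *.
  move=> id; rewrite EFinB leeBrDr// id EFinD leeD2r//.
- exact: cvg_cst.
- by apply/cvg_EFin; [near=> n|].
Unshelve. all: by end_near. Qed.

End EdgeSumLimit.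

(** * Convergence in mean square *)

Section Admissible.
Context {R : realType} {d' : nat}.
Local Notation d := d'.+1.
Local Notation pt := (pt R d).
Local Notation Rd := (Rd R d).
Local Notation lebd := (@lebesgue_d R d).

Lemma dotp_comb (a x y : pt) (s t : R) : dotp a (s *: x + t *: y) = s * dotp a x + t * dotp a y.
Proof.
rewrite /dotp !mulr_sumr -big_split/=; apply: eq_bigr => i _.
by rewrite !mxE; ring.
Qed.

Lemma convex_polyhedron_comb (K : set pt) (x y : pt) (t : R) : convex_polyhedron K ->
  K x -> K y -> 0 <= t <= 1 -> K (t *: x + (1 - t) *: y).
Proof.
move=> [m [a [b ->]]] /= Kx Ky /andP[t0 t1] j; rewrite dotp_comb.
have := Kx j; have := Ky j => h1 h2.
have : t * dotp (a j) x <= t * b j by rewrite ler_wpM2l.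
have : (1 - t) * dotp (a j) y <= (1 - t) * b j by rewrite ler_wpM2l// subr_ge0.
lra.
Qed.

(** The support is closed, hence Borel, and contains every point where [f] is nonzero. *)
Lemma C1_admissible (f : pt -> R) : prob_density f -> C1 f ->
  exists c1 c2, admissible (supp f : set Rd) f c1 c2.
Proof.
move=> [mf [f0 intf]] [polK [c1 [c2 [c10 [c12 fc]]]]]; exists c1, c2; split => //.
- have /closed_openC/open_Rd_measurable/measurableC : closed (supp f) by exact: closed_closure.
  by rewrite setCK.
- by move=> x y t; exact: convex_polyhedron_comb.
- by move=> x /fc[-> ->].
- move=> x Kx; apply: contrapT => /eqP fx; apply: Kx.
  exact: subset_closure.
Qed.

End Admissible.

(** * The Gabriel weight as a sum over index pairs *)

Section GabrielWeight.
Context {R : realType} {d' : nat}.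
Local Notation d := d'.+1.
Local Notation pt := (pt R d).
Local Notation Rd := (Rd R d).
Context {dT : measure_display} {T : measurableType dT}.
Variables (X : nat -> T -> Rd) (alpha : R).

Definition distinct (w : T) := forall i j, i != j -> X i w <> X j w.

(** The graph exempts the endpoints by comparing points, [rest] by comparing indices; for distinct
    points this is the same. *)
Lemma gabriel_edgeE n w i j : distinct w -> (i < n)%N -> (j < n)%N ->
  gabriel_edge [seq (X k w : pt) | k <- iota 0 n] (X i w) (X j w) =
  all (clear (X i w, X j w)) (others X (rest n [:: i; j]) w).
Proof.
move=> dw i_n j_n; apply/idP/idP => /allP h; apply/allP => z.
  move=> /mapP[k]; rewrite mem_filter !inE negb_or => /andP[/andP[ki kj] kn] ->.
  have /h : (X k w : pt) \in [seq (X k w : pt) | k <- iota 0 n] by exact: map_f.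
  have /negbTE -> : (X k w : pt) != X i w by apply/eqP; exact: dw.
  have /negbTE -> : (X k w : pt) != X j w by apply/eqP; exact: dw.
  by rewrite /= /clear /in_gball /= -ltNge.
move=> /mapP[k kn ->]; have [->|ki] := eqVneq k i; first by rewrite eqxx.
have [->|kj] := eqVneq k j; first by rewrite eqxx orbT.
have : X k w \in tval (others X (rest n [:: i; j]) w).
  by apply: map_f; rewrite mem_filter !inE negb_or ki kj.
by move=> /h; rewrite /clear /in_gball /= -ltNge => ->; rewrite orbT.
Qed.

Lemma gabriel_weightE n w : distinct w ->
  gabriel_weight alpha [seq (X k w : pt) | k <- iota 0 n] = edge_sum X alpha n w.
Proof.
move=> dw; rewrite /gabriel_weight undup_id; last first.
  rewrite map_inj_in_uniq ?iota_uniq// => i j _ _ /eqP h.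
  by apply/eqP/negPn/negP => /dw; apply; exact/eqP.
rewrite size_map size_iota /edge_sum.
rewrite -(pair_big_dep xpredT (fun i j : 'I_n => (i < j)%N)
  (fun i j : 'I_n => edge_weight X alpha n i j w)) /=.
have nthE (i : 'I_n) : nth 0 [seq (X k w : pt) | k <- iota 0 n] i = X i w.
  by rewrite (nth_map 0%N) ?size_iota// nth_iota.
apply: eq_bigr => i _; apply: eq_bigr => j _; rewrite !nthE gabriel_edgeE//.
by rewrite /edge_weight; case: all; rewrite ?mulr1 ?mulr0.
Qed.

End GabrielWeight.

(** * Coincidences are null; conclusion *)

Section Main.
Context {R : realType} {d' : nat}.
Local Notation d := d'.+1.
Local Notation pt := (pt R d).
Local Notation Rd := (Rd R d).
Local Notation lebd := (@lebesgue_d R d).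
Variables (K : set Rd) (f : Rd -> R) (c1 c2 : R).
Hypothesis adm : admissible K f c1 c2.
Context {dT : measure_display} {T : measurableType dT}.
Variables (P : probability T R) (X : nat -> T -> Rd).
Hypothesis mX : forall i, measurable_fun [set: T] (X i).
Hypothesis lawf : forall i (B : set Rd), measurable B ->
  P (X i @^-1` B) = (\int[lebd]_(x in B) (f x)%:E)%E.
Hypothesis indepX : mutually_independent P X.
Variable alpha : R.
Hypothesis alpha0 : 0 <= alpha.

Let F : probability Rd R := distribution P (mfun_Sub (mem_set (mX 0%N))).

Let FE (A : set Rd) : measurable A -> F A = (\int[lebd]_(x in A) (f x)%:E)%E.
Proof. by move=> mA; rewrite -(lawf 0%N mA). Qed.

Let lawX i (B : set Rd) : measurable B -> P (X i @^-1` B) = F B.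
Proof. by move=> mB; rewrite FE// lawf. Qed.

(** Distance [<= 0] instead of equality: this is the event that [law_ball_le] bounds at radius 0.
    The diagonal is emptied so that the union may run over all pairs. *)
Let tie i j : set T := if i == j then set0 else [set w | enorm (X i w - X j w) <= 0].

Let measurable_tie i j : measurable (tie i j).
Proof.
rewrite /tie; case: ifP => // _; rewrite -[X in measurable X]setTI.
have m : measurable_fun setT (fun w => enorm (X i w - X j w) <= 0 : bool).
  by apply: measurable_fun_ler => //; exact: measurable_enormB.
by rewrite (_ : [set w | _] = (fun w => enorm (X i w - X j w) <= 0) @^-1` [set true])//; exact: m.
Qed.

(** [expect2] with no further points turns the probability into a double integral, whose inner
    integral is the mass of a ball of radius 0. *)
Let tie_null i j : P (tie i j) = 0%E.
Proof.
have := measurable_tie i j; rewrite /tie; have [//|ij mt] := eqVneq i j.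
pose Phi (p : Rd * Rd) : R := (enorm (p.1 - p.2) <= 0)%R%:R.
have mPhi : measurable_fun setT Phi.
  have mb : measurable_fun setT (fun b : bool => b%:R : R) by [].
  apply: (measurableT_comp mb); apply: measurable_fun_ler => //.
  by apply: measurable_enormB; mproj.
have Phi0 p : 0 <= Phi p by [].
have u : uniq [:: i; j] by rewrite /= inE ij.
have := expect2 mX lawX indepX measurable_clear_fun mPhi Phi0 u.
move=> h; apply/eqP; rewrite eq_le measure_ge0 andbT.
rewrite -[X in P X]setIT -(integral_indic P measurableT mt).
have -> : (\int[P]_w (\1_[set w | enorm (X i w - X j w) <= 0] w)%:E =
  \int[P]_w (Phi (X i w, X j w) * (all (clear (X i w, X j w)) (others X [::] w))%:R)%:E)%E.
  apply: eq_integral => w _; rewrite indicE mulr1; congr ((nat_of_bool _)%:R)%:E.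
  by apply/idP/idP => [/set_mem//|?]; apply/mem_set.
rewrite h; apply: (@le_trans _ _ (\int[F]_x (cst 0%:E x))%E); last first.
  by rewrite integral_probability_cst.
apply: ge0_le_integral_any => [x|x].
  by apply: integral_ge0 => y _; rewrite lee_fin mulr_ge0.
have := law_ball_le adm FE x (lexx 0); rewrite expr0n mulr0 mulr0 => h0.
by under eq_integral do rewrite expr0 mulr1.
Qed.

(* Off this null set [undup] does nothing, so that the weight is a measurable sum. *)
Let ties := \bigcup_i \bigcup_j tie i j.

Let measurable_ties : measurable ties.
Proof. by apply: bigcup_measurable => i _; apply: bigcup_measurable => j _. Qed.

Let ties_null : P ties = 0%E.
Proof.
apply: (iffLR (negligibleP P measurable_ties)).
apply: negligible_bigcup => i; apply: negligible_bigcup => j.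
exact: (iffRL (negligibleP P (measurable_tie i j)) (tie_null i j)).
Qed.

Lemma distinct_off_ties w : ~ ties w -> distinct X w.
Proof.
move=> nt i j ij Xij; apply: nt; exists i => //; exists j => //.
rewrite /tie (negbTE ij) /= Xij subrr.
have /eqP -> : enorm (0 : pt) == 0 by rewrite enorm_eq0.
exact: lexx.
Qed.

(** Squeezed by [edge_sum_L2]: off the ties the two integrands coincide, and
    [ge0_le_integral_off_null] asks measurability of the edge sum alone. *)
Lemma gabriel_weight_L2 :
  (fun n => \int[P]_w ((@scale R d' alpha n *
     gabriel_weight alpha [seq (X i w : pt) | i <- iota 0 n] - pair_limit K f alpha / 2) ^+ 2)%:E)%E
   @ \oo --> 0%E.
Proof.
have [c0 c00 h] := adm_ball_bound adm.
have c0P x y : K x -> K y -> c0 * enorm (x - y) ^+ d <= ball_prob f x y.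
  by move=> Kx Ky; rewrite -lee_fin -(ball_probE adm); exact: h.
have lim := edge_sum_L2 adm FE mX lawX indepX alpha0 c00 c0P.
apply: (squeeze_cvge _ (cvg_cst 0%E) lim).
near=> n; apply/andP; split.
  by apply: integral_ge0 => w _; rewrite lee_fin sqr_ge0.
apply: (@ge0_le_integral_off_null _ _ _ P ties) => //.
- apply/measurable_EFinP; apply: measurable_funX; apply: measurable_funB => //.
  by apply: measurable_funM => //; exact: measurable_edge_sum.
- by move=> w; rewrite lee_fin sqr_ge0.
- by move=> w; rewrite lee_fin sqr_ge0.
by move=> w /distinct_off_ties dw; rewrite gabriel_weightE.
Unshelve. all: by end_near. Qed.

End Main.

Theorem theorem6 (R : realType) (d : nat) (alpha : R)
  (f : pt R d -> R)
  (dT : measure_display) (T : measurableType dT) (P : probability T R)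
  (X : nat -> T -> Rd R d) :
  (0 < d)%N -> 0 <= alpha ->
  prob_density f -> C1 f ->
  (forall i, measurable_fun [set: T] (X i)) ->
  (forall i (B : set (Rd R d)), measurable B ->
     P (X i @^-1` B) = (\int[lebesgue_d (R:=R) (d:=d)]_(x in B) (f x)%:E)%E) ->
  mutually_independent P X ->
  let L := vol_ball R d `^ (- (alpha / d%:R)) * 2 `^ (d%:R + alpha - 1)
           * Gamma (1 + alpha / d%:R)
           * fine (\int[lebesgue_d (R:=R) (d:=d)]_(x in (supp f : set (Rd R d)))
                      ((f x) `^ ((d%:R - alpha) / d%:R))%:E)%E in
  let Y (n : nat) (w : T) : R :=
    n%:R `^ ((alpha - d%:R) / d%:R) *
    gabriel_weight alpha [seq X i w | i <- iota 0 n] in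
  (fun n => (\int[P]_w (((Y n w - L) ^+ 2)%:E))%E) @ \oo --> (0 : \bar R)%E.
Proof.
(* From here on the dimension is a successor, for which the box covers define a measure. *)
case: d f X => // d' f X _ alpha0 densf C1f mX lawX indepX L Y.
have [c1 [c2 adm]] := C1_admissible densf C1f.
have -> : L = pair_limit (supp f) f alpha / 2.
  rewrite /L /pair_limit vol_ballE.
  have -> : 2 `^ (d'.+1%:R + alpha - 1) = 2 `^ (d'.+1%:R + alpha) / 2 :> R.
    by rewrite powRD ?pnatr_eq0 ?implybT// powR_inv1.
  set I := fine _; set G := Gamma _; ring.
exact: (gabriel_weight_L2 adm mX lawX indepX alpha0).
Qed.
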